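(* Let $A,B\in\mathcal{CR}$ and let $\mathcal{J}$ be a proper operator ideal. Then the following conditions are equivalent: (i) there exists $G\in\mathcal{G}\ell_{\mathcal J}$ such that $GA=B$; (ii) $A-B\in\mathcal{J}$ and $N(A)=N(B)$. If any of these conditions holds, then $[P_{R(A)}:P_{R(B)}]=0$. Moreover, if $\mathcal{J}$ is in addition arithmetic mean closed, then the conditions above are also equivalent to: (iii) $|A|-|B|\in\mathcal{J}$, $V_A-V_B\in\mathcal{J}$ and $V_A^*V_A=V_B^*V_B$, where $A=V_A|A|$ and $B=V_B|B|$ are the polar decompositions of $A$ and $B$.
   Context: $\mathcal{H}$ is a separable infinite-dimensional complex Hilbert space, $\mathcal{B}(\mathcal{H})$ the algebra of bounded operators on it. $R(A)$, $N(A)$ denote range and nullspace of $A$; $P_{\mathcal S}$ is the orthogonal projection onto a closed subspace $\mathcal{S}$. $\mathcal{CR}=\{A\in\mathcal{B}(\mathcal{H}): R(A)\text{ is closed}\}$. An operator ideal is a two-sided ideal $\mathcal{J}$ of $\mathcal{B}(\mathcal{H})$; it is proper if $\{0\}\ne\mathcal{J}\neq\mathcal{B}(\mathcal{H})$. $\mathcal{G}\ell_{\mathcal J}=\{G\in\mathcal{B}(\mathcal{H}): G\text{ invertible in }\mathcal{B}(\mathcal{H}),\ G-I\in\mathcal{J}\}$. Polar decomposition: $A=V_A|A|$, $|A|=(A^*A)^{1/2}$, $V_A$ the partial isometry uniquely determined by this identity and $N(V_A)=N(A)$. Essential codimension: a pair $(P,Q)$ of orthogonal projections is a Fredholm pair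 if $QP|_{R(P)}:R(P)\to R(Q)$ is a Fredholm operator, and then $[P:Q]$ is its index, i.e. $[P:Q]=\dim(N(Q)\cap R(P))-\dim(R(Q)\cap N(P))$. Writing $[P:Q]=0$ includes that $(P,Q)$ is a Fredholm pair. For a compact operator $A$, $s(A)=\{s_n(A)\}_{n\ge1}$ is the sequence of singular values (eigenvalues of $|A|$) in non-increasing order with multiplicity. For compact $A,B$, $s(B)\prec_w s(A)$ means $\sum_{i=1}^n s_i(B)\le\sum_{i=1}^n s_i(A)$ for every $n\ge1$. An operator ideal $\mathcal{J}$ is arithmetic mean closed if $A\in\mathcal{J}$ and $s(B)\prec_w s(A)$ imply $B\in\mathcal{J}$ (for compact $A,B$). *)

(* Defs.v *)
From mathcomp Require Export all_boot all_order all_algebra sesquilinear complex.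
From mathcomp Require Export all_classical all_reals all_analysis.

Set Implicit Arguments.
Unset Strict Implicit.
Unset Printing Implicit Defensive.

Export Order.TTheory GRing.Theory Num.Theory.
Export numFieldNormedType.Exports.

Open Scope classical_set_scope.
Open Scope ring_scope.
Open Scope complex_scope.

(* Operators are plain functions [H -> H]; boundedness is the predicate
   [bounded_op], and [\o], [\+], [\-] are the operations on them. Objects that
   exist by a theorem of Hilbert space theory (adjoint, modulus, ...) are total
   functions given by [get], the choice of a witness, as [lim] is. *)

Section Linear.
Context {R : realType} {H : completeNormedModType R[i]}.
Implicit Types (M N S : set H) (T : H -> H) (n : nat).

Definition separable := exists2 D : set H, countable D & dense D.

(* [e] is a basis of the quotient N / S; S and N are subspaces, S included
   in N. *)
Definition has_dim_mod N S n := exists e : 'I_n -> H,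
  [/\ forall i, N (e i),
      forall c : 'I_n -> R[i], S (\sum_i c i *: e i) -> forall i, c i = 0
    & forall x, N x -> exists c : 'I_n -> R[i], S (x - \sum_i c i *: e i)].

Definition has_dim N n := has_dim_mod N [set 0] n.

(* Arbitrary values when the (co)dimension is infinite. *)
Definition dim N : nat := get [set n | has_dim N n].
Definition codim N S : nat := get [set n | has_dim_mod N S n].

Definition kernel T : set H := [set x | T x = 0].

Definition bounded_op T := linear T /\ continuous T.

Definition closed_range T := bounded_op T /\ closed (range T).

Definition compact_op T :=
  bounded_op T /\ precompact (T @` [set x | `|x| <= 1]).

(* The restriction of T to an operator M -> N is Fredholm. *)
Definition fredholm M N T :=
  [/\ T @` M `<=` N, closed (T @` M),
      exists n, has_dim (M `&` kernel T) n
    & exists n, has_dim_mod N (T @` M) n].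

Definition fredholm_index M N T : int :=
  (dim (M `&` kernel T))%:Z - (codim N (T @` M))%:Z.

Definition fredholm_pair (P Q : H -> H) :=
  fredholm (range P) (range Q) (Q \o P).

Definition ess_codim (P Q : H -> H) : int :=
  fredholm_index (range P) (range Q) (Q \o P).

Definition operator_ideal (J : set (H -> H)) :=
  [/\ J `<=` bounded_op, J (fun=> 0),
      forall K L, J K -> J L -> J (K \+ L)
    & forall K T, J K -> bounded_op T -> J (T \o K) /\ J (K \o T)].

Definition proper_ideal (J : set (H -> H)) :=
  [/\ operator_ideal J, J <> [set (fun=> 0)] & J <> bounded_op].

Definition GLJ (J : set (H -> H)) : set (H -> H) := [set G |
  [/\ bounded_op G,
      exists G', [/\ bounded_op G', G \o G' = id & G' \o G = id]
    & J (G \- id)]].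

End Linear.

Arguments separable {R} H.

Section Hilbert.
Context {R : realType} {H : completeNormedModType R[i]}.
(* Linear in the first argument, conjugate-linear in the second. *)
Variable ip : {dot H for Num.conj}.
Implicit Types (S : set H) (A T V : H -> H) (s : nat -> R).

Definition adjoint T : H -> H :=
  fun y => get [set z | forall x, ip (T x) y = ip x z].

Definition ortho_proj S : H -> H :=
  fun x => get [set y | S y /\ forall z, S z -> ip (x - y) z = 0].

(* The order on [R[i]] makes [0 <= z] entail that [z] is real. *)
Definition positive_op T := bounded_op T /\ forall x, 0 <= ip (T x) x.

Definition modulus A : H -> H :=
  get [set M | positive_op M /\ M \o M = adjoint A \o A].

Definition partial_isometry V := bounded_op V /\
  forall x, (forall z, kernel V z -> ip x z = 0) -> `|V x| = `|x|.

Definition polar_isometry A : H -> H :=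
  get [set V | [/\ partial_isometry V, A = V \o modulus A
                 & kernel V = kernel A]].

(* [s] lists, in non-increasing order, the positive eigenvalues of the modulus
   with their multiplicities, followed by zeros if there are finitely many. *)
Definition lists_singular_values A s :=
  [/\ forall n, 0 <= s n,
      forall m n, (m <= n)%N -> s n <= s m
    & forall l : R, 0 < l ->
        exists2 n, has_dim [set x | modulus A x = l%:C *: x] n
                 & ([set k | s k = l] #= `I_n)%card].

(* Indexed from 0. *)
Definition singular_values A : nat -> R := get [set s | lists_singular_values A s].

Definition weakly_majorized (s t : nat -> R) :=
  forall n, \sum_(i < n) s i <= \sum_(i < n) t i.

Definition am_closed (J : set (H -> H)) := forall A B,
  compact_op A -> compact_op B -> J A ->
  weakly_majorized (singular_values B) (singular_values A) -> J B.

End Hilbert.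

(* Main.v *)
(**
A proper ideal of a separable Hilbert space consists of compact operators (Calkin), so
[I + K] with [K] in [J] is Fredholm of index zero.  Let [A'] be the pseudo-inverse of [A]; it
is bounded because [A] has closed range.  If [N(A) = N(B)], then [T = I + (B - A) A'] satisfies
[T A = B] and is injective on [R(A)]; adding a finite-rank operator that kills [R(A)] and maps
[N(T)] onto a complement of [R(T)] makes it invertible, which is the [G] of (i).  Conversely
[A - G A = (I - G) A].  For the essential codimension, the restriction of [P_{R(B)}] to [R(A)]
is carried by [G] to the restriction of [I - P_{R(B)} K G^-1 P_{R(B)}] to [R(B)], where
[G = I + K], again of index zero.

For (ii) -> (iii), put [X = |A| - |B|].  Then [|A| X + X |B| = A*A - B*B] lies in [J]; being
arithmetic mean closed is what gives [(A - B)* \in J].  With [P] the projection onto [N(A)^\perp] and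
[t] small, [X = (P/2 - t|A|) X + X (P/2 - t|B|) + t (A*A - B*B)], and both coefficients have norm
[q < 1/2] since [|A|] and [|B|] are bounded below on [N(A)^\perp].  Hence the Ky Fan norms of [X]
are at most [t / (1 - 2q)] times those of [A*A - B*B], and [X \in J].  The polar factors are
[A |A|^+] and [B |B|^+], whose difference is then in [J] by the resolvent identity.
*)
Require Import Defs.
From mathcomp Require Import finmap ring lra.

Set Implicit Arguments.
Unset Strict Implicit.
Unset Printing Implicit Defensive.

(** * Norms and inner products *)

Section ComplexAbs.
Context {R : realType}.
Implicit Types (z w : R[i]) (x : R).

(** The equation [X = U X + X V + t D] for the difference [X] of the moduli is exploited twice.
    Singular values of [X] are under control only once [X] is compact, and its compactness is not
    given: it comes from a first pass with the essential norm, in which the compact [D] costs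
    nothing and the factor [2q < 1] forces the norm to vanish. The second pass absorbs the Ky Fan
    norms. The weight 1/2 comes from sharing [X = P X = X P] equally between left and right
    multiplication: each coefficient is then half of a strict contraction, and the two together stay
    below 1.

    Compactness is handled as smallness off a finite set of vectors. This reduces Riesz theory to a
    Neumann series and matrix algebra, and lets singular values be produced by deflating top
    eigenvectors, without a spectral theorem; [compact_op] is met only where [am_closed] is applied.
    The order of [R[i]] being partial, estimates are carried out with the real-valued copies [cabs]
    and [hnorm] of the modulus and the norm. *)

Definition cabs z : R := complex.Re `|z|.

Lemma cabsE z : `|z| = (cabs z)%:C.
Proof. by rewrite /cabs RRe_real ?normr_real. Qed.

Lemma cabs_ge0 z : 0 <= cabs z.
Proof. by rewrite -ler0c -cabsE. Qed.

Lemma cabsM z w : cabs (z * w) = cabs z * cabs w.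
Proof. by apply: complexI; rewrite rmorphM/= -!cabsE normrM. Qed.

Lemma cabsD z w : cabs (z + w) <= cabs z + cabs w.
Proof. by rewrite -lecR rmorphD/= -!cabsE ler_normD. Qed.

Lemma cabsN z : cabs (- z) = cabs z.
Proof. by rewrite /cabs normrN. Qed.

Lemma cabs0 : cabs 0 = 0.
Proof. by rewrite /cabs normr0. Qed.

Lemma cabs1 : cabs 1 = 1.
Proof. by rewrite /cabs normr1. Qed.

Lemma cabs_eq0 z : (cabs z == 0) = (z == 0).
Proof. by rewrite -(normr_eq0 z) cabsE (inj_eq (@complexI R)). Qed.

Lemma cabsV z : cabs z^-1 = (cabs z)^-1.
Proof. by apply: complexI; rewrite fmorphV/= -!cabsE normfV. Qed.

Lemma cabs_real x : cabs x%:C = `|x|.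
Proof.
by rewrite /cabs normc_def/= expr0n/= addr0 sqrtr_sqr.
Qed.

Lemma cabs_pos x : 0 <= x -> cabs x%:C = x.
Proof. by move=> ?; rewrite cabs_real ger0_norm. Qed.

Lemma conjE z : Num.conj z = z^*%C.
Proof. by []. Qed.

Lemma conj_real x : Num.conj x%:C = x%:C :> R[i].
Proof. by rewrite conjE conjc_real. Qed.

Lemma cabsJ z : cabs (Num.conj z) = cabs z.
Proof. by rewrite /cabs conjE normcJ. Qed.

Lemma Re_le_cabs z : complex.Re z <= cabs z.
Proof.
have := normc_ge_Re z; rewrite cabsE lecR; apply: le_trans; exact: ler_norm.
Qed.

Lemma cabs_sum (I : Type) (r : seq I) (P : pred I) (F : I -> R[i]) :
  cabs (\sum_(i <- r | P i) F i) <= \sum_(i <- r | P i) cabs (F i).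
Proof.
by rewrite -lecR rmorph_sum/= -cabsE (le_trans (ler_norm_sum _ _ _))//
  (eq_bigr _ (fun i _ => cabsE (F i))).
Qed.

Lemma real_ge0 z : 0 <= z -> z = (complex.Re z)%:C.
Proof. by move=> z0; apply/esym/(@RRe_real R)/ger0_real. Qed.

Lemma cabs_sqr z : cabs z ^+ 2 = complex.Re z ^+ 2 + complex.Im z ^+ 2.
Proof. by apply: complexI; rewrite rmorphXn/= -cabsE -add_Re2_Im2. Qed.

End ComplexAbs.

Section Norm.
Context {R : realType} {H : completeNormedModType R[i]}.
Implicit Types (x y z : H) (c : R[i]).

Definition hnorm x : R := complex.Re `|x|.

Lemma hnormE x : `|x| = (hnorm x)%:C.
Proof. by apply/esym/(@RRe_real R)/normr_real. Qed.

Lemma hnorm_ge0 x : 0 <= hnorm x.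
Proof. by rewrite -ler0c -hnormE. Qed.

Lemma hnormZ c x : hnorm (c *: x) = cabs c * hnorm x.
Proof. by apply: complexI; rewrite rmorphM/= -hnormE -cabsE -hnormE normrZ. Qed.

Lemma hnormD x y : hnorm (x + y) <= hnorm x + hnorm y.
Proof. by rewrite -lecR rmorphD/= -!hnormE ler_normD. Qed.

Lemma hnormN x : hnorm (- x) = hnorm x.
Proof. by rewrite /hnorm normrN. Qed.

Lemma hnormB x y : hnorm (x - y) <= hnorm x + hnorm y.
Proof. by rewrite -(hnormN y) hnormD. Qed.

Lemma hnorm_distC x y : hnorm (x - y) = hnorm (y - x).
Proof. by rewrite -opprB hnormN. Qed.

Lemma hnorm0 : hnorm 0 = 0.
Proof. by rewrite /hnorm normr0. Qed.

Lemma hnorm_eq0 x : (hnorm x == 0) = (x == 0).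
Proof. by rewrite -(normr_eq0 x) hnormE (inj_eq (@complexI R)). Qed.

Lemma hnorm_gt0 x : (0 < hnorm x) = (x != 0).
Proof. by rewrite lt_def hnorm_ge0 andbT hnorm_eq0. Qed.

Lemma hnorm_le0 x : hnorm x <= 0 -> x = 0.
Proof.
by move=> x0; apply/eqP; rewrite -hnorm_eq0 eq_le x0 hnorm_ge0.
Qed.

Lemma hnorm_dist_trans y x z : hnorm (x - z) <= hnorm (x - y) + hnorm (y - z).
Proof. by rewrite (le_trans _ (hnormD _ _))// addrA subrK. Qed.

Definition cvgs (u : nat -> H) x :=
  forall e : R, 0 < e -> exists N, forall n, (N <= n)%N -> hnorm (u n - x) < e.

Definition cauchys (u : nat -> H) :=
  forall e : R, 0 < e -> exists N, forall m n, (N <= m)%N -> (N <= n)%N ->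
    hnorm (u m - u n) < e.

Lemma gt0_complex (e : R[i]) : 0 < e -> exists2 r : R, 0 < r & e = r%:C.
Proof.
move=> e0; have h := real_ge0 (ltW e0); exists (complex.Re e) => //.
by rewrite -ltcR -h.
Qed.

Lemma cvgsP (u : nat -> H) x : cvgs u x <-> u @ \oo --> x.
Proof.
split=> [ux|/cvgrPdist_lt ux e e0].
  apply/cvgrPdist_lt => _ /gt0_complex[e e0 ->].
  have [N NP] := ux e e0; exists N => // n /NP.
  by rewrite hnormE ltcR hnorm_distC.
have [|N _ NP] := ux e%:C; first by rewrite ltcR.
by exists N => n /NP; rewrite hnormE ltcR hnorm_distC.
Qed.

Lemma cauchys_cvg (u : nat -> H) : cauchys u -> exists x, cvgs u x.
Proof.
move=> cu; suff /cauchy_cvgP/cvg_ex[l ul] : cauchy (u @ \oo).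
  by exists l; apply/cvgsP.
apply/cauchy_ballP => _ /gt0_complex[e e0 ->].
have [N NP] := cu e e0.
pose A := u @` [set n | (N <= n)%N].
exists (A, A) => /=; first by split; exists N => // n Nn; exists n.
move=> _ /= [[m Nm <-] [n Nn <-]].
by rewrite -ball_normE /= hnormE ltcR NP.
Qed.

Lemma cvgs_unique (u : nat -> H) x y : cvgs u x -> cvgs u y -> x = y.
Proof.
move=> ux uy; apply/eqP; rewrite -subr_eq0; apply: contraT => xy.
have e0 : 0 < hnorm (x - y) / 2 by rewrite divr_gt0// hnorm_gt0.
have [N NP] := ux _ e0; have [M MP] := uy _ e0.
have := hnorm_dist_trans (u (maxn N M)) x y.
have := NP _ (leq_maxl N M); have := MP _ (leq_maxr N M).
rewrite (hnorm_distC _ x); lra.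
Qed.

Lemma closed_cvgs (S : set H) (u : nat -> H) x :
  closed S -> (forall n, S (u n)) -> cvgs u x -> S x.
Proof.
move=> cS Su /cvgsP ux; apply: (@closed_cvg _ _ \oo _ u S cS _ _ ux).
by apply: nearW.
Qed.

Lemma closedI_cvgs (S : set H) :
  (forall (u : nat -> H) x, (forall n, S (u n)) -> cvgs u x -> S x) -> closed S.
Proof.
move=> hS x clx.
have h n : exists y, S y /\ hnorm (y - x) < n.+1%:R^-1.
  have n0 : (0 : R[i]) < (n.+1%:R^-1 : R)%:C by rewrite ltcR invr_gt0.
  have [y []] := clx (ball x (n.+1%:R^-1 : R)%:C) (nbhsx_ballx x _ n0).
  by rewrite -ball_normE /= hnormE ltcR hnorm_distC => Sy xy; exists y.
have [u uP] := choice h.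
apply: (hS u); first by move=> n; case: (uP n).
move=> e e0; exists (Num.truncn e^-1) => n Nn.
apply: (lt_trans (uP n).2).
rewrite invf_plt ?posrE//.
by apply: (lt_le_trans (truncnS_gt _)); rewrite ler_nat ltnS.
Qed.

Lemma cvgs_cst x : cvgs (fun=> x) x.
Proof. by move=> e e0; exists 0%N => n _; rewrite subrr hnorm0. Qed.

Lemma cvgsD u v x y : cvgs u x -> cvgs v y -> cvgs (fun n => u n + v n) (x + y).
Proof.
move=> ux vy e e0.
have e2 : 0 < e / 2 by rewrite divr_gt0.
have [N NP] := ux _ e2; have [M MP] := vy _ e2; exists (maxn N M) => n.
rewrite geq_max => /andP[/NP h1 /MP h2].
rewrite opprD addrACA (le_lt_trans (hnormD _ _))//; lra.
Qed.

Lemma cvgsZ c u x : cvgs u x -> cvgs (fun n => c *: u n) (c *: x).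
Proof.
move=> ux e e0.
have c1 : 0 < cabs c + 1 by have := cabs_ge0 c; lra.
have [|N NP] := ux (e / (cabs c + 1)); first by rewrite divr_gt0.
exists N => n /NP; rewrite ltr_pdivlMr// -scalerBr hnormZ; apply: le_lt_trans.
rewrite mulrC ler_wpM2l ?hnorm_ge0// lerDl; lra.
Qed.

Lemma hnorm_cvgs_le u x (C : R) N :
  cvgs u x -> (forall n, (N <= n)%N -> hnorm (u n) <= C) -> hnorm x <= C.
Proof.
move=> ux uC; apply/ler_addgt0Pr => e e0.
have [M MP] := ux e e0.
have := MP _ (leq_maxr N M); have := uC _ (leq_maxl N M).
have := hnorm_dist_trans (u (maxn N M)) x 0; rewrite !subr0 hnorm_distC; lra.
Qed.

Lemma cvgs_ext u v x : u =1 v -> cvgs u x -> cvgs v x.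
Proof. by move=> /funext ->. Qed.

Lemma dominated_increments (u : nat -> H) (a : nat -> R) m n :
  (forall n, hnorm (u n.+1 - u n) <= a n.+1 - a n) -> (m <= n)%N ->
  hnorm (u n - u m) <= a n - a m.
Proof.
move=> ua; elim: n => [|n IH]; first by rewrite leqn0 => /eqP->; rewrite !subrr hnorm0.
rewrite leq_eqVlt => /predU1P[<-|]; first by rewrite !subrr hnorm0.
rewrite ltnS => /IH h; have := hnorm_dist_trans (u n) (u n.+1) (u m).
have := ua n; lra.
Qed.

(** Telescoping compares [u] with the bounded nondecreasing scalar sequence [a]. The Neumann series,
    the gliding hump and the square root iteration all converge by exhibiting such an [a]. *)
Lemma cauchys_dominated (u : nat -> H) (a : nat -> R) (C : R) :
  (forall n, hnorm (u n.+1 - u n) <= a n.+1 - a n) ->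
  (forall n, a n <= C) -> cauchys u.
Proof.
move=> ua aC; have mono := dominated_increments ua.
have ndec m n : (m <= n)%N -> a m <= a n.
  by move=> /mono; have := hnorm_ge0 (u n - u m); lra.
have hS : has_sup (range a) by split; [exists (a 0%N), 0%N | exists C => _ [n _ <-]].
move=> e e0; have [_ [N _ <-] hN] := sup_adherent e0 hS.
have ub n : a n <= sup (range a) by apply: ub_le_sup; [case: hS|exists n].
have key m n : (N <= m)%N -> (m <= n)%N -> hnorm (u m - u n) < e.
  move=> Nm mn; rewrite hnorm_distC (le_lt_trans (mono _ _ mn))//.
  have := ub n; have := ndec _ _ Nm; lra.
exists N => m n Nm Nn; case: (leqP m n) => [mn|/ltnW nm]; first exact: key.
by rewrite hnorm_distC key.
Qed.

End Norm.

Section BoundedOp.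
Context {R : realType} {H : completeNormedModType R[i]}.
Implicit Types (x y z : H) (c : R[i]) (S T : H -> H).

Lemma bounded_opP T : bounded_op T <->
  linear T /\ exists2 C : R, 0 <= C & forall x, hnorm (T x) <= C * hnorm x.
Proof.
split=> [[lT cT]|[lT [C C0 TC]]]; split=> //.
- have T0 : T 0 = 0 by have := lT (-1) 0 0; rewrite scaleN1r oppr0 addr0 scaleN1r addNr.
  have TZ c x : T (c *: x) = c *: T x by rewrite -[c *: x]addr0 lT T0 addr0.
  have /cvgrPdist_lt/(_ 1 ltr01) := cT 0.
  rewrite T0 => /nbhs_ballP[_ /gt0_complex[e e0 ->] eP].
  have e2 : 0 < e / 2 by rewrite divr_gt0.
  exists (e / 2)^-1; first by rewrite invr_ge0 ltW.
  move=> x; have [->|x0] := eqVneq x 0; first by rewrite T0 hnorm0 mulr0.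
  have nx : 0 < hnorm x by rewrite hnorm_gt0.
  have := eP ((e / 2 / hnorm x)%:C *: x).
  rewrite -ball_normE /= !sub0r !normrN !hnormE TZ !hnormZ cabs_pos; last first.
    by rewrite divr_ge0// ltW.
  rewrite divfK ?gt_eqF// -(rmorph1 (real_complex R)) !ltcR => /(_ _)/ltW.
  rewrite mulrAC ler_pdivrMr// mul1r => h.
  rewrite [leRHS]mulrC ler_pdivlMr// mulrC; apply: h; lra.
- move=> x; apply/cvgrPdist_lt => _ /gt0_complex[e e0 ->].
  have C1 : 0 < C + 1 by lra.
  apply/nbhs_ballP; exists (e / (C + 1))%:C; first by rewrite /= ltcR divr_gt0.
  move=> y; rewrite -ball_normE /= !hnormE !ltcR ltr_pdivlMr//.
  have -> : T x - T y = T (x - y).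
    by rewrite [x - y]addrC -[- y]scaleN1r lT scaleN1r addrC.
  apply: le_lt_trans; rewrite (le_trans (TC _))// mulrC ler_wpM2l ?hnorm_ge0//; lra.
Qed.

Lemma bounded_opI T C : linear T -> (forall x, hnorm (T x) <= C * hnorm x) ->
  bounded_op T.
Proof.
move=> lT TC; apply/bounded_opP; split=> //; exists `|C|; first exact: normr_ge0.
by move=> x; rewrite (le_trans (TC x))// ler_wpM2r ?hnorm_ge0// ler_norm.
Qed.

Lemma bounded_op_pos T : bounded_op T ->
  exists2 C : R, 0 < C & forall x, hnorm (T x) <= C * hnorm x.
Proof.
move=> /bounded_opP[_ [C C0 TC]]; exists (C + 1); first by lra.
by move=> x; rewrite (le_trans (TC x))// ler_wpM2r ?hnorm_ge0//; lra.
Qed.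

Section Linear.
Variable T : H -> H.
Hypothesis bT : bounded_op T.

Lemma bop0 : T 0 = 0.
Proof.
by have := bT.1 (-1) 0 0; rewrite scaleN1r oppr0 addr0 scaleN1r addNr.
Qed.

Lemma bopZ c x : T (c *: x) = c *: T x.
Proof. by rewrite -[c *: x]addr0 bT.1 bop0 addr0. Qed.

Lemma bopD x y : T (x + y) = T x + T y.
Proof. by rewrite -{1}[x]scale1r bT.1 scale1r. Qed.

Lemma bopN x : T (- x) = - T x.
Proof. by rewrite -scaleN1r bopZ scaleN1r. Qed.

Lemma bopB x y : T (x - y) = T x - T y.
Proof. by rewrite bopD bopN. Qed.

Lemma bop_sum (I : Type) (r : seq I) (P : pred I) (F : I -> H) :
  T (\sum_(i <- r | P i) F i) = \sum_(i <- r | P i) T (F i).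
Proof. exact: (big_morph T bopD bop0). Qed.

Lemma bop_cvgs u x : cvgs u x -> cvgs (T \o u) (T x).
Proof.
move=> ux e e0; have [C C0 TC] := bounded_op_pos bT.
have [|N NP] := ux (e / C); first by rewrite divr_gt0.
exists N => n /NP; rewrite ltr_pdivlMr// mulrC => h /=.
by rewrite -bopB (le_lt_trans (TC _)).
Qed.

End Linear.

Lemma bounded_op_comp S T : bounded_op S -> bounded_op T -> bounded_op (S \o T).
Proof.
move=> bS bT; have [C C0 SC] := bounded_op_pos bS.
have [D D0 TD] := bounded_op_pos bT.
apply: (@bounded_opI _ (C * D)) => [c x y /=|x /=].
  by rewrite bT.1 bS.1.
by rewrite (le_trans (SC _))// -mulrA ler_wpM2l// ltW.
Qed.

Lemma bounded_op_add S T : bounded_op S -> bounded_op T -> bounded_op (S \+ T).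
Proof.
move=> bS bT; have [C C0 SC] := bounded_op_pos bS.
have [D D0 TD] := bounded_op_pos bT.
apply: (@bounded_opI _ (C + D)) => [c x y /=|x /=].
  by rewrite bT.1 bS.1 scalerDr addrACA.
by rewrite (le_trans (hnormD _ _))// mulrDl lerD.
Qed.

Lemma bounded_op_scale c : bounded_op (fun x : H => c *: x).
Proof.
apply: (@bounded_opI _ (cabs c)) => [a x y|x]; last by rewrite hnormZ.
by rewrite scalerDr !scalerA mulrC.
Qed.

Lemma bounded_op_id : bounded_op (@id H).
Proof. by apply: (@bounded_opI _ 1) => // x; rewrite mul1r. Qed.

Lemma bounded_op0 : bounded_op (fun=> 0 : H).
Proof.
by apply: (@bounded_opI _ 0) => [c x y|x]; rewrite ?scaler0 ?addr0// hnorm0 mul0r.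
Qed.

Lemma bounded_op_scaled c T : bounded_op T -> bounded_op (fun x => c *: T x).
Proof. exact: bounded_op_comp (bounded_op_scale c). Qed.

Lemma bounded_op_opp T : bounded_op T -> bounded_op (fun x => - T x).
Proof.
by move=> /(bounded_op_scaled (-1)); congr bounded_op; apply/funext => x;
  rewrite scaleN1r.
Qed.

Lemma bounded_op_sub S T : bounded_op S -> bounded_op T -> bounded_op (S \- T).
Proof. by move=> bS /bounded_op_opp; exact: bounded_op_add. Qed.

End BoundedOp.

(** The form and the norm of [H] are given separately; the bundle records that they match, so that
    later lemmas take a single argument. The coercion lets [adjoint], [modulus] and the like apply
    to it. *)
Structure hdot {R : realType} (H : completeNormedModType R[i]) := HDot {
  hdot_dot :> {dot H for Num.conj};
  ip_norm : forall x, hdot_dot x x = `|x| ^+ 2 }.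

Section InnerProduct.
Context {R : realType} {H : completeNormedModType R[i]}.
Variable ip : hdot H.
Implicit Types (x y z : H) (c : R[i]) (S : set H) (T : H -> H).

Lemma ipDl x y z : ip (x + y) z = ip x z + ip y z.
Proof. exact: linearDl. Qed.

Lemma ipDr x y z : ip z (x + y) = ip z x + ip z y.
Proof. exact: linearDr. Qed.

Lemma ipZl c x y : ip (c *: x) y = c * ip x y.
Proof. exact: linearZl_LR. Qed.

Lemma ipZr c x y : ip x (c *: y) = Num.conj c * ip x y.
Proof. exact: linearZr_LR. Qed.

Lemma ip0l x : ip 0 x = 0.
Proof. exact: linear0l. Qed.

Lemma ip0r x : ip x 0 = 0.
Proof. exact: linear0r. Qed.

Lemma ipNl x y : ip (- x) y = - ip x y.
Proof. exact: linearNl. Qed.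

Lemma ipNr x y : ip x (- y) = - ip x y.
Proof. exact: linearNr. Qed.

Lemma ipBl x y z : ip (x - y) z = ip x z - ip y z.
Proof. exact: linearBl. Qed.

Lemma ipBr x y z : ip z (x - y) = ip z x - ip z y.
Proof. exact: linearBr. Qed.

Lemma ip_suml (I : Type) (r : seq I) (P : pred I) (F : I -> H) y :
  ip (\sum_(i <- r | P i) F i) y = \sum_(i <- r | P i) ip (F i) y.
Proof. exact: linear_sumlz. Qed.

Lemma ip_sumr (I : Type) (r : seq I) (P : pred I) (F : I -> H) y :
  ip y (\sum_(i <- r | P i) F i) = \sum_(i <- r | P i) ip y (F i).
Proof. exact: linear_sumr. Qed.

Lemma ipC x y : ip x y = Num.conj (ip y x).
Proof. by rewrite hermC/= expr0 mul1r. Qed.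

Lemma ip_eq0C x y : ip x y = 0 -> ip y x = 0.
Proof. by move=> h; rewrite ipC h rmorph0. Qed.

Lemma ipxx x : ip x x = (hnorm x ^+ 2)%:C.
Proof. by rewrite ip_norm hnormE rmorphXn. Qed.

Lemma hnorm_ip x : hnorm x ^+ 2 = complex.Re (ip x x).
Proof. by rewrite ipxx. Qed.

Lemma ipxx_eq0 x : ip x x = 0 -> x = 0.
Proof.
by rewrite ipxx => -[/eqP]; rewrite sqrf_eq0 hnorm_eq0 => /eqP.
Qed.

Lemma hnormD_sqr x y :
  hnorm (x + y) ^+ 2 = hnorm x ^+ 2 + hnorm y ^+ 2 + 2 * complex.Re (ip x y).
Proof.
rewrite hnorm_ip ipDl !ipDr (ipC y x) !ipxx !conjE.
by case: (ip x y) => a b /=; ring.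
Qed.

Lemma hnormB_sqr x y :
  hnorm (x - y) ^+ 2 = hnorm x ^+ 2 + hnorm y ^+ 2 - 2 * complex.Re (ip x y).
Proof.
by rewrite hnormD_sqr hnormN ipNr; case: (ip x y) => a b /=; ring.
Qed.

Lemma parallelogram x y :
  hnorm (x + y) ^+ 2 + hnorm (x - y) ^+ 2 = 2 * hnorm x ^+ 2 + 2 * hnorm y ^+ 2.
Proof. by rewrite hnormD_sqr hnormB_sqr; ring. Qed.

Lemma pythagoras x y : ip x y = 0 ->
  hnorm (x + y) ^+ 2 = hnorm x ^+ 2 + hnorm y ^+ 2.
Proof. by move=> xy; rewrite hnormD_sqr xy mulr0 addr0. Qed.

Lemma cauchy_schwarz x y : cabs (ip x y) <= hnorm x * hnorm y.
Proof.
have [->|y0] := eqVneq y 0; first by rewrite ip0r cabs0 hnorm0 mulr0.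
have ny : 0 < hnorm y by rewrite hnorm_gt0.
have ny2 : (hnorm y ^+ 2)%:C != 0 :> R[i].
  by rewrite (inj_eq (@complexI R)) sqrf_eq0 gt_eqF.
set c := ip x y / (hnorm y ^+ 2)%:C.
have : ip (x - c *: y) (c *: y) = 0.
  by rewrite ipZr ipBl ipZl ipxx divfK// subrr mulr0.
move/pythagoras; rewrite subrK hnormZ => h.
have -> : cabs (ip x y) = cabs c * hnorm y * hnorm y.
  rewrite cabsM cabsV cabs_pos ?sqr_ge0// -!mulrA -expr2 mulVf ?mulr1//.
  by rewrite sqrf_eq0 gt_eqF.
rewrite ler_wpM2r ?hnorm_ge0// -(@ler_pXn2r _ 2) ?nnegrE ?mulr_ge0 ?cabs_ge0 ?hnorm_ge0//.
by rewrite h lerDr sqr_ge0.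
Qed.

Lemma ip_ext x y : (forall z, ip z x = ip z y) -> x = y.
Proof.
move=> h; apply/eqP; rewrite -subr_eq0; apply/eqP/ipxx_eq0.
by rewrite ipBr h subrr.
Qed.

Lemma ip_cvgs_eq u x y c n0 : cvgs u x ->
  (forall n, (n0 <= n)%N -> ip (u n) y = c) -> ip x y = c.
Proof.
move=> ux uc; apply/eqP; rewrite -subr_eq0 -cabs_eq0 eq_le cabs_ge0 andbT.
apply/ler_addgt0Pr => e e0; rewrite add0r.
have ny : 0 < hnorm y + 1 by have := hnorm_ge0 y; lra.
have [|N NP] := ux (e / (hnorm y + 1)); first by rewrite divr_gt0.
have := NP _ (leq_maxl N n0).
rewrite ltr_pdivlMr// -(uc _ (leq_maxr N n0)) -ipBl => h.
rewrite (le_trans (cauchy_schwarz _ _))// hnorm_distC.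
have := hnorm_ge0 (u (maxn N n0) - x); nra.
Qed.

Definition orthc (S : set H) : set H := [set x | forall z, S z -> ip x z = 0].

Definition subsp (S : set H) :=
  S 0 /\ forall c x y, S x -> S y -> S (c *: x + y).

Lemma subspD S x y : subsp S -> S x -> S y -> S (x + y).
Proof. by move=> [_ h] /(h 1)/[apply]; rewrite scale1r. Qed.

Lemma subspZ S c x : subsp S -> S x -> S (c *: x).
Proof. by move=> [S0 h] /(h c)/(_ S0); rewrite addr0. Qed.

Lemma subspN S x : subsp S -> S x -> S (- x).
Proof. by move=> sS; rewrite -scaleN1r; exact: subspZ. Qed.

Lemma subspB S x y : subsp S -> S x -> S y -> S (x - y).
Proof. by move=> sS Sx /(subspN sS); exact: subspD. Qed.

Lemma subsp_range T : bounded_op T -> subsp (range T).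
Proof.
move=> bT; split; first by exists 0 => //; rewrite bop0.
by move=> c _ _ [x _ <-] [y _ <-]; exists (c *: x + y); rewrite ?bT.1.
Qed.

Lemma subsp_kernel T : bounded_op T -> subsp (kernel T).
Proof.
move=> bT; split; first exact: bop0.
by move=> c x y Tx Ty; rewrite /kernel/= bT.1 Tx Ty scaler0 addr0.
Qed.

Lemma closed_kernel T : bounded_op T -> closed (kernel T).
Proof.
move=> bT; apply: closedI_cvgs => u x Tu ux.
apply: (cvgs_unique (bop_cvgs bT ux)); apply: cvgs_ext (cvgs_cst 0) => n.
by rewrite /= Tu.
Qed.

Lemma subsp_orthc S : subsp (orthc S).
Proof.
split=> [z _|c x y Sx Sy z Sz]; first exact: ip0l.
by rewrite ipDl ipZl Sx// Sy// mulr0 addr0.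
Qed.

Lemma closed_orthc S : closed (orthc S).
Proof.
apply: closedI_cvgs => u x Su ux z Sz.
by apply: (ip_cvgs_eq (n0 := 0%N) ux) => n _; exact: Su.
Qed.

Section Projection.
Variables (S : set H) (sS : subsp S) (cS : closed S).

Lemma closest_point_ortho x y : S y ->
  (forall z, S z -> hnorm (x - y) <= hnorm (x - z)) ->
  forall z, S z -> ip (x - y) z = 0.
Proof.
move=> Sy ymin z Sz; have [->|z0] := eqVneq z 0; first exact: ip0r.
have nz : 0 < hnorm z by rewrite hnorm_gt0.
have nz2 : (hnorm z ^+ 2)%:C != 0 :> R[i].
  by rewrite (inj_eq (@complexI R)) sqrf_eq0 gt_eqF.
set c := ip (x - y) z / (hnorm z ^+ 2)%:C.
have h : ip (x - y - c *: z) (c *: z) = 0.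
  by rewrite ipZr ipBl ipZl ipxx divfK// subrr mulr0.
have := pythagoras h; rewrite subrK => h2.
have := ymin _ (subspD sS Sy (subspZ c sS Sz)); rewrite opprD addrA.
rewrite -(@ler_pXn2r _ 2) ?nnegrE ?hnorm_ge0// h2 gerDl hnormZ => h3.
have : cabs c * hnorm z = 0.
  by apply/eqP; rewrite -sqrf_eq0 eq_le h3 sqr_ge0.
move/eqP; rewrite mulf_eq0 (gt_eqF nz) orbF cabs_eq0 mulf_eq0 invr_eq0.
by rewrite (negbTE nz2) orbF => /eqP.
Qed.

Lemma projection_exists x : exists y, S y /\ forall z, S z -> ip (x - y) z = 0.
Proof.
pose D := [set hnorm (x - z) | z in S].
have hD : has_inf D.
  split; first by exists (hnorm (x - 0)), 0 => //; case: sS.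
  by exists 0 => _ [z _ <-]; exact: hnorm_ge0.
set d := inf D.
have dle z : S z -> d <= hnorm (x - z).
  by move=> Sz; apply: ge_inf => //; [case: hD|exists z].
have d0 : 0 <= d by apply: lb_le_inf; [case: hD|move=> _ [z _ <-]; exact: hnorm_ge0].
have ex n : exists z, S z /\ hnorm (x - z) < d + n.+1%:R^-1.
  have n0 : (0 : R) < n.+1%:R^-1 by rewrite invr_gt0.
  by have [_ [z Sz <-] zd] := inf_adherent n0 hD; exists z.
have [u uP] := choice ex.
have cu : cauchys u.
  move=> e e0.
  (* With [p, q <= 1] the parallelogram law bounds the squared distance of [u m] and [u n] by
     [2(d+p)^2 + 2(d+q)^2 - 4d^2 <= (4d+2)(p+q)]. Taking [p] and [q] below [e^2 / (8d+5)] brings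
     this under [e^2]; the final [+ 1] makes it strict. *)
  have K0 : 0 < e ^+ 2 / (8 * d + 4 + 1) by rewrite divr_gt0 ?exprn_gt0//; lra.
  have [N NP] : exists N, forall n, (N <= n)%N ->
      n.+1%:R^-1 < e ^+ 2 / (8 * d + 4 + 1).
    exists (Num.truncn (e ^+ 2 / (8 * d + 4 + 1))^-1) => n Nn.
    rewrite invf_plt ?posrE//.
    by apply: (lt_le_trans (truncnS_gt _)); rewrite ler_nat ltnS.
  exists N => m n /NP mP /NP nP.
  rewrite -(@ltr_pXn2r _ 2) ?nnegrE ?hnorm_ge0 ?ltW//.
  set p := m.+1%:R^-1 in mP *; set q := n.+1%:R^-1 in nP *.
  have p0 : 0 < p by rewrite invr_gt0.
  have q0 : 0 < q by rewrite invr_gt0.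
  have p1 : p <= 1 by rewrite invf_le1 ?ler1n.
  have q1 : q <= 1 by rewrite invf_le1 ?ler1n.
  have := parallelogram (x - u m) (x - u n).
  have -> : x - u m - (x - u n) = u n - u m by rewrite opprB addrC subrKA.
  have -> : x - u m + (x - u n) = 2%:R *: (x - 2^-1 *: (u m + u n)).
    by rewrite scalerBr scalerA mulfV ?pnatr_eq0// scale1r scaler_nat mulr2n opprD addrACA.
  rewrite hnormZ (hnorm_distC (u n)).
  have -> : cabs 2 = 2 :> R by rewrite -(cabs_pos (ler0n R 2)) rmorphMn rmorph1.
  have [[Sm um] [Sn un]] := (uP m, uP n).
  have := dle _ (subspZ 2^-1 sS (subspD sS Sm Sn)).
  have a0 := hnorm_ge0 (x - u m); have b0 := hnorm_ge0 (x - u n).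
  have c0 := hnorm_ge0 (x - 2^-1 *: (u m + u n)).
  rewrite ltr_pdivlMr in mP; last by lra.
  rewrite ltr_pdivlMr in nP; last by lra.
  rewrite -/p in um; rewrite -/q in un.
  move: (hnorm (x - u m)) (hnorm (x - u n)) (hnorm (x - 2^-1 *: _)) (hnorm (u m - u n)) um un a0 b0 c0.
  move=> a b c f um un a0 b0 c0 dc.
  have : a ^+ 2 < (d + p) ^+ 2 by rewrite ltr_pXn2r// ?nnegrE//; lra.
  have : b ^+ 2 < (d + q) ^+ 2 by rewrite ltr_pXn2r// ?nnegrE//; lra.
  have : d ^+ 2 <= c ^+ 2 by rewrite ler_pXn2r// ?nnegrE//; lra.
  by nra.
have [y uy] := cauchys_cvg cu.
have Sy : S y by apply: (closed_cvgs cS _ uy) => n; case: (uP n).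
exists y; split=> //; apply: closest_point_ortho => // z Sz.
apply: le_trans (dle z Sz); apply/ler_addgt0Pr => e e0.
have e2 : 0 < e / 2 by rewrite divr_gt0.
have [N NP] := uy _ e2.
pose n := maxn N (Num.truncn (e / 2)^-1).
have h1 := NP n (leq_maxl _ _).
have h2 : n.+1%:R^-1 < e / 2.
  rewrite invf_plt ?posrE//.
  by apply: (lt_le_trans (truncnS_gt _)); rewrite ler_nat ltnS leq_maxr.
have := (uP n).2; have := hnorm_dist_trans (u n) x y.
move: h1 h2; move: (n.+1%:R^-1) => q; lra.
Qed.

Definition proj := ortho_proj ip S.

Lemma projP x : S (proj x) /\ forall z, S z -> ip (x - proj x) z = 0.
Proof. by rewrite /proj /ortho_proj; apply: (getPex (projection_exists x)). Qed.

Lemma proj_unique x y : S y -> (forall z, S z -> ip (x - y) z = 0) -> proj x = y.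
Proof.
move=> Sy hy; have [Sp hp] := projP x.
apply/eqP; rewrite -subr_eq0; apply/eqP/ipxx_eq0.
have Sd : S (proj x - y) by exact: subspB.
have -> : ip (proj x - y) (proj x - y) = ip (x - y) (proj x - y) - ip (x - proj x) (proj x - y).
  by rewrite -ipBl opprB [x - y + _]addrC subrKA.
by rewrite hy// hp// subr0.
Qed.

Lemma proj_in x : S (proj x).
Proof. by case: (projP x). Qed.

Lemma proj_compl x : orthc S (x - proj x).
Proof. by case: (projP x). Qed.

Lemma proj_id x : S x -> proj x = x.
Proof. by move=> Sx; apply: proj_unique => // z _; rewrite subrr ip0l. Qed.

Lemma proj_orthc x : orthc S x -> proj x = 0.
Proof. by move=> Sx; apply: proj_unique => [|z Sz]; [case: sS|rewrite subr0 Sx]. Qed.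

Lemma hnorm_proj x : hnorm x ^+ 2 = hnorm (proj x) ^+ 2 + hnorm (x - proj x) ^+ 2.
Proof.
rewrite addrC -pythagoras ?subrK//; exact: (proj_compl x) (proj_in x).
Qed.

Lemma hnorm_proj_le x : hnorm (proj x) <= hnorm x.
Proof.
by rewrite -(@ler_pXn2r _ 2) ?nnegrE ?hnorm_ge0// (hnorm_proj x) lerDl sqr_ge0.
Qed.

Lemma proj_linear : linear proj.
Proof.
move=> c x y; apply: proj_unique.
  by apply: subspD (proj_in y) => //; apply: subspZ (proj_in x).
move=> z Sz; rewrite opprD addrACA -scalerBr ipDl ipZl.
by rewrite !(proj_compl _ Sz) mulr0 addr0.
Qed.

Lemma bounded_proj : bounded_op proj.
Proof.
by apply: (@bounded_opI _ _ _ 1 proj_linear) => x; rewrite mul1r hnorm_proj_le.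
Qed.

Lemma range_proj : range proj = S.
Proof.
apply/seteqP; split=> [_ [x _ <-]|x Sx]; first exact: proj_in.
by exists x => //; exact: proj_id.
Qed.

End Projection.

Lemma riesz (f : H -> R[i]) (C : R) :
  (forall c x y, f (c *: x + y) = c * f x + f y) ->
  (forall x, cabs (f x) <= C * hnorm x) ->
  exists z, forall x, f x = ip x z.
Proof.
move=> lf fC; pose K := [set x | f x = 0].
have f0 : f 0 = 0.
  by have := lf (-1) 0 0; rewrite scaleN1r oppr0 addr0 mulN1r addNr.
have fZ c x : f (c *: x) = c * f x by rewrite -[c *: x]addr0 lf f0 addr0.
have fD x y : f (x + y) = f x + f y by rewrite -[x]scale1r lf scale1r mul1r.
have fN x : f (- x) = - f x by rewrite -scaleN1r fZ mulN1r.
have sK : subsp K.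
  by split=> // c x y Kx Ky; rewrite /K/= lf Kx Ky mulr0 addr0.
have cK : closed K.
  apply: closedI_cvgs => u x Ku ux.
  apply/eqP; rewrite -cabs_eq0 eq_le cabs_ge0 andbT.
  apply/ler_addgt0Pr => e e0; rewrite add0r.
  have C1 : 0 < `|C| + 1 by rewrite ltr_wpDl.
  have [|N NP] := ux (e / (`|C| + 1)); first by rewrite divr_gt0.
  have := NP N (leqnn N); rewrite ltr_pdivlMr// => h.
  have := fC (u N - x); rewrite fD fN Ku add0r cabsN.
  have := hnorm_ge0 (u N - x); have := ler_norm C; nra.
have [allK|] := pselect (forall x, K x).
  by exists 0 => x; rewrite ip0r; exact: allK.
move=> /existsNP[x0 fx0]; pose w := x0 - proj K x0.
have fw : f w = f x0.
  by rewrite /w fD fN (proj_in sK cK x0 : f _ = 0) subr0.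
have fw0 : f w != 0 by rewrite fw; apply/eqP.
have wK := proj_compl sK cK x0; rewrite -/w in wK.
have ww : ip w w != 0.
  by apply: contra fw0 => /eqP/ipxx_eq0 ->; rewrite f0.
(* A normal vector of the hyperplane [K], rescaled; the conjugate compensates the
   conjugate-linearity of the second argument. *)
exists (Num.conj (f w / ip w w) *: w) => x.
have Kx : K (x - (f x / f w) *: w).
  by rewrite /K/= fD fN fZ divfK// subrr.
have := ip_eq0C (wK _ Kx); rewrite ipBl ipZl => /eqP; rewrite subr_eq0 => /eqP h.
rewrite ipZr h; have -> : Num.conj (Num.conj (f w / ip w w)) = f w / ip w w by exact: conjcK.
by field; rewrite fw0 ww.
Qed.

Lemma adjoint_exists T : bounded_op T -> forall y, exists z, forall x,
  ip (T x) y = ip x z.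
Proof.
move=> bT y; have [C C0 TC] := bounded_op_pos bT.
apply: (@riesz _ (C * hnorm y)) => [c x z|x]; first by rewrite bT.1 ipDl ipZl.
rewrite (le_trans (cauchy_schwarz _ _))// mulrAC ler_wpM2r ?hnorm_ge0//.
Qed.

Lemma adjointP T x y : bounded_op T -> ip (T x) y = ip x (adjoint ip T y).
Proof.
move=> bT; rewrite /adjoint.
exact: (getPex (adjoint_exists bT y) x).
Qed.

Lemma adjointPl T x y : bounded_op T -> ip (adjoint ip T x) y = ip x (T y).
Proof. by move=> bT; rewrite ipC -adjointP// -ipC. Qed.

Lemma adjoint_eq T y z : bounded_op T -> (forall x, ip (T x) y = ip x z) ->
  adjoint ip T y = z.
Proof. by move=> bT h; apply: ip_ext => x; rewrite -adjointP. Qed.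

Lemma adjoint_bound T C : 0 <= C -> bounded_op T ->
  (forall x, hnorm (T x) <= C * hnorm x) ->
  forall x, hnorm (adjoint ip T x) <= C * hnorm x.
Proof.
move=> C0 bT TC x; set z := adjoint ip T x.
have [->|z0] := eqVneq z 0; first by rewrite hnorm0 mulr_ge0 ?hnorm_ge0.
have nz : 0 < hnorm z by rewrite hnorm_gt0.
have := cauchy_schwarz (T z) x.
rewrite adjointP// -/z ipxx cabs_pos ?sqr_ge0// => h.
rewrite -(ler_pM2r nz) -expr2 (le_trans h)// mulrAC ler_wpM2r ?hnorm_ge0//.
Qed.

Lemma bounded_adjoint T : bounded_op T -> bounded_op (adjoint ip T).
Proof.
move=> bT; have [C C0 TC] := bounded_op_pos bT.
apply: (@bounded_opI _ _ _ C); last exact: adjoint_bound (ltW C0) bT TC.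
move=> c x y; apply: ip_ext => z.
by rewrite -adjointP// !ipDr !ipZr -!adjointP.
Qed.

End InnerProduct.

(** * Closed ranges *)

Section Inverse.
Context {R : realType} {H : completeNormedModType R[i]}.
Implicit Types (x y z : H) (T : H -> H).

Lemma inverse_bounded_below T (d : R) : bounded_op T -> 0 < d ->
  (forall x, d * hnorm x <= hnorm (T x)) -> (forall y, exists x, T x = y) ->
  exists L, [/\ bounded_op L, T \o L = id & L \o T = id].
Proof.
move=> bT d0 Td /choice[L TL].
have injT x y : T x = T y -> x = y.
  move=> Txy; apply/eqP; rewrite -subr_eq0 -hnorm_eq0 eq_le hnorm_ge0 andbT.
  by have := Td (x - y); rewrite (bopB bT) Txy subrr hnorm0 pmulr_rle0.
exists L; split; last 2 first.
- exact/funext.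
- by apply/funext => x; apply: injT; rewrite /= TL.
apply: (@bounded_opI _ _ _ d^-1) => [c x y|x].
  by apply: injT; rewrite TL bT.1 !TL.
by rewrite ler_pdivlMl// -{2}[x]TL.
Qed.

Lemma neumann T (q : R) : bounded_op T -> 0 <= q -> q < 1 ->
  (forall x, hnorm (T x) <= q * hnorm x) ->
  exists L, [/\ bounded_op L, (id \+ T) \o L = id & L \o (id \+ T) = id].
Proof.
move=> bT q0 q1 Tq.
have p0 : 0 < 1 - q by rewrite subr_gt0.
apply: (@inverse_bounded_below _ (1 - q)) => //.
- exact: bounded_op_add (bounded_op_id) bT.
- move=> x /=; have := hnormB (x + T x) (T x); rewrite addrK.
  have := Tq x; lra.
move=> y; pose u := fix u n := if n is m.+1 then y - T (u m) else 0.
(* Partial sums of the geometric series of ratio [q] and first term [hnorm y], which dominate the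
   fixed point iteration for [x = y - T x]. *)
pose a n : R := hnorm y / (1 - q) * (1 - q ^+ n).
have ua n : hnorm (u n.+1 - u n) <= a n.+1 - a n.
  have -> : a n.+1 - a n = q ^+ n * hnorm y.
    by rewrite /a exprS; field; rewrite gt_eqF//.
  elim: n => [|n IH]; first by rewrite /= bop0// !subr0 expr0 mul1r.
  have -> : u n.+2 - u n.+1 = T (u n - u n.+1).
    have uS m : u m.+1 = y - T (u m) by [].
    by rewrite (bopB bT) (uS n.+1) {1}(uS n) opprB [LHS]addrC subrKA.
  rewrite (le_trans (Tq _))// exprS -mulrA ler_wpM2l// hnorm_distC; exact: IH.
have [|x ux] := cauchys_cvg (@cauchys_dominated _ _ u a (hnorm y / (1 - q)) ua _).
  move=> n; rewrite /a ler_piMr ?gerBl ?exprn_ge0//.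
  by rewrite divr_ge0 ?hnorm_ge0// ltW.
exists x => /=.
have h1 : cvgs (fun n => u n.+1) x.
  by move=> e /ux[N NP]; exists N => n Nn; apply: NP; rewrite leqW.
have h2 : cvgs (fun n => u n.+1) (y + (-1) *: T x).
  apply: cvgs_ext (cvgsD (cvgs_cst y) (cvgsZ (-1) (bop_cvgs bT ux))) => n.
  by rewrite /= scaleN1r.
by rewrite {1}(cvgs_unique h1 h2) scaleN1r subrK.
Qed.

Lemma closed_image_bounded_below T (S : set H) (d : R) : bounded_op T ->
  subsp S -> closed S -> 0 < d -> (forall x, S x -> d * hnorm x <= hnorm (T x)) ->
  closed (T @` S).
Proof.
move=> bT sS cS d0 Td; apply: closedI_cvgs => u x Su ux.
have /choice[v vP] : forall n, exists v, S v /\ T v = u n.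
  by move=> n; have [v Sv Tv] := Su n; exists v.
have [|y vy] := @cauchys_cvg _ _ v.
  move=> e e0; have de : 0 < d * e / 2 by rewrite divr_gt0// mulr_gt0.
  have [N NP] := ux _ de; exists N => m n /NP um /NP un.
  have Sd : S (v m - v n) by exact: subspB sS (vP m).1 (vP n).1.
  have := Td _ Sd; rewrite (bopB bT) (vP m).2 (vP n).2 => h.
  rewrite -(ltr_pM2l d0); have := hnorm_dist_trans x (u m) (u n).
  rewrite (hnorm_distC x); lra.
exists y; first by apply: (closed_cvgs cS _ vy) => n; case: (vP n).
apply: (cvgs_unique (bop_cvgs bT vy)).
by apply: cvgs_ext ux => n; rewrite /= (vP n).2.
Qed.

End Inverse.

Section ClosedRange.
Context {R : realType} {H : completeNormedModType R[i]}.
Variable ip : hdot H.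
Implicit Types (x y z : H) (A : H -> H).

(* Uniform boundedness by Sokal's gliding hump, applied to the functionals
   [ip _ (v n)] on the complete space [range A]. *)
Lemma adjoint_bounded_below_range A : closed_range A ->
  exists2 d : R, 0 < d &
    forall y, range A y -> d * hnorm y <= hnorm (adjoint ip A y).
Proof.
move=> [bA cA]; have sA := subsp_range bA.
apply: contrapT => /forall2NP noB.
have /choice[v vP] : forall n, exists v, [/\ range A v, hnorm v = 4 ^+ n :> R
    & hnorm (adjoint ip A v) <= 1].
  move=> n; have := noB (4 ^- n); rewrite invr_gt0 exprn_gt0// => -[//|].
  move=> /existsNP[y /not_implyP[Ay /negP]]; rewrite -ltNge => hy.
  have y0 : 0 < hnorm y.
    rewrite lt_neqAle hnorm_ge0 andbT eq_sym; apply/eqP => y0.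
    by move: hy; rewrite y0 mulr0 ltNge hnorm_ge0.
  have c0 : (0 : R) <= 4 ^+ n / hnorm y by rewrite divr_ge0 ?exprn_ge0 ?hnorm_ge0.
  exists ((4 ^+ n / hnorm y)%:C *: y); split.
  - exact: subspZ.
  - by rewrite hnormZ cabs_pos// divfK// gt_eqF.
  - rewrite (bopZ (bounded_adjoint ip bA)) hnormZ cabs_pos// mulrAC ler_pdivrMr// mul1r.
    by rewrite -ler_pdivlMl ?exprn_gt0// ltW.
(* As [12 = 3 * 4], the bump [h n] has the summable norm [3^-n], while its pairing with [v n], of
   norm [4^n], grows like [(4/3)^n]. *)
pose h n := (12 ^- n : R)%:C *: v n.
have hh n : hnorm (h n) = 3 ^- n.
  rewrite hnormZ cabs_pos ?invr_ge0 ?exprn_ge0//; have [_ -> _] := vP n.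
  by rewrite -[12]/((3 * 4)%:R) natrM exprMn invfM divfK// expf_neq0.
have iph n : cabs (ip (h n) (v n)) = 3 ^- n * 4 ^+ n.
  rewrite -hh; have [_ vn _] := vP n.
  rewrite ipZl cabsM ipxx [cabs (_ ^+ 2)%:C]cabs_pos ?sqr_ge0// /h hnormZ vn expr2.
  by rewrite mulrA.
(* The values of [ip _ (v n)] at [x + h n] and [x - h n] differ by twice its value at [h n], so one
   of them is at least as large as the latter. *)
pose step n x := if cabs (ip (h n) (v n)) <= cabs (ip (x + h n) (v n))
  then x + h n else x - h n.
have stepP n x : cabs (ip (h n) (v n)) <= cabs (ip (step n x) (v n)).
  rewrite /step; case: ifPn => //; rewrite -ltNge ipDl ipBl.
  move: (ip x _) (ip (h n) _) => p q; have := cabsD (p + q) (- (p - q)).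
  rewrite cabsN opprB [q - p]addrC addrACA subrr add0r -mulr2n.
  rewrite -mulr_natr cabsM -(rmorph_nat (real_complex R)) cabs_pos ?ler0n//.
  lra.
have step_dist n x : hnorm (step n x - x) = 3 ^- n.
  by rewrite /step; case: ifP => _; rewrite addrAC subrr add0r ?hnormN hh.
pose u := fix u n := if n is m.+1 then step m (u m) else 0.
pose a n : R := 3 / 2 * (1 - 3 ^- n).
have ua n : hnorm (u n.+1 - u n) <= a n.+1 - a n.
  rewrite step_dist /a exprS invfM; move: (3 ^- n) => t; lra.
have a_le n : a n <= 3 / 2.
  have : (0 : R) <= 3 ^- n by rewrite invr_ge0 exprn_ge0.
  rewrite /a; move: (3 ^- n) => t; lra.
have [x ux] := cauchys_cvg (cauchys_dominated ua a_le).
have rh n : range A (h n) by apply: subspZ => //; case: (vP n).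
have Ax : range A x.
  apply: (closed_cvgs cA _ ux); elim=> [|n IH]; first by case: sA.
  by rewrite /= /step; case: ifP => _; [exact: subspD sA IH (rh n)|exact: subspB sA IH (rh n)].
have tail n : hnorm (x - u n.+1) <= 3 ^- n / 2.
  apply: (@hnorm_cvgs_le _ _ (fun m => u m - u n.+1) _ _ n.+1).
    exact: cvgsD ux (cvgs_cst _).
  move=> m nm; rewrite (le_trans (dominated_increments ua nm))//.
  have := a_le m; rewrite [a n.+1]/a exprS invfM; move: (3 ^- n) => t; lra.
have [x' _ x'x] := Ax.
(* All steps after the one for [n] move the limit by at most [3^-n / 2], which costs half of the
   pairing [(4/3)^n]. On the other side, [x = A x'] and the bound 1 on [adjoint ip A (v n)] keep the
   pairing below [hnorm x']; Bernoulli's inequality then gives the contradiction. *)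
have lower n : (4 / 3) ^+ n / 2 <= hnorm x'.
  have [_ vn vA] := vP n.
  have h1 : cabs (ip x (v n)) <= hnorm x'.
    rewrite -x'x adjointP// (le_trans (cauchy_schwarz _ _ _))//.
    by rewrite ler_piMr ?hnorm_ge0.
  apply: le_trans h1.
  have := cauchy_schwarz ip (x - u n.+1) (v n); rewrite vn ipBl.
  have := stepP n (u n); rewrite iph -[step _ _]/(u n.+1).
  have := tail n; move: (ip x _) (ip (u n.+1) _) => b c.
  have : cabs c <= cabs b + cabs (b - c).
    by rewrite -[in leLHS](subrK b c) addrC (le_trans (cabsD _ _))// -[c - b]opprB cabsN.
  rewrite exprMn -exprVn.
  have p0 : (0 : R) < 4 ^+ n by rewrite exprn_gt0.
  rewrite exprVn; move: (3 ^- n) (4 ^+ n) p0 => t s p0; nra.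
have bern n : 1 + n%:R / 3 <= (4 / 3) ^+ n :> R.
  elim: n => [|n IH]; first by rewrite expr0 mul0r addr0.
  rewrite exprS -natr1; have : 0 <= n%:R :> R by rewrite ler0n.
  move: IH; move: (_ ^+ n) (n%:R) => s t; lra.
set N := (Num.truncn (6 * hnorm x')).+1.
have := truncnS_gt (6 * hnorm x'); rewrite -/N.
have := lower N; have := bern N; move: (N%:R) (_ ^+ N) => s t; lra.
Qed.

(** The bound passes from the adjoint to [A] with the same [d]. The set [M = A^*(R(A))] is closed,
    and a vector orthogonal to it is killed by [A], so N(A)^\perp lies in [M]. For [x = A^* y] with
    [y] in R(A), [|x|^2 = <y, A x> <= |y| |A x|] and [d |y| <= |x|]. This takes the place of the
    open mapping theorem. *)
Lemma closed_range_bounded_below A : closed_range A ->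
  exists2 d : R, 0 < d &
    forall x, orthc ip (kernel A) x -> d * hnorm x <= hnorm (A x).
Proof.
move=> crA; have [bA cA] := crA.
have [d d0 Ad] := adjoint_bounded_below_range crA.
have bA' := bounded_adjoint ip bA.
pose M := adjoint ip A @` range A.
have cM : closed M.
  by apply: closed_image_bounded_below Ad => //; exact: subsp_range.
have sM : subsp M.
  rewrite /M image_comp; apply: subsp_range; exact: bounded_op_comp.
exists d => // x xN.
have : M x.
  suff -> : x = proj ip M x by exact: proj_in.
  apply/eqP; rewrite -subr_eq0; apply/eqP/(@ipxx_eq0 _ _ ip).
  have xp := proj_compl ip sM cM x.
  have Nxp : kernel A (x - proj ip M x).
    apply: (@ipxx_eq0 _ _ ip); rewrite adjointP//.
    by apply: xp; exists (A (x - proj ip M x)) => //; exists (x - proj ip M x).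
  rewrite {1}ipBl xN// sub0r.
  have [y _ py] := proj_in ip sM cM x.
  by rewrite -{1}py adjointPl// Nxp ip0r oppr0.
move=> [y Ay yx]; have [->|x0] := eqVneq x 0.
  by rewrite hnorm0 mulr0 hnorm_ge0.
have nx : 0 < hnorm x by rewrite hnorm_gt0.
have := cauchy_schwarz ip y (A x); rewrite -adjointPl// yx.
rewrite ipxx cabs_pos ?sqr_ge0// => h1; have := Ad _ Ay; rewrite yx => h2.
rewrite -(ler_pM2r nx) -mulrA -expr2.
apply: le_trans (ler_wpM2l (ltW d0) h1) _.
by rewrite mulrA [leRHS]mulrC ler_wpM2r ?hnorm_ge0.
Qed.

End ClosedRange.

(** * Orthonormal sequences and compact operators *)

Section OrthoSeq.
Context {R : realType} {H : completeNormedModType R[i]}.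
Variable ip : hdot H.
Implicit Types (x y z : H) (T : H -> H) (f : nat -> H).

(* Orthonormal up to some vanishing terms, which spares reindexings. *)
Definition orthoseq f := forall i j, ip (f i) (f j) = ((i == j) && (f i != 0))%:R.

Definition psum f n x := \sum_(k < n) ip x (f k) *: f k.

Lemma orthoseq_norm f k : orthoseq f -> hnorm (f k) = (f k != 0)%:R.
Proof.
move=> of_; have := of_ k k; rewrite ipxx eqxx /= => h.
have : hnorm (f k) ^+ 2 = ((f k != 0)%:R : R).
  by apply: complexI; rewrite h; case: (_ != _); rewrite ?rmorph0 ?rmorph1.
case: (_ != _) => [|/eqP]; last by rewrite sqrf_eq0 => /eqP.
by move=> /eqP; rewrite sqrp_eq1 ?hnorm_ge0// => /eqP.
Qed.

Lemma orthoseq_norm_le1 f k : orthoseq f -> hnorm (f k) <= 1.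
Proof. by move=> /orthoseq_norm ->; case: (_ != _); rewrite ?ler01. Qed.

Lemma ip_psum f n x k : orthoseq f ->
  ip (psum f n x) (f k) = if (k < n)%N then ip x (f k) else 0.
Proof.
move=> of_; rewrite ip_suml.
under eq_bigr => i _ do rewrite ipZl of_.
case: ltnP => [kn|nk].
  rewrite (bigD1 (Ordinal kn))//= eqxx/= big1 ?addr0 => [|i ik].
    by have [->|_] := eqVneq (f k) 0; rewrite ?ip0r ?mul0r// mulr1.
  by move: ik; rewrite -val_eqE /= => /negbTE ->; rewrite mulr0.
rewrite big1// => i _; rewrite ltn_eqF ?mulr0//.
exact: leq_trans (ltn_ord i) nk.
Qed.

Lemma ip_psum_compl f n x k : orthoseq f -> (k < n)%N ->
  ip (x - psum f n x) (f k) = 0.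
Proof. by move=> of_ kn; rewrite ipBl ip_psum// kn subrr. Qed.

Lemma hnorm_sum_ortho f n (c : nat -> R[i]) : orthoseq f ->
  hnorm (\sum_(k < n) c k *: f k) ^+ 2 =
  \sum_(k < n) (cabs (c k) * hnorm (f k)) ^+ 2.
Proof.
move=> of_; elim: n => [|n IH]; first by rewrite !big_ord0 hnorm0 expr0n.
rewrite !big_ord_recr /= (@pythagoras _ _ ip) ?IH ?hnormZ// ipZr ip_suml big1 ?mulr0// => i _.
by rewrite ipZl of_ ltn_eqF ?mulr0.
Qed.

Lemma bessel_eq f n x : orthoseq f ->
  hnorm x ^+ 2 = \sum_(k < n) cabs (ip x (f k)) ^+ 2 + hnorm (x - psum f n x) ^+ 2.
Proof.
move=> of_; have -> : \sum_(k < n) cabs (ip x (f k)) ^+ 2 = hnorm (psum f n x) ^+ 2.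
  rewrite (hnorm_sum_ortho _ (fun k => ip x (f k)))//; apply: eq_bigr => i _.
  rewrite orthoseq_norm//; have [->|_] := eqVneq (f i) 0; last by rewrite mulr1.
  by rewrite ip0r cabs0 mul0r.
rewrite addrC -(@pythagoras _ _ ip) ?subrK// ip_sumr big1// => i _.
by rewrite ipZr ip_psum_compl// mulr0.
Qed.

Lemma bessel f n x : orthoseq f ->
  \sum_(k < n) cabs (ip x (f k)) ^+ 2 <= hnorm x ^+ 2.
Proof. by move=> of_; rewrite (bessel_eq n x of_) lerDl sqr_ge0. Qed.

Lemma psum_compl_le f n x : orthoseq f -> hnorm (x - psum f n x) <= hnorm x.
Proof.
move=> of_; rewrite -(@ler_pXn2r _ 2) ?nnegrE ?hnorm_ge0//.
by rewrite (bessel_eq n x of_) lerDr sumr_ge0// => i _; rewrite sqr_ge0.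
Qed.

Lemma psum_le f n x : orthoseq f -> hnorm (psum f n x) <= hnorm x.
Proof.
move=> of_; rewrite -(@ler_pXn2r _ 2) ?nnegrE ?hnorm_ge0//.
rewrite (hnorm_sum_ortho _ (fun k => ip x (f k)))// (le_trans _ (bessel n x of_))//.
apply: ler_sum => i _; rewrite ler_pXn2r ?nnegrE ?mulr_ge0 ?cabs_ge0 ?hnorm_ge0//.
by rewrite ler_piMr ?cabs_ge0// orthoseq_norm_le1.
Qed.

Lemma bounded_psum f n : orthoseq f -> bounded_op (psum f n).
Proof.
move=> of_; apply: (@bounded_opI _ _ _ 1) => [c x y|x]; last by rewrite mul1r psum_le.
rewrite /psum scaler_sumr -big_split /=; apply: eq_bigr => i _.
by rewrite ipDl ipZl scalerDl scalerA.
Qed.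

(** [gs d n] is the operator that removes the components along the first [n] Gram-Schmidt vectors.
    Since [0^-1 = 0], a vanishing residual [r] contributes the zero vector, which [orthoseq]
    tolerates. *)
Definition gs (d : nat -> H) := fix gs n : H -> H :=
  if n is m.+1 then
    let r := gs m (d m) in
    fun x => gs m x - ip x ((hnorm r)^-1%:C *: r) *: ((hnorm r)^-1%:C *: r)
  else id.

Lemma gram_schmidt (d : nat -> H) :
  exists2 f, orthoseq f & forall n, d n = psum f n.+1 (d n).
Proof.
pose r n := gs d n (d n); pose f n := (hnorm (r n))^-1%:C *: r n.
have gsE n x : gs d n x = x - psum f n x.
  elim: n => [|n IH]; first by rewrite /psum big_ord0 subr0.
  by rewrite /psum big_ord_recr /= opprD addrA -/(psum f n x) -IH.
have ff n : ip (f n) (f n) = (f n != 0)%:R.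
  have [->|/=] := eqVneq (f n) 0; first by rewrite ip0l.
  rewrite /f ipZl ipZr conj_real ipxx -!rmorphM => h /=.
  have r0 : hnorm (r n) != 0 by apply: contra h => /eqP ->; rewrite invr0 scale0r.
  by rewrite expr2 mulKf// mulVf// rmorph1.
have rf n k : (k < n)%N -> ip (r n) (f k) = 0.
  have [m] := ubnP n; elim: m n k => // m IH n k; rewrite ltnS => nm kn.
  have sub i : (i < n)%N -> ip (f i) (f k) = ((i == k) && (f k != 0))%:R.
    move=> in_; have [->|ik /=] := eqVneq i k; first exact: ff.
    case: (ltngtP i k) ik => // [ik|ki] _.
    - apply: ip_eq0C; rewrite {1}/f ipZl IH ?mulr0//; exact: leq_trans nm.
    - by rewrite {1}/f ipZl IH ?mulr0//; exact: leq_trans nm.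
  rewrite /r gsE ipBl ip_suml (bigD1 (Ordinal kn))//= big1 ?addr0 => [|i ik].
    rewrite ipZl sub// eqxx /=; have [->|_] := eqVneq (f k) 0; last by rewrite mulr1 subrr.
    by rewrite ip0r mul0r subrr.
  by move: ik; rewrite ipZl sub// -val_eqE /= => /negbTE ->; rewrite mulr0.
have of_ : orthoseq f.
  move=> i j; have [->|] := eqVneq i j; first exact: ff.
  case: (ltngtP i j) => // [ij|ji] _ /=.
  - by apply: ip_eq0C; rewrite {1}/f ipZl rf ?mulr0.
  - by rewrite {1}/f ipZl rf ?mulr0.
exists f => // n; apply/eqP; rewrite -subr_eq0 -gsE /=; apply/eqP.
rewrite -/(r n) -/(f n).
have [r0|r0] := eqVneq (r n) 0.
  by rewrite /f r0 scaler0 scaler0 subr0.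
have nr : hnorm (r n) != 0 by rewrite hnorm_eq0.
have -> : ip (d n) (f n) = (hnorm (r n))%:C.
  have -> : d n = r n + psum f n (d n) by rewrite /r gsE subrK.
  rewrite ipDl ip_psum// ltnn addr0 {1}/f ipZr conj_real ipxx -rmorphM.
  by rewrite expr2 mulKf.
by rewrite /f scalerA -rmorphM mulfV// rmorph1 scale1r subrr.
Qed.

(* An operator is compact iff for each [e > 0] it is [e]-small on the
   orthogonal complement of a finite set; this form passes to sums, products
   and adjoints by finite bookkeeping. *)
Definition small_off T (e : R) (us : seq H) :=
  forall x, (forall u, u \in us -> ip x u = 0) -> hnorm (T x) <= e * hnorm x.

Definition ess_small T := forall e, 0 < e -> exists us, small_off T e us.

(** Orthonormalizing the test vectors turns the side condition into an explicit projection
    [id - psum f n], which can be composed with other operators. *)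
Lemma small_off_psum T e us : small_off T e us -> exists2 f, orthoseq f &
  forall n x, (size us <= n)%N ->
    hnorm (T (x - psum f n x)) <= e * hnorm (x - psum f n x).
Proof.
move=> Tus; have [f of_ fP] := gram_schmidt (nth 0 us).
exists f => // n x un; apply: Tus => u /(nthP 0)[k ku <-].
rewrite fP ip_sumr big1// => i _; rewrite ipZr ip_psum_compl ?mulr0//.
exact: leq_trans (ltn_ord i) (leq_trans ku un).
Qed.

Lemma ess_small_psum T e : ess_small T -> 0 < e ->
  exists f n, orthoseq f /\
  forall x, hnorm (T (x - psum f n x)) <= e * hnorm (x - psum f n x).
Proof.
move=> eT e0; have [us /small_off_psum[f of_ fP]] := eT e e0.
by exists f, (size us); split=> // x; apply: fP.
Qed.

Lemma small_offD S T a b us vs : small_off S a us -> small_off T b vs ->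
  small_off (S \+ T) (a + b) (us ++ vs).
Proof.
move=> Sa Tb x xo; rewrite /= (le_trans (hnormD _ _))// mulrDl lerD//.
  by apply: Sa => u uu; apply: xo; rewrite mem_cat uu.
by apply: Tb => u uu; apply: xo; rewrite mem_cat uu orbT.
Qed.

Lemma small_off_compl S T a C us : 0 <= C -> (forall x, hnorm (S x) <= C * hnorm x) ->
  small_off T a us -> small_off (S \o T) (C * a) us.
Proof.
by move=> C0 SC Ta x xo; rewrite /= (le_trans (SC _))// -mulrA ler_wpM2l// Ta.
Qed.

Lemma small_off_compr S T a C us : 0 <= a -> bounded_op S ->
  (forall x, hnorm (S x) <= C * hnorm x) ->
  small_off T a us -> small_off (T \o S) (C * a) (map (adjoint ip S) us).
Proof.
move=> a0 bS SC Ta x xo; rewrite /= (le_trans (Ta _ _))//.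
  move=> u uu; rewrite adjointP//; apply: xo; exact: map_f.
by rewrite (mulrC C) -mulrA ler_wpM2l.
Qed.

Lemma ess_small_compl S T : bounded_op S -> ess_small T -> ess_small (S \o T).
Proof.
move=> /bounded_op_pos[C C0 SC] eT e e0.
have [|us hu] := eT (e / C); first by rewrite divr_gt0.
exists us; have := small_off_compl (ltW C0) SC hu.
by rewrite mulrC divfK// gt_eqF.
Qed.

Lemma ess_small_compr S T : bounded_op S -> ess_small T -> ess_small (T \o S).
Proof.
move=> bS eT e e0; have [C C0 SC] := bounded_op_pos bS.
have [|us hu] := eT (e / C); first by rewrite divr_gt0.
exists (map (adjoint ip S) us); have := small_off_compr _ bS SC hu.
by rewrite [C * _]mulrC divfK ?gt_eqF//; apply; rewrite ltW// divr_gt0.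
Qed.

Lemma ess_small_dominated S T C : 0 <= C ->
  (forall x, hnorm (S x) <= C * hnorm (T x)) -> ess_small T -> ess_small S.
Proof.
move=> C0 ST eT e e0; have C1 : 0 < C + 1 by lra.
have [|us hu] := eT (e / (C + 1)); first by rewrite divr_gt0.
exists us => x xo; rewrite (le_trans (ST x))//.
rewrite (le_trans (ler_wpM2l C0 (hu x xo)))// mulrA ler_wpM2r ?hnorm_ge0//.
rewrite mulrA ler_pdivrMr// mulrC; nra.
Qed.

End OrthoSeq.

(** * Riesz theory *)

Section Dimension.
Context {R : realType} {H : completeNormedModType R[i]}.
Implicit Types (x y z : H) (T L : H -> H) (N S : set H).

Lemma subsp_sum S (I : Type) (r : seq I) (F : I -> H) : subsp S ->
  (forall i, S (F i)) -> S (\sum_(i <- r) F i).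
Proof.
move=> sS SF; elim/big_ind: _ => //; first by case: sS.
by move=> x y; exact: subspD.
Qed.

(** Steinitz exchange by matrices: if [n > m], the [n] by [m] matrix of coordinates of the [e j]
    along the [f i] has a nonzero row vector in its left kernel, which is a dependence of the [e j]
    modulo [S]. *)
Lemma has_dim_mod_le N S n m (e : 'I_n -> H) (f : 'I_m -> H) : subsp S ->
  (forall i, N (e i)) ->
  (forall c : 'I_n -> R[i], S (\sum_i c i *: e i) -> forall i, c i = 0) ->
  (forall x, N x -> exists c : 'I_m -> R[i], S (x - \sum_i c i *: f i)) ->
  (n <= m)%N.
Proof.
move=> sS Ne indep span; rewrite leqNgt; apply/negP => mn.
have /choice[a aP] : forall j, exists c : 'I_m -> R[i], S (e j - \sum_i c i *: f i).
  by move=> j; exact: span.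
pose A : 'M[R[i]]_(n, m) := \matrix_(j, i) a j i.
have : kermx A != 0.
  rewrite kermx_eq0 -row_leq_rank -ltnNge (leq_ltn_trans (rank_leq_col A))//.
case/rowV0Pn => v /sub_kermxP vA /negP; apply; apply/eqP/rowP => i; rewrite mxE.
apply: (indep (fun j => v 0 j)).
have -> : \sum_j v 0 j *: e j = \sum_j v 0 j *: (e j - \sum_i a j i *: f i).
  apply/esym; under eq_bigr do rewrite scalerBr; rewrite sumrB.
  suff -> : \sum_j v 0 j *: \sum_i a j i *: f i = 0 by rewrite subr0.
  under eq_bigr do rewrite scaler_sumr; rewrite exchange_big big1//= => k _.
  have := congr1 (fun M : 'rV_m => M 0 k) vA; rewrite !mxE => vAk.
  under eq_bigr do rewrite scalerA; rewrite -scaler_suml.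
  rewrite (_ : \sum_i _ = 0) ?scale0r// -[RHS]vAk.
  by apply: eq_bigr => j _; rewrite mxE.
by apply: subsp_sum => // j; exact: subspZ.
Qed.

Lemma has_dim_mod_unique N S n m : subsp S ->
  has_dim_mod N S n -> has_dim_mod N S m -> n = m.
Proof.
move=> sS [e [Ne ie se]] [f [Nf jf sf]]; apply/eqP; rewrite eqn_leq.
by rewrite (has_dim_mod_le sS Ne ie sf) (has_dim_mod_le sS Nf jf se).
Qed.

Lemma subsp0 : subsp [set 0 : H].
Proof. by split=> // c x y -> ->; rewrite scaler0 addr0. Qed.

Lemma dimE N n : has_dim N n -> dim N = n.
Proof.
move=> Nn; apply: (has_dim_mod_unique subsp0 _ Nn).
by apply: (getPex (ex_intro (fun k => has_dim N k) n Nn)).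
Qed.

Lemma codimE N S n : subsp S -> has_dim_mod N S n -> codim N S = n.
Proof.
move=> sS Nn; apply: (has_dim_mod_unique sS _ Nn).
by apply: (getPex (ex_intro (fun k => has_dim_mod N S k) n Nn)).
Qed.

Lemma has_dim_mod_image L L' N S n : bounded_op L -> bounded_op L' ->
  L \o L' = id -> L' \o L = id ->
  has_dim_mod N S n -> has_dim_mod (L @` N) (L @` S) n.
Proof.
move=> bL bL' LL' L'L [e [Ne ie se]].
have L'K x : L' (L x) = x by rewrite -[LHS]/((L' \o L) x) L'L.
have Lsum (c : 'I_n -> R[i]) :
    \sum_i c i *: L (e i) = L (\sum_i c i *: e i).
  by rewrite (bop_sum bL); apply: eq_bigr => i _; rewrite (bopZ bL).
exists (L \o e); split=> [i|c|_ [x Nx <-]]; first by exists (e i).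
- rewrite /= Lsum => -[y Sy Ly]; apply: ie.
  by rewrite -[\sum_i _]L'K -Ly L'K.
- have [c Sc] := se x Nx; exists c; rewrite /= Lsum -(bopB bL).
  by exists (x - \sum_i c i *: e i).
Qed.

Lemma closed_image_iso L L' S : bounded_op L -> bounded_op L' ->
  L \o L' = id -> L' \o L = id -> closed S -> closed (L @` S).
Proof.
move=> bL bL' LL' L'L cS; apply: closedI_cvgs => u x Su ux.
exists (L' x); last by rewrite -[LHS]/((L \o L') x) LL'.
apply: (closed_cvgs cS _ (bop_cvgs bL' ux)) => n /=.
have [y Sy <-] := Su n.
by rewrite -[L' (L y)]/((L' \o L) y) L'L.
Qed.

End Dimension.

(** * Finite-rank perturbations of the identity *)

Section FiniteRank.
Context {R : realType} {H : completeNormedModType R[i]}.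
Variable ip : hdot H.
Variables (n : nat) (u v : 'I_n -> H).
Implicit Types (x y z : H).

(** The operator is governed by the row vector [b x]: [b (T x) = b x *m N], and [y] has a preimage
    under [T] as soon as [b y] is of the form [c *m N]. Kernel and cokernel of [T] become those of
    the square matrix [N], whence the equal dimensions [n - \rank N]. *)
Let T x := x + \sum_i ip x (u i) *: v i.
Let b x : 'rV[R[i]]_n := \row_i ip x (u i).
Let Mx : 'M[R[i]]_n := \matrix_(j, i) ip (v j) (u i).
Let N : 'M[R[i]]_n := 1%:M + Mx.

Let b_comb (c : 'rV[R[i]]_n) : b (\sum_j c 0 j *: v j) = c *m Mx.
Proof.
apply/rowP => i; rewrite !mxE ip_suml.
by apply: eq_bigr => j _; rewrite ipZl mxE.
Qed.

Let bD x y : b (x + y) = b x + b y.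
Proof. by apply/rowP => i; rewrite !mxE ipDl. Qed.

Let bN x : b (- x) = - b x.
Proof. by apply/rowP => i; rewrite !mxE ipNl. Qed.

Let bB x y : b (x - y) = b x - b y.
Proof. by rewrite bD bN. Qed.

Let bZ c x : b (c *: x) = c *: b x.
Proof. by apply/rowP => i; rewrite !mxE ipZl. Qed.

Let TE x : T x = x + \sum_j b x 0 j *: v j.
Proof. by congr (_ + _); apply: eq_bigr => i _; rewrite mxE. Qed.

Let bT x : b (T x) = b x *m N.
Proof. by rewrite TE bD b_comb mulmxDr mulmx1. Qed.

Let solve (c : 'rV[R[i]]_n) y : c *m N = b y -> T (y - \sum_j c 0 j *: v j) = y.
Proof.
move=> cN; rewrite TE bB b_comb -cN mulmxDr mulmx1 addrK subrK//.
Qed.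

Let solve_b (c : 'rV[R[i]]_n) y : c *m N = b y -> b (y - \sum_j c 0 j *: v j) = c.
Proof. by move=> cN; rewrite bB b_comb -cN mulmxDr mulmx1 addrK. Qed.

Let rangeT y : range T y <-> (b y <= N)%MS.
Proof.
split=> [[x _ <-]|/submxP[c bc]]; first by rewrite bT submxMl.
by exists (y - \sum_j c 0 j *: v j) => //; apply: solve.
Qed.

Let comb_sum k (c : 'I_k -> R[i]) (A : 'M[R[i]]_(k, n)) :
  \sum_i c i *: (\sum_j A i j *: v j) = \sum_j ((\row_i c i) *m A) 0 j *: v j.
Proof.
under eq_bigr do rewrite scaler_sumr; rewrite exchange_big; apply: eq_bigr => j _.
under eq_bigr do rewrite scalerA; rewrite -scaler_suml; congr (_ *: _).
by rewrite mxE; apply: eq_bigr => i _; rewrite mxE.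
Qed.

(** A kernel vector is [- \sum_j c_j v_j] with [c = b x] in the left kernel of [N]; conversely [b]
    recovers [c] from this combination, so independence holds even if the [v j] are dependent. *)
Lemma finite_rank_kernel_dim : has_dim (kernel T) (n - \rank N).
Proof.
rewrite -mxrank_ker; pose K := kermx N.
pose e i := - (\sum_j row_base K i j *: v j).
have Ksolve (c : 'rV[R[i]]_n) : c *m N = 0 ->
    T (- \sum_j c 0 j *: v j) = 0 /\ b (- \sum_j c 0 j *: v j) = c.
  have b0 : b 0 = 0 by apply/rowP => i; rewrite !mxE ip0l.
  move=> cN; have cN0 : c *m N = b 0 by rewrite b0.
  by have := solve cN0; have := solve_b cN0; rewrite sub0r.
have esum (c : 'I_(\rank K) -> R[i]) : \sum_i c i *: e i =
    - \sum_j ((\row_i c i) *m row_base K) 0 j *: v j.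
  rewrite -comb_sum -sumrN; apply: eq_bigr => i _; rewrite scalerN//.
have rbK (c : 'rV[R[i]]_(\rank K)) : c *m row_base K *m N = 0.
  apply/sub_kermxP; rewrite (submx_trans (submxMl _ _))// eq_row_base submx_refl//.
exists e; split=> [i|c|x Tx].
- have -> : e i = \sum_j (j == i)%:R *: e j.
    rewrite (bigD1 i)//= eqxx scale1r big1 ?addr0// => j /negbTE ->.
    by rewrite scale0r.
  by rewrite esum; case: (Ksolve _ (rbK (\row_j (j == i)%:R))).
- rewrite /= esum => h i; have [_] := Ksolve _ (rbK (\row_i c i)).
  rewrite h => /esym bc.
  have : (\row_i c i) *m row_base K = 0 *m row_base K.
    by rewrite mul0mx bc; apply/rowP => j; rewrite !mxE ip0l.
  by move=> /(row_free_inj (row_base_free K))/rowP/(_ i); rewrite !mxE.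
- have : (b x <= row_base K)%MS.
    rewrite eq_row_base; apply/sub_kermxP; rewrite -bT Tx.
    by apply/rowP => i; rewrite !mxE ip0l.
  move=> /submxP[c bc]; exists (fun i => c 0 i).
  rewrite /= esum (_ : \row_i c 0 i = c); last by apply/rowP => i; rewrite mxE.
  by rewrite -bc opprK -[LHS]TE.
Qed.

(** Membership in the range only depends on [b y] modulo the row space of [N]. The map [b] need not
    be onto, so the representatives are taken as [- \sum_j k_j v_j] with [k] in a complement of that
    row space: their image under [b] is [k - k *m N], which is [k] modulo [N]. *)
Lemma finite_rank_range_codim : has_dim_mod setT (range T) (n - \rank N).
Proof.
rewrite -mxrank_compl; pose K := (N^C)%MS.
pose e i := - (\sum_j row_base K i j *: v j).
have esum (c : 'I_(\rank K) -> R[i]) : \sum_i c i *: e i =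
    - \sum_j ((\row_i c i) *m row_base K) 0 j *: v j.
  by rewrite -comb_sum -sumrN; apply: eq_bigr => i _; rewrite scalerN.
have be c : b (\sum_i c i *: e i) =
    (\row_i c i) *m row_base K - (\row_i c i) *m row_base K *m N.
  by rewrite esum bN b_comb mulmxDr mulmx1 opprD addNKr.
exists e; split=> // [c /rangeT|x _].
- rewrite be => h i.
  have h1 : ((\row_i c i) *m row_base K <= N)%MS.
    rewrite -[X in (X <= _)%MS](subrK ((\row_i c i) *m row_base K *m N)).
    by rewrite addmx_sub// submxMl.
  have h2 : ((\row_i c i) *m row_base K <= K)%MS.
    by rewrite (submx_trans (submxMl _ _))// eq_row_base.
  have : ((\row_i c i) *m row_base K <= N :&: K)%MS by rewrite sub_capmx h1.
  rewrite capmx_compl submx0 => /eqP h3.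
  have : (\row_i c i) *m row_base K = 0 *m row_base K by rewrite mul0mx.
  by move=> /(row_free_inj (row_base_free K))/rowP/(_ i); rewrite !mxE.
- have : (b x <= N + K)%MS by apply: submx_full; exact: addsmx_compl_full.
  case/sub_addsmxP => -[c d] /= bx.
  have : (d *m K <= row_base K)%MS by rewrite eq_row_base submxMl.
  move=> /submxP[c' dc']; exists (fun i => c' 0 i); apply/rangeT.
  rewrite bB be (_ : \row_i c' 0 i = c'); last by apply/rowP => i; rewrite mxE.
  rewrite bx dc' opprB addrACA subrr addr0.
  by rewrite addmx_sub ?submxMl.
Qed.

(** The columns of the cokernel matrix of [N] are linear equations for the row space; read through
    [b], they say that the range is the orthogonal complement of finitely many vectors. *)
Lemma finite_rank_range_closed : closed (range T).
Proof.
pose w l := \sum_i Num.conj (cokermx N i l) *: u i.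
have -> : range T = orthc ip (range w).
  apply/seteqP; split=> [y /rangeT|y yo].
    rewrite submxE => /eqP/rowP h _ [l _ <-]; have := h l; rewrite !mxE => <-.
    rewrite ip_sumr; apply: eq_bigr => i _.
    by rewrite ipZr conjCK mulrC; congr (_ * _); rewrite /b mxE.
  apply/rangeT; rewrite submxE; apply/eqP/rowP => l; rewrite !mxE.
  rewrite -[RHS](yo (w l)); last by exists l.
  rewrite ip_sumr; apply: eq_bigr => i _.
  by rewrite ipZr conjCK mulrC; congr (_ * _); rewrite /b mxE.
exact: closed_orthc.
Qed.

End FiniteRank.

Section RieszIndex.
Context {R : realType} {H : completeNormedModType R[i]}.
Variable ip : hdot H.
Implicit Types (x y z : H) (C : H -> H).

(** Splitting [C] at a finite-dimensional projection leaves a tail [S] of norm at most 1/2, so that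
    [id + S] has a Neumann inverse [L]. Then [id + C] is [id + S] composed with [T0], a finite-rank
    perturbation of the identity, and the isomorphism [id + S] preserves dimension, codimension and
    closedness. *)
Lemma riesz_index C : bounded_op C -> ess_small ip C -> exists n,
  [/\ has_dim (kernel (id \+ C)) n, has_dim_mod setT (range (id \+ C)) n
    & closed (range (id \+ C))].
Proof.
move=> bC eC; have h2 : (0 : R) < 2^-1 by rewrite invr_gt0.
have [f [m [of_ Cf]]] := ess_small_psum eC h2.
pose S x := C (x - psum ip f m x).
have bS : bounded_op S.
  by apply: bounded_op_comp bC (bounded_op_sub bounded_op_id (bounded_psum m of_)).
have [|x|L [bL SL LS]] := neumann bS (ltW h2); first lra.
  rewrite (le_trans (Cf x))// ler_wpM2l ?psum_compl_le//; lra.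
pose T0 x := x + \sum_(i < m) ip x (f i) *: L (C (f i)).
have bIS : bounded_op (id \+ S) by exact: bounded_op_add bounded_op_id bS.
have fact x : (id \+ C) x = (id \+ S) (T0 x).
  have -> : T0 x = x + L (C (psum ip f m x)).
    rewrite /T0 (bop_sum bC) (bop_sum bL); congr (_ + _); apply: eq_bigr => i _.
    by rewrite (bopZ bC) (bopZ bL).
  rewrite (bopD bIS) -[(id \+ S) (L _)]/(((id \+ S) \o L) _) SL /=.
  by rewrite /S -addrA -(bopD bC) subrK.
have kerE : kernel (id \+ C) = kernel T0.
  apply/seteqP; split=> x; rewrite /kernel /mkset fact => h.
    by rewrite -[T0 x]/(id (T0 x)) -LS /= -[T0 x + _]/((id \+ S) (T0 x)) h (bop0 bL).
  by rewrite h (bop0 bIS).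
have rngE : range (id \+ C) = (id \+ S) @` range T0.
  apply/seteqP; split=> [_ [x _ <-]|_ [_ [x _ <-] <-]].
    by exists (T0 x); rewrite ?fact//; exists x.
  by exists x => //; rewrite fact.
have setTE : [set: H] = (id \+ S) @` setT.
  apply/seteqP; split=> // y _; exists (L y) => //.
  by rewrite -[LHS]/(((id \+ S) \o L) y) SL.
eexists; split; first by rewrite kerE; exact: finite_rank_kernel_dim.
  rewrite rngE [X in has_dim_mod X]setTE.
  apply: (has_dim_mod_image bIS bL SL LS); exact: finite_rank_range_codim.
rewrite rngE; apply: (closed_image_iso bIS bL SL LS).
exact: finite_rank_range_closed.
Qed.

Lemma kernel0_orthc T x : (forall x, T x = 0 -> x = 0) -> orthc ip (kernel T) x.
Proof. by move=> T0 z /T0 ->; rewrite ip0r. Qed.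

Lemma fredholm_alternative C : bounded_op C -> ess_small ip C ->
  (forall x, x + C x = 0 -> x = 0) ->
  exists L, [/\ bounded_op L, (id \+ C) \o L = id & L \o (id \+ C) = id].
Proof.
move=> bC eC inj; have [n [kn rn cr]] := riesz_index bC eC.
have bT : bounded_op (id \+ C) by exact: bounded_op_add bounded_op_id bC.
have [d d0 dP] := closed_range_bounded_below ip (conj bT cr).
apply: (inverse_bounded_below bT d0) => [x|y].
  by apply: dP; exact: kernel0_orthc.
have n0 : n = 0%N.
  apply: (has_dim_mod_unique (@subsp0 R H) kn).
  exists (fun=> 0); split=> [i|c _ []//|x /inj ->].
    exact: bop0.
  by exists (fun=> 0); rewrite big_ord0 subr0.
subst n; have [e [_ _ /(_ y Logic.I)[c]]] := rn.
by rewrite big_ord0 subr0 => -[x _ <-]; exists x.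
Qed.

End RieszIndex.

(** * Orthonormal series and bases *)

Section OrthoSeries.
Context {R : realType} {H : completeNormedModType R[i]}.
Variable ip : hdot H.
Implicit Types (x y z : H) (f g h : nat -> H) (c : nat -> R[i]).

Lemma ndec_bounded_cauchy (a : nat -> R) (B e : R) :
  (forall m n, (m <= n)%N -> a m <= a n) -> (forall n, a n <= B) -> 0 < e ->
  exists N, forall m n, (N <= m)%N -> (m <= n)%N -> a n - a m < e.
Proof.
move=> inc aB e0.
have hS : has_sup (range a) by split; [exists (a 0%N), 0%N | exists B => _ [n _ <-]].
have [_ [N _ <-] hN] := sup_adherent e0 hS; exists N => m n Nm mn.
have : a n <= sup (range a) by apply: ub_le_sup; [case: hS|exists n].
have := inc _ _ Nm; lra.
Qed.

Lemma ortho_series_cvg h c (B : R) : orthoseq ip h ->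
  (forall n, hnorm (\sum_(k < n) c k *: h k) ^+ 2 <= B) ->
  exists x, cvgs (fun n => \sum_(k < n) c k *: h k) x.
Proof.
move=> oh; set y := fun n => \sum_(k < n) c k *: h k => yB; apply: cauchys_cvg.
have yS n : y n.+1 = y n + c n *: h n by rewrite /y big_ord_recr.
have orth m n : (m <= n)%N -> ip (y m) (y n - y m) = 0.
  elim: n => [|n IH]; first by rewrite leqn0 => /eqP ->; rewrite subrr ip0r.
  rewrite leq_eqVlt => /predU1P[->|]; first by rewrite subrr ip0r.
  rewrite ltnS => mn; rewrite yS addrAC ipDr IH// add0r ipZr ip_suml big1 ?mulr0// => i _.
  by rewrite ipZl oh ltn_eqF ?mulr0//; exact: leq_trans (ltn_ord i) mn.
have inc m n : (m <= n)%N -> hnorm (y n) ^+ 2 = hnorm (y m) ^+ 2 + hnorm (y n - y m) ^+ 2.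
  by move=> mn; rewrite -(pythagoras (orth _ _ mn)) addrC subrK.
move=> e e0; have e2 : 0 < e ^+ 2 by rewrite exprn_gt0.
have ya m n : (m <= n)%N -> hnorm (y m) ^+ 2 <= hnorm (y n) ^+ 2.
  by move=> mn; rewrite (inc m n)// lerDl sqr_ge0.
have [N NP] := ndec_bounded_cauchy ya yB e2.
have key m n : (N <= m)%N -> (m <= n)%N -> hnorm (y n - y m) < e.
  move=> Nm mn; have := NP m n Nm mn; rewrite (inc m n)// addrAC subrr add0r.
  by rewrite ltr_pXn2r// ?nnegrE ?hnorm_ge0// ltW.
exists N => m n Nm Nn; case: (leqP m n) => [mn|/ltnW nm]; last exact: key.
by rewrite hnorm_distC key.
Qed.

Lemma diag_op f h c (C : R) : orthoseq ip f -> orthoseq ip h -> 0 <= C ->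
  (forall k, cabs (c k) <= C) ->
  exists2 D, bounded_op D &
    forall x, cvgs (fun n => \sum_(k < n) (c k * ip x (f k)) *: h k) (D x).
Proof.
move=> of_ oh C0 cC.
have bnd x n : hnorm (\sum_(k < n) (c k * ip x (f k)) *: h k) <= C * hnorm x.
  rewrite -(@ler_pXn2r _ 2) ?nnegrE ?mulr_ge0 ?hnorm_ge0//.
  rewrite (@hnorm_sum_ortho _ _ ip _ _ (fun k => c k * ip x (f k)))// exprMn.
  rewrite (le_trans _ (ler_wpM2l (sqr_ge0 C) (bessel n x of_)))// mulr_sumr.
  apply: ler_sum => i _; rewrite -exprMn ler_pXn2r ?nnegrE ?mulr_ge0 ?cabs_ge0 ?hnorm_ge0//.
  rewrite cabsM (@le_trans _ _ (C * cabs (ip x (f i)) * 1))//; last by rewrite mulr1.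
  by rewrite ler_pM ?mulr_ge0 ?cabs_ge0 ?hnorm_ge0// ?ler_wpM2r ?cabs_ge0 ?(orthoseq_norm_le1 _ oh).
have /choice[D DP] : forall x, exists y,
    cvgs (fun n => \sum_(k < n) (c k * ip x (f k)) *: h k) y.
  move=> x; apply: (@ortho_series_cvg h (fun k => c k * ip x (f k)) ((C * hnorm x) ^+ 2) oh) => n.
  by rewrite ler_pXn2r ?nnegrE ?mulr_ge0 ?hnorm_ge0.
exists D => //; apply: (@bounded_opI _ _ _ C) => [a x y|x].
  apply: (cvgs_unique (DP _)).
  apply: cvgs_ext (cvgsD (cvgsZ a (DP x)) (DP y)) => n.
  rewrite scaler_sumr -big_split /=; apply: eq_bigr => i _.
  by rewrite ipDl ipZl scalerA mulrDr scalerDl mulrCA.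
by apply: (hnorm_cvgs_le (N := 0%N) (DP x)) => n _; exact: bnd.
Qed.

Lemma separable_orthobasis : separable H ->
  exists2 f, orthoseq ip f & forall x, cvgs (fun n => psum ip f n x) x.
Proof.
move=> [D /countable_injP[g ginj] dD].
(* An enumeration of the dense set obtained by inverting the injection [g]; it takes an arbitrary
   value at an [n] outside the image of [g], which only adds a vector to the sequence. *)
pose d n := get [set x | D x /\ g x = n].
have dg x : D x -> d (g x) = x.
  move=> Dx; have [Dd gd] := getPex (ex_intro (fun z => D z /\ g z = g x) x (conj Dx erefl)).
  by apply: ginj => //; exact: mem_set.
have [f of_ fP] := gram_schmidt ip d; exists f => // x e e0.
have e0c : (0 : R[i]) < e%:C by rewrite ltcR.
have [|y [yx Dy]] := dD (ball x e%:C) _ (ball_open x e%:C).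
  by exists x; exact: ballxx.
exists (g y).+1 => n gn.
(* The point [y] is reproduced exactly by the first [(g y).+1] Gram-Schmidt vectors, and by Bessel's
   identity the residual can only decrease with more vectors. *)
have yn : y - psum ip f n y = 0.
  apply: hnorm_le0.
  have : y - psum ip f (g y).+1 y = 0 
    by have := fP (g y); rewrite dg// => <-; rewrite subrr.
  move/(congr1 (fun z => hnorm z)); rewrite hnorm0 => <-.
  rewrite -(@ler_pXn2r _ 2) ?nnegrE ?hnorm_ge0//.
  have := bessel_eq n y of_; rewrite (bessel_eq (g y).+1 y of_).
  have : \sum_(k < (g y).+1) cabs (ip y (f k)) ^+ 2 <=
      \sum_(k < n) cabs (ip y (f k)) ^+ 2.
    rewrite (big_ord_widen n (fun k => cabs (ip y (f k)) ^+ 2) gn) big_mkcond.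
    by apply: ler_sum => i _; case: ifP => // _; rewrite sqr_ge0.
  lra.
rewrite hnorm_distC; have -> : x - psum ip f n x = x - y - psum ip f n (x - y).
  by rewrite (bopB (bounded_psum n of_)) -(subr0_eq yn) opprB subrKA.
rewrite (le_lt_trans (psum_compl_le n _ of_))//.
by move: yx; rewrite -ball_normE /= hnormE ltcR.
Qed.

End OrthoSeries.

(** * Operator ideals *)

Section Ideal.
Context {R : realType} {H : completeNormedModType R[i]}.
Variable ip : hdot H.
Variable J : set (H -> H).
Hypothesis iJ : operator_ideal J.
Implicit Types (x y z : H) (K L T : H -> H).

Lemma ideal_bounded K : J K -> bounded_op K.
Proof. by case: iJ => + _ _ _; apply. Qed.

Lemma idealD K L : J K -> J L -> J (K \+ L).
Proof. by case: iJ => _ _ + _; apply. Qed.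

Lemma ideal_compl T K : bounded_op T -> J K -> J (T \o K).
Proof. by move=> bT JK; case: iJ => _ _ _ /(_ K T JK bT)[]. Qed.

Lemma ideal_compr T K : bounded_op T -> J K -> J (K \o T).
Proof. by move=> bT JK; case: iJ => _ _ _ /(_ K T JK bT)[]. Qed.

Lemma idealZ c K : J K -> J (fun x => c *: K x).
Proof. exact: ideal_compl (bounded_op_scale c). Qed.

Lemma idealN K : J K -> J (fun x => - K x).
Proof.
by move=> /(idealZ (-1)); congr J; apply/funext => x; rewrite scaleN1r.
Qed.

Lemma idealBC K L : J (K \- L) -> J (L \- K).
Proof. by move=> /idealN; congr J; apply/funext => x /=; rewrite opprB. Qed.

Lemma ideal0 : J (fun=> 0).
Proof. by case: iJ. Qed.

Lemma bounded_rank1 u v : bounded_op (fun x => ip x u *: v).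
Proof.
apply: (@bounded_opI _ _ _ (hnorm u * hnorm v)) => [c x y|x].
  by rewrite ipDl ipZl scalerDl scalerA.
by rewrite hnormZ mulrC [_ * hnorm v]mulrC -mulrA ler_wpM2l ?hnorm_ge0// mulrC cauchy_schwarz.
Qed.

(** A nonzero member [K], with [K x0 <> 0], is sandwiched between two rank-one operators: [x] goes
    to [ip x u *: x0], then to [ip x u *: K x0], then to [ip x u *: v]. *)
Lemma ideal_rank1 u v : J <> [set (fun=> 0)] -> J (fun x => ip x u *: v).
Proof.
move=> J0; have [K [JK [x0 Kx0]]] : exists K, J K /\ exists x, K x <> 0.
  apply: contrapT => nK; apply: J0; apply/seteqP; split=> [K JK|_ ->]; last exact: ideal0.
  apply/funext => x; apply: contrapT => Kx; apply: nK.
  by exists K; split=> //; exists x.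
have bK := ideal_bounded JK.
have k0 : ip (K x0) (K x0) != 0 by apply/eqP => /ipxx_eq0.
have := ideal_compl (bounded_rank1 (K x0) ((ip (K x0) (K x0))^-1 *: v))
  (ideal_compr (bounded_rank1 u x0) JK).
congr J; apply/funext => x /=.
by rewrite (bopZ bK) ipZl scalerA mulfK.
Qed.

Lemma ideal_finite_rank n (u v : 'I_n -> H) : J <> [set (fun=> 0)] ->
  J (fun x => \sum_i ip x (u i) *: v i).
Proof.
move=> J0; elim: n u v => [|n IH] u v.
  by have := ideal0; congr J; apply/funext => x; rewrite big_ord0.
have := idealD (IH (fun i => u (widen_ord (leqnSn n) i)) (fun i => v (widen_ord (leqnSn n) i)))
  (ideal_rank1 (u ord_max) (v ord_max) J0).
by congr J; apply/funext => x; rewrite big_ord_recr.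
Qed.

(** Failure of smallness gives a unit vector with large image off any finite set. Each [f n] is
    chosen orthogonal to every earlier [f k] and also to [K^* K (f k)]; the latter makes the images
    orthogonal as well. *)
Lemma not_ess_small_orthoseq K : bounded_op K -> ~ ess_small ip K ->
  exists2 e : R, 0 < e & exists f, [/\ orthoseq ip f, forall n, e < hnorm (K (f n))
    & forall m n, m != n -> ip (K (f m)) (K (f n)) = 0].
Proof.
move=> bK /existsNP[e /not_implyP[e0 noK]]; exists e => //.
have /choice[p pP] : forall us : seq H, exists x,
    [/\ hnorm x = 1, forall u, u \in us -> ip x u = 0 & e < hnorm (K x)].
  move=> us; move/forallNP: noK => /(_ us)/existsNP[x /not_implyP[xo /negP]].
  rewrite -ltNge => Kx; have nx : 0 < hnorm x.
    rewrite hnorm_gt0; apply/eqP => x0; move: Kx.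
    by rewrite x0 (bop0 bK) hnorm0 mulr0 ltxx.
  exists ((hnorm x)^-1%:C *: x); split=> [|u uu|].
  - by rewrite hnormZ cabs_pos ?invr_ge0 ?hnorm_ge0// mulVf// gt_eqF.
  - by rewrite ipZl xo ?mulr0.
  - by rewrite (bopZ bK) hnormZ cabs_pos ?invr_ge0 ?hnorm_ge0// ltr_pdivlMl// mulrC.
pose us := fix us n := if n is m.+1
  then [:: p (us m), adjoint ip K (K (p (us m))) & us m] else [::].
pose f n := p (us n).
have mem k n : (k < n)%N -> f k \in us n /\ adjoint ip K (K (f k)) \in us n.
  elim: n => // n IH; rewrite ltnS leq_eqVlt => /predU1P[->|/IH[h1 h2]].
    by rewrite /= !inE !eqxx orbT.
  by rewrite /= !inE h1 h2 !orbT.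
have o1 k n : (k < n)%N -> ip (f n) (f k) = 0.
  by move=> /mem[h _]; have [_ + _] := pP (us n); apply.
have o2 k n : (k < n)%N -> ip (K (f n)) (K (f k)) = 0.
  by move=> /mem[_ h]; rewrite adjointP//; have [_ + _] := pP (us n); apply.
exists f; split=> [i j|n|m n].
- have [->|] := eqVneq i j.
    have [h _ _] := pP (us j); rewrite ipxx /f h expr1n.
    by have -> : p (us j) != 0; [rewrite -hnorm_eq0 h oner_eq0|].
  by case: (ltngtP i j) => // [/o1/ip_eq0C ->|/o1 ->].
- by case: (pP (us n)).
- by case: (ltngtP m n) => // [/o2/ip_eq0C ->|/o2 ->].
Qed.

(* Calkin: a non-compact [K] is bounded below along an orthonormal sequence, and
   mapping an orthonormal basis onto it factors the identity through [K]. *)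
Lemma ideal_ess_small K : separable H -> J <> bounded_op -> J K -> ess_small ip K.
Proof.
move=> sH Jb JK; apply: contrapT => nK; apply: Jb.
have bK := ideal_bounded JK.
have [e e0 [f [of_ eK Kf]]] := not_ess_small_orthoseq bK nK.
have Kf0 n : 0 < hnorm (K (f n)) := lt_trans e0 (eK n).
have Kfn n : hnorm (K (f n)) != 0 by rewrite gt_eqF.
pose h n := (hnorm (K (f n)))^-1%:C *: K (f n).
have oh : orthoseq ip h.
  move=> i j; have [->|ij] := eqVneq i j; last first.
    by rewrite /h ipZl ipZr Kf// !mulr0.
  have -> : h j != 0 by rewrite scaler_eq0 (fmorph_eq0 (real_complex R)) invr_eq0 (negbTE (Kfn j)) -hnorm_eq0 (negbTE (Kfn j)).
  by rewrite /h ipZl ipZr conj_real ipxx -!rmorphM/= expr2 mulKf// mulVf.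
have [b ob bb] := separable_orthobasis ip sH.
have [|U bU UP] := @diag_op _ _ ip b f (fun=> 1) 1 ob of_ ler01.
  by move=> k; rewrite cabs1.
(* [W] undoes [K \o U] on the basis: [K] sends [f n] to [hnorm (K (f n))] times [h n], and the
   reciprocal weights are bounded by [e^-1] because the images are bounded below by [e]. *)
have [||W bW WP] := @diag_op _ _ ip h b (fun n => (hnorm (K (f n)))^-1%:C) e^-1 oh ob.
- by rewrite invr_ge0 ltW.
- by move=> k; rewrite cabs_pos ?invr_ge0 ?hnorm_ge0// lef_pV2 ?posrE// ltW.
have WKU : W \o (K \o U) = id.
  apply/funext => x; apply: (cvgs_unique (WP _)).
  apply: cvgs_ext (bb x) => n; apply: eq_bigr => k _; congr (_ *: _).
  have : ip (K (U x)) (h k) = ip x (b k) * (hnorm (K (f k)))%:C.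
    rewrite adjointP//; apply: (ip_cvgs_eq (n0 := k.+1) (UP x)) => m km.
    rewrite -adjointP// (bop_sum bK) ip_suml (bigD1 (Ordinal km))//= big1 ?addr0.
      rewrite (bopZ bK) ipZl mul1r; congr (_ * _).
      by rewrite /h ipZr conj_real ipxx -rmorphM/= expr2 mulKf.
    move=> i ik; rewrite (bopZ bK) ipZl /h ipZr Kf ?mulr0//.
  by move=> /= ->; rewrite mulrC -mulrA -rmorphM/= mulfV// rmorph1 mulr1.
have Jid : J id by rewrite -WKU; apply: ideal_compl => //; exact: ideal_compr.
apply/seteqP; split=> [T|T bT]; first exact: ideal_bounded.
exact: (ideal_compl bT Jid).
Qed.

End Ideal.

(** * Invertible operators congruent to the identity modulo an ideal *)

Section Positive.
Context {R : realType} {H : completeNormedModType R[i]}.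
Variable ip : hdot H.
Implicit Types (x y z : H) (a T : H -> H).

(** Polarization: the quadratic form of [a] is real at [x + c *: y] for [c = 1] and [c = 'i], which
    yields the imaginary and the real part of the identity. *)
Lemma positive_sym a x y : positive_op ip a -> ip (a x) y = ip x (a y).
Proof.
move=> [ba pa].
have sym z : complex.Im (ip (a z) z) = 0 by exact: ger0_Im.
have e c : complex.Im (ip (a x) (c *: y) + ip (a (c *: y)) x) = 0.
  have := sym (x + c *: y); rewrite (bopD ba) !ipDl !ipDr !raddfD /=.
  have := sym x; have := sym (c *: y); lra.
have := e 1; have := e 'i; rewrite scale1r (bopZ ba) ipZr ipZl !conjE (ipC ip x (a y)) conjE.
case: (ip (a x) y) => p q; case: (ip (a y) x) => r s /=.
rewrite !mul0r !add0r mulN1r mul1r => h1 h2.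
by apply/eqP; rewrite eq_complex /=; apply/andP; split; apply/eqP; lra.
Qed.

Lemma positive_Re a x : positive_op ip a -> ip (a x) x = (complex.Re (ip (a x) x))%:C.
Proof. by move=> [_ pa]; apply: real_ge0. Qed.

Lemma positive_Re_ge0 a x : positive_op ip a -> 0 <= complex.Re (ip (a x) x).
Proof. by move=> pa; rewrite -ler0c -positive_Re//; case: pa. Qed.

Lemma Re_ip_bound T L x : (forall x, hnorm (T x) <= L * hnorm x) ->
  complex.Re (ip (T x) x) <= L * hnorm x ^+ 2.
Proof.
move=> TL; rewrite (le_trans (Re_le_cabs _))// (le_trans (cauchy_schwarz _ _ _))//.
by rewrite expr2 mulrA ler_wpM2r ?hnorm_ge0.
Qed.

(** Positivity of [a] at the single vector [x - L^-1 a x], with [<a (a x), a x> <= L |a x|^2]. It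
    replaces the Cauchy-Schwarz inequality for the form of [a], before square roots are
    available. *)
Lemma positive_hnorm_sqr a L x : positive_op ip a -> 0 < L ->
  (forall x, hnorm (a x) <= L * hnorm x) ->
  hnorm (a x) ^+ 2 <= L * complex.Re (ip (a x) x).
Proof.
move=> pa L0 aL; have ba := pa.1.
have := positive_Re_ge0 (x - (L^-1)%:C *: a x) pa.
rewrite (bopB ba) (bopZ ba) ipBl !ipBr !ipZl !ipZr conj_real.
rewrite (positive_sym (a x) x pa) ipxx (positive_Re (a x) pa) (positive_Re x pa).
rewrite !raddfB /=; have := Re_ip_bound (a x) aL.
move: (complex.Re (ip (a (a x)) (a x))) (complex.Re (ip (a x) x)) (hnorm (a x) ^+ 2).
move=> p q n h g; have t0 : 0 < L^-1 by rewrite invr_gt0.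
rewrite -(ler_pM2l t0) mulKf ?gt_eqF//.
have : L^-1 * (L^-1 * p) <= L^-1 * n.
  by rewrite ler_pM2l// mulrC ler_pdivrMr// mulrC.
move: g; move: (L^-1) => t; lra.
Qed.

(** Expanding the square gives [-2t <a x, x> + t^2 |a x|^2], and the last term is at most
    [t <a x, x>] as [t L <= 1]. A lower bound on [<a x, x>] thus turns [id - t a] into a strict
    contraction. *)
Lemma positive_contraction a L t x : positive_op ip a -> 0 < L -> 0 <= t ->
  t * L <= 1 -> (forall x, hnorm (a x) <= L * hnorm x) ->
  hnorm (x - t%:C *: a x) ^+ 2 <= hnorm x ^+ 2 - t * complex.Re (ip (a x) x).
Proof.
move=> pa L0 t0 tL aL; have := positive_hnorm_sqr x pa L0 aL.
have := positive_Re_ge0 x pa.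
rewrite (hnormB_sqr ip) hnormZ cabs_pos// ipZr conj_real.
rewrite -(positive_sym _ _ pa) (positive_Re x pa) -rmorphM /= exprMn.
move: (complex.Re _) (hnorm (a x) ^+ 2) (hnorm x ^+ 2) => p q n p0 h.
have : t * q <= t * L * p by rewrite -mulrA ler_wpM2l.
have : t * L * p <= p by rewrite ler_piMl.
move=> h1 h2; have : t * (t * q) <= t * p by rewrite ler_wpM2l//; lra.
rewrite mulrA -expr2; lra.
Qed.

Lemma positive_invertible a d : positive_op ip a -> 0 < d ->
  (forall x, d * hnorm x ^+ 2 <= complex.Re (ip (a x) x)) ->
  exists L, [/\ bounded_op L, a \o L = id & L \o a = id].
Proof.
move=> pa d0 da; have ba := pa.1.
have [M M0 aM] := bounded_op_pos ba.
(* This [t] satisfies both [t M <= 1], needed for the contraction estimate, and [t d < 1], so that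
   [t a - id] has norm at most [sqrt (1 - t d) < 1]. *)
pose t := (M + d)^-1; have t0 : 0 < t by rewrite invr_gt0; lra.
have tM : t * M <= 1 by rewrite /t mulrC ler_pdivrMr; lra.
have td : t * d < 1 by rewrite /t mulrC ltr_pdivrMr; lra.
pose S x := (t%:C *: a x) - x.
have bS : bounded_op S.
  exact: bounded_op_sub (bounded_op_scaled _ ba) bounded_op_id.
have td0 : 0 < t * d by rewrite mulr_gt0.
have [|x|L [bL SL LS]] := neumann bS (sqrtr_ge0 (1 - t * d)).
- by rewrite -[ltRHS]sqrtr1 ltr_sqrt//; lra.
- rewrite -(@ler_pXn2r _ 2) ?nnegrE ?mulr_ge0 ?sqrtr_ge0 ?hnorm_ge0//.
  rewrite exprMn sqr_sqrtr; last by lra.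
  rewrite /S hnorm_distC (le_trans (positive_contraction x pa M0 (ltW t0) tM aM))//.
  rewrite mulrBl mul1r lerD2l lerN2 -mulrA; exact: ler_wpM2l (ltW t0) _ _ (da x).
have IS : id \+ S = fun x => t%:C *: a x.
  by apply/funext => x; rewrite /S /= addrC subrK.
exists (fun x => L (t%:C *: x)); split.
- exact: bounded_op_comp bL (bounded_op_scale _).
- apply/funext => x; have tC : t%:C != 0 :> R[i].
    by rewrite (fmorph_eq0 (real_complex R)) gt_eqF.
  apply: (scalerI tC); rewrite /= -[LHS]/((fun x => t%:C *: a x) (L (t%:C *: x))).
  by rewrite -IS -[LHS]/(((id \+ S) \o L) _) SL.
- by apply/funext => x; rewrite -[LHS]/(L ((fun x => t%:C *: a x) x)) -IS -[LHS]/((L \o (id \+ S)) x) LS.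
Qed.

(** With [P] the projection onto N(A), [A^* A + P] is coercive since [A] is bounded below off its
    kernel; its inverse composed with [A^*] is the required [A']. *)
Lemma pseudo_inverse A : closed_range A -> exists2 A', bounded_op A' &
  forall x, A' (A x) = x - proj ip (kernel A) x.
Proof.
move=> crA; have [bA _] := crA.
have [d d0 Ad] := closed_range_bounded_below ip crA.
have sN := subsp_kernel bA; have cN := closed_kernel bA.
pose P := proj ip (kernel A).
have bP : bounded_op P by exact: bounded_proj.
have bA' := bounded_adjoint ip bA.
pose a x := adjoint ip A (A x) + P x.
have ba : bounded_op a by apply: bounded_op_add bP; exact: bounded_op_comp.
have PN x : A (P x) = 0 by exact: (proj_in ip sN cN x).
have APx x : A (x - P x) = A x by rewrite (bopB bA) PN subr0.
have aE x : ip (a x) x = (hnorm (A x) ^+ 2 + hnorm (P x) ^+ 2)%:C.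
  rewrite rmorphD /= -!(ipxx ip) ipDl adjointPl//; congr (_ + _).
  rewrite -{2}[x](subrK (P x)) ipDr.
  by rewrite (ip_eq0C (proj_compl ip sN cN x (proj_in ip sN cN x))) add0r.
have pa : positive_op ip a.
  by split=> // x; rewrite aE ler0c addr_ge0 ?sqr_ge0.
pose m := Num.min (d ^+ 2) 1.
have m0 : 0 < m by rewrite lt_min exprn_gt0 ?ltr01.
have [|L [bL aL La]] := positive_invertible pa m0.
  move=> x; rewrite aE /= (hnorm_proj ip sN cN x) -/P.
  have := Ad _ (proj_compl ip sN cN x); rewrite -/P APx => h.
  have : (d * hnorm (x - P x)) ^+ 2 <= hnorm (A x) ^+ 2.
    by rewrite ler_pXn2r ?nnegrE ?mulr_ge0 ?hnorm_ge0// ltW.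
  have m1 : m <= 1 by rewrite ge_min lexx orbT.
  have m2 : m <= d ^+ 2 by rewrite ge_min lexx.
  rewrite exprMn; move: m2; move: (d ^+ 2) => e m2.
  have := sqr_ge0 (hnorm (P x)); have := sqr_ge0 (hnorm (x - P x)).
  move: (_ ^+ 2) (_ ^+ 2) (_ ^+ 2) => p q r; nra.
exists (L \o adjoint ip A); first exact: bounded_op_comp.
move=> x; rewrite -[RHS]/(id _) -La /= -/P; congr (L _).
rewrite /a APx [P (_ - _)](_ : _ = 0) ?addr0//.
by apply: (proj_orthc sN cN); exact: proj_compl.
Qed.

End Positive.

Section Biorthogonal.
Context {R : realType} {H : completeNormedModType R[i]}.
Variable ip : hdot H.

(** The dual family is read off from the inverse of the Gram matrix. The second property keeps it in
    the span of [q], so that dual vectors of a family orthogonal to R(A) are themselves orthogonal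
    to R(A). *)
Lemma biorthogonal n (q : 'I_n -> H) :
  (forall c : 'I_n -> R[i], \sum_i c i *: q i = 0 -> forall i, c i = 0) ->
  exists2 w : 'I_n -> H, forall i j, ip (q j) (w i) = (j == i)%:R
    & forall S, subsp S -> (forall i, S (q i)) -> forall i, S (w i).
Proof.
move=> indep; pose M : 'M[R[i]]_n := \matrix_(j, k) ip (q j) (q k).
have uM : M \in unitmx.
  rewrite -row_free_unit -kermx_eq0; apply: contraT => /rowV0Pn[v /sub_kermxP vM /eqP[]].
  apply/rowP => i; rewrite mxE; apply: (indep (fun j => v 0 j)).
  apply: (@ipxx_eq0 _ _ ip); rewrite ip_sumr big1// => k _.
  rewrite ipZr; have := congr1 (fun A : 'rV_n => A 0 k) vM; rewrite !mxE => h.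
  rewrite ip_suml (_ : \sum_i _ = 0) ?mulr0// -[RHS]h.
  by apply: eq_bigr => j _; rewrite ipZl mxE.
exists (fun i => \sum_k Num.conj (invmx M k i) *: q k) => [i j|S sS Sq i].
  have := congr1 (fun A : 'M[R[i]]_n => A j i) (mulmxV uM).
  rewrite [RHS]mxE [LHS]mxE => <-.
  by rewrite ip_sumr; apply: eq_bigr => k _; rewrite ipZr conjCK mulrC [M j k]mxE.
by apply: subsp_sum => // k; exact: subspZ.
Qed.

End Biorthogonal.

Section GLJ.
Context {R : realType} {H : completeNormedModType R[i]}.
Variable ip : hdot H.
Hypothesis sepH : separable H.
Variable J : set (H -> H).
Hypothesis properJ : proper_ideal J.
Variables A B : H -> H.
Hypotheses (crA : closed_range A) (crB : closed_range B).

Let iJ : operator_ideal J. Proof. by case: properJ. Qed.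
Let J0 : J <> [set (fun=> 0)]. Proof. by case: properJ. Qed.
Let J_small K : J K -> ess_small ip K.
Proof. by apply: ideal_ess_small => //; case: properJ. Qed.
Let bA : bounded_op A. Proof. by case: crA. Qed.
Let bB : bounded_op B. Proof. by case: crB. Qed.

Lemma GLJ_factor_kernel : (exists2 G, GLJ J G & G \o A = B) ->
  J (A \- B) /\ kernel A = kernel B.
Proof.
move=> [G [bG [G' [bG' GG' G'G]] JG] <-]; split.
  have := idealN iJ (ideal_compr iJ bA JG).
  by congr J; apply/funext => x /=; rewrite opprB.
apply/seteqP; split=> x; rewrite /kernel /mkset /= => h; first by rewrite h bop0.
by rewrite -[A x]/(id (A x)) -G'G /= h bop0.
Qed.

Lemma kernel_factor_GLJ : J (A \- B) -> kernel A = kernel B ->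
  exists2 G, GLJ J G & G \o A = B.
Proof.
move=> JAB kAB; have [A' bA' A'A] := pseudo_inverse ip crA.
pose C := (B \- A) \o A'.
have JC : J C by apply: (ideal_compr iJ bA'); exact: (idealBC iJ JAB).
have bC := ideal_bounded iJ JC.
have TA x : A x + C (A x) = B x.
  have Nx : kernel A (proj ip (kernel A) x).
    exact: proj_in (subsp_kernel bA) (closed_kernel bA) x.
  rewrite /C /= A'A (bopB bA) (bopB bB) Nx.
  by move: Nx; rewrite kAB => ->; rewrite !subr0 addrC subrK.
have [n [[e [ke ie se]] [g [_ ig _]] _]] := riesz_index bC (J_small JC).
(* By [TA] and N(A) = N(B), a kernel vector of [id + C] inside [range A] is zero. The components
   [Q (e i)] therefore stay independent, and functionals dual to them give an [F] that kills
   [range A] and sends [e i] to [g i]. *)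
pose Q x := x - proj ip (range A) x.
have sA := subsp_range bA; have cA := crA.2.
have bQ : bounded_op Q by apply: bounded_op_sub bounded_op_id _; exact: bounded_proj.
have indep (c : 'I_n -> R[i]) : \sum_i c i *: Q (e i) = 0 -> forall i, c i = 0.
  have -> : \sum_i c i *: Q (e i) = Q (\sum_i c i *: e i).
    by rewrite (bop_sum bQ); apply: eq_bigr => i _; rewrite (bopZ bQ).
  move=> /subr0_eq ceA; apply: ie => /=.
  have [u _ uA] := proj_in ip sA cA (\sum_i c i *: e i); rewrite -ceA in uA.
  have bT : bounded_op (id \+ C) by exact: bounded_op_add bounded_op_id bC.
  have : (id \+ C) (\sum_i c i *: e i) = 0.
    rewrite (bop_sum bT) big1// => i _.
    by rewrite (bopZ bT) (ke i : (id \+ C) (e i) = 0) scaler0.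
  rewrite -uA /= TA => Bu; have : kernel B u by [].
  by rewrite -kAB.
have [w wq wS] := biorthogonal ip indep.
have wA i z : range A z -> ip z (w i) = 0.
  move=> Az; apply: ip_eq0C; apply: (wS (orthc ip (range A))) => //.
    exact: subsp_orthc.
  by move=> j; exact: proj_compl.
have we i j : ip (e j) (w i) = (j == i)%:R.
  rewrite -wq /Q ipBl [X in _ - X]wA ?subr0//; exact: proj_in.
pose F x := \sum_i ip x (w i) *: g i.
have JF : J F := ideal_finite_rank ip iJ w g J0.
have JCF := idealD iJ JC JF; have bCF := ideal_bounded iJ JCF.
have [x|L [bL GL LG]] := fredholm_alternative bCF (J_small JCF).
  rewrite /= addrA => h.
  (* The [g i] are independent modulo the range of [id + C], so [(id + C) x = - F x] annihilates the
     coefficients of [F x]. Then [x] is in the kernel, and these same numbers are its coordinates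
     along the [e i]. *)
  have w0 : forall i, ip x (w i) = 0.
    apply: ig; exists (- x) => //=; rewrite (bopN bC).
    by apply/esym/eqP; rewrite -opprD -addr_eq0 addrC; apply/eqP.
  have : kernel (id \+ C) x.
    by move: h; rewrite /kernel /mkset /= [F x]big1 ?addr0// => i _; rewrite w0 scale0r.
  move=> /se[c /subr0_eq xc]; rewrite xc big1// => i _.
  rewrite (_ : c i = 0) ?scale0r// -(w0 i) xc ip_suml (bigD1 i)//= ipZl we eqxx mulr1.
  by rewrite big1 ?addr0// => j ji; rewrite ipZl we (negbTE ji) mulr0.
exists (id \+ (C \+ F)).
  split; first exact: bounded_op_add bounded_op_id bCF.
    by exists L.
  by move: JCF; congr J; apply/funext => x /=; rewrite [RHS]addrC addKr.
apply/funext => x; rewrite /= addrA TA [F _]big1 ?addr0// => i _.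
by rewrite wA ?scale0r//; exists x.
Qed.

Lemma GLJ_factor_fredholm : (exists2 G, GLJ J G & G \o A = B) ->
  fredholm_pair (ortho_proj ip (range A)) (ortho_proj ip (range B)) /\
  ess_codim (ortho_proj ip (range A)) (ortho_proj ip (range B)) = 0.
Proof.
move=> [G [bG [G' [bG' GG' G'G]] JG] GA].
have sA := subsp_range bA; have cA := crA.2.
have sB := subsp_range bB; have cB := crB.2.
rewrite /fredholm_pair /ess_codim -!/(proj ip _) !range_proj//.
pose PA := proj ip (range A); pose PB := proj ip (range B).
rewrite -/PA -/PB.
have bPB : bounded_op PB by exact: bounded_proj.
have PBin x : range B (PB x) by exact: proj_in.
have PBid x : range B x -> PB x = x by exact: proj_id.
(* Chosen so that [S (G y) = G y - PB (G y - y) = PB y] for [y] in [range A]. The outer [PB] keeps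
   [range B] invariant under [S], the inner one makes [S] the identity on the orthogonal
   complement. *)
pose C x := - PB ((G \- id) (G' (PB x))).
have JC : J C.
  apply: (idealN iJ (K := fun x => PB ((G \- id) (G' (PB x))))).
  apply: (ideal_compl iJ (K := fun x => (G \- id) (G' (PB x))) bPB).
  by apply: (ideal_compr iJ (T := fun x => G' (PB x)) _ JG); exact: bounded_op_comp.
have bC := ideal_bounded iJ JC.
pose S := id \+ C; have bS : bounded_op S by exact: bounded_op_add bounded_op_id bC.
have [n [kS rS cS]] := riesz_index bC (J_small JC); rewrite -/S in kS rS cS.
have GAin x : range A x -> range B (G x).
  by move=> [u _ <-]; exists u; rewrite -?GA.
have G'Bin x : range B x -> range A (G' x).
  move=> [u _ <-]; exists u => //; rewrite -GA.
  by rewrite -[RHS]/((G' \o G) (A u)) G'G.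
have SG x : range A x -> PB (PA x) = S (G x).
  move=> Ax; rewrite /PA (proj_id ip sA cA Ax) /S /C /= (PBid (G x)); last exact: GAin.
  rewrite -[G' (G x)]/((G' \o G) x) G'G /= (bopB bPB) (PBid (G x)) ?opprB; last exact: GAin.
  by rewrite addrC subrK.
have Sin x : range B x -> range B (S x).
  by move=> Bx; apply: (subspD sB) => //; apply: (subspN sB).
have Sid x : orthc ip (range B) x -> S x = x.
  move=> xo; rewrite /S /C /= [PB x](proj_orthc sB cB xo).
  by rewrite (bop0 bG') (bop0 bG) subr0 (bop0 bPB) oppr0 addr0.
have imE : (PB \o PA) @` range A = S @` range B.
  apply/seteqP; split=> z [y Hy <-].
    by exists (G y); [exact: GAin|rewrite /= SG].
  exists (G' y); first exact: G'Bin.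
  by rewrite /= SG; [rewrite -[G (G' y)]/((G \o G') y) GG'|exact: G'Bin].
(* [S] is block diagonal for [range B] and its complement, with identity on the complement; its
   index is that of its restriction to [range B]. *)
have capE : S @` range B = range S `&` range B.
  apply/seteqP; split=> z; first by move=> [w Bw <-]; split; [exists w|exact: Sin].
  move=> [[x _ <-] Sx].
  exists (PB x) => //.
  have xo : orthc ip (range B) (x - PB x) by exact: proj_compl.
  have : range B (x - PB x).
    by rewrite -(Sid _ xo) (bopB bS); apply: (subspB sB) => //; exact: Sin.
  move=> Bx; have : x - PB x = 0 by apply: (@ipxx_eq0 _ _ ip); exact: xo.
  by move/subr0_eq => <-.
have kerin x : kernel S x -> range B x.
  move=> /eqP; rewrite addr_eq0 opprK => /eqP ->; exact: PBin.
have kerE : range A `&` kernel (PB \o PA) = G' @` kernel S.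
  apply/seteqP; split=> y.
    move=> [Ax kx]; exists (G y); last by rewrite -[LHS]/((G' \o G) y) G'G.
    by rewrite /kernel /mkset -SG.
  move=> [x kx <-]; have Bx := kerin _ kx; split; first exact: G'Bin.
  rewrite /kernel /mkset /= SG; last exact: G'Bin.
  by rewrite -[G (G' x)]/((G \o G') x) GG'.
have dimK : has_dim (range A `&` kernel (PB \o PA)) n.
  rewrite /has_dim kerE; have := has_dim_mod_image bG' bG G'G GG' kS.
  by rewrite image_set1 (bop0 bG').
have codimR : has_dim_mod (range B) ((PB \o PA) @` range A) n.
  have [g [_ ig sg]] := rS; rewrite imE capE.
  (* The differences [g i - PB (g i)] are fixed by [S], hence lie in its range: cokernel
     representatives may be moved into [range B]. *)
  have dif (c : 'I_n -> R[i]) : range S (\sum_i c i *: (g i - PB (g i))).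
    apply: subsp_sum; first exact: subsp_range.
    move=> i; apply: subspZ; first exact: subsp_range.
    exists (g i - PB (g i)) => //; apply: Sid; exact: proj_compl.
  have difE (c : 'I_n -> R[i]) : \sum_i c i *: (g i - PB (g i)) =
      \sum_i c i *: g i - \sum_i c i *: PB (g i).
    by rewrite -sumrB; apply: eq_bigr => i _; rewrite scalerBr.
  have sS := subsp_range bS.
  exists (PB \o g); split=> [i|c [h _]|x Bx]; first exact: PBin.
    apply: ig; rewrite -(subrK (\sum_i c i *: PB (g i)) (\sum_i c i *: g i)) -difE.
    exact: subspD.
  have [c hc] := sg x Logic.I; exists c; split.
    have := subspD sS hc (dif c); rewrite difE addrA subrK; exact.
  apply: (subspB sB) => //; apply: subsp_sum => // i; exact: (subspZ _ sB (PBin _)).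
split; last first.
  rewrite /fredholm_index (dimE dimK) (codimE _ codimR) ?subrr//.
  by rewrite imE; rewrite image_comp; apply: subsp_range; exact: bounded_op_comp.
split; [|by rewrite imE capE; exact: closedI|by exists n|by exists n].
by move=> _ [x _ <-]; exact: PBin.
Qed.

End GLJ.

(** * Square roots and polar decompositions *)

Section SquareRoot.
Context {R : realType} {H : completeNormedModType R[i]}.
Variable ip : hdot H.
Implicit Types (x y z : H) (P T : H -> H).

Lemma ip_cvgs_eq2 (u v : nat -> H) x y x0 y0 : cvgs u x -> cvgs v y ->
  (forall n, ip (u n) y0 = ip x0 (v n)) -> ip x y0 = ip x0 y.
Proof.
move=> ux vy uv; apply/eqP; rewrite -subr_eq0 -cabs_eq0 eq_le cabs_ge0 andbT.
apply/ler_addgt0Pr => e e0; rewrite add0r.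
pose K := hnorm y0 + hnorm x0 + 1.
have K0 : 0 < K by have := hnorm_ge0 y0; have := hnorm_ge0 x0; rewrite /K; lra.
have eK : 0 < e / K by rewrite divr_gt0.
have [N NP] := ux _ eK; have [M MP] := vy _ eK.
have := NP _ (leq_maxl N M); have := MP _ (leq_maxr N M); set n := maxn N M.
rewrite !ltr_pdivlMr// => h1 h2.
have -> : ip x y0 - ip x0 y = ip (x - u n) y0 - ip x0 (y - v n).
  by rewrite ipBl ipBr uv opprB addrA subrK.
rewrite (le_trans (cabsD _ _))// cabsN.
have := cauchy_schwarz ip (x - u n) y0; have := cauchy_schwarz ip x0 (y - v n).
rewrite (hnorm_distC x) (hnorm_distC y).
have := hnorm_ge0 y0; have := hnorm_ge0 x0.
have := hnorm_ge0 (u n - x); have := hnorm_ge0 (v n - y).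
rewrite /K in h1 h2 *; move: (hnorm (u n - x)) (hnorm (v n - y)) h1 h2 => p q h1 h2.
move: (hnorm y0) (hnorm x0) h1 h2 => r s h1 h2 *.
case: (leP p q) => pq; nra.
Qed.

Lemma symmetric_positive T : bounded_op T -> (forall x y, ip (T x) y = ip x (T y)) ->
  (forall x, 0 <= complex.Re (ip (T x) x)) -> positive_op ip T.
Proof.
move=> bT sT pT; split=> // x; rewrite lecE /= pT andbT.
have := ipC ip (T x) x; rewrite -sT conjE.
by case: (ip (T x) x) => a b [] /=; lra.
Qed.

Section Root.
Variable P : H -> H.
Hypotheses (pP : positive_op ip P) (P1 : forall x, hnorm (P x) <= hnorm x).

Let Z x := x - P x.
Let bP : bounded_op P. Proof. by case: pP. Qed.
Let bZ : bounded_op Z. Proof. exact: bounded_op_sub bounded_op_id bP. Qed.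

Let Z1 x : hnorm (Z x) <= hnorm x.
Proof.
have P1' z : hnorm (P z) <= 1 * hnorm z by rewrite mul1r.
have := positive_contraction x pP ltr01 ler01 _ P1'; rewrite mulr1 lexx => /(_ isT).
have := positive_Re_ge0 x pP; rewrite rmorph1 scale1r -/(Z x) => p0 h.
by rewrite -(@ler_pXn2r _ 2) ?nnegrE ?hnorm_ge0//; lra.
Qed.

(* Newton-type iteration for [1 - sqrt (1 - Z)]; its increments are dominated
   by those of the same scalar iteration started from [Z = 1]. *)
Let Y := fix Y n : H -> H :=
  if n is m.+1 then fun x => 2^-1%:C *: (Z x + Y m (Y m x)) else fun=> 0.
Let y := fix y n : R := if n is m.+1 then 2^-1 * (1 + y m ^+ 2) else 0.

Let half0 : (0 : R) <= 2^-1. Proof. by rewrite invr_ge0 ler0n. Qed.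

Let y01 n : 0 <= y n <= 1.
Proof. by elim: n => [|n /andP[y0 y1]] /=; [rewrite lexx ler01|apply/andP; split; nra]. Qed.

Let bY n : bounded_op (Y n).
Proof.
elim: n => [|n IH]; first exact: bounded_op0.
apply: (bounded_op_scaled _ (T := fun x => Z x + Y n (Y n x))).
by apply: bounded_op_add bZ _; exact: bounded_op_comp.
Qed.

Let Yle n x : hnorm (Y n x) <= y n * hnorm x.
Proof.
elim: n x => [|n IH] x; first by rewrite /= hnorm0 mul0r.
rewrite [Y _ _]/= [y _]/= hnormZ cabs_pos// -mulrA ler_wpM2l// mulrDl mul1r.
rewrite (le_trans (hnormD _ _))// lerD//; rewrite (le_trans (IH _))// expr2 -mulrA.
by rewrite ler_wpM2l//; case/andP: (y01 n).
Qed.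

Let Yle1 n x : hnorm (Y n x) <= hnorm x.
Proof.
by rewrite (le_trans (Yle n x))// ler_piMl ?hnorm_ge0//; case/andP: (y01 n).
Qed.

Let Ysym n x z : ip (Y n x) z = ip x (Y n z).
Proof.
elim: n x z => [|n IH] x z; first by rewrite /= ip0l ip0r.
rewrite /= ipZl ipZr conj_real !ipDl !ipDr !IH; congr (_ * (_ + _)).
by rewrite ipNl ipNr (positive_sym _ _ pP).
Qed.

Let Yinc n x : hnorm (Y n.+1 x - Y n x) <= (y n.+1 - y n) * hnorm x.
Proof.
elim: n x => [|n IH] x.
  rewrite /= addr0 subr0 hnormZ cabs_pos// expr0n addr0 mulr1 subr0.
  by rewrite ler_wpM2l.
have -> : Y n.+2 x - Y n.+1 x = 2^-1%:C *: (Y n.+1 (Y n.+1 x - Y n x) +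
    (Y n.+1 (Y n x) - Y n (Y n x))).
  rewrite (bopB (bY n.+1)) addrA subrK.
  rewrite -[Y n.+2 x]/(2^-1%:C *: (Z x + Y n.+1 (Y n.+1 x))).
  rewrite -[X in _ - X]/(2^-1%:C *: (Z x + Y n (Y n x))).
  by rewrite -scalerBr opprD addrACA subrr add0r.
have -> : y n.+2 - y n.+1 = 2^-1 * (y n.+1 * (y n.+1 - y n) + (y n.+1 - y n) * y n).
  rewrite -[y n.+2]/(2^-1 * (1 + y n.+1 ^+ 2)) -[X in _ - X]/(2^-1 * (1 + y n ^+ 2)).
  by ring.
rewrite hnormZ cabs_pos// -mulrA ler_wpM2l// mulrDl (le_trans (hnormD _ _))//.
have d0 : 0 <= y n.+1 - y n.
  have := hnorm_ge0 x; rewrite subr_ge0 -[y n.+1]/(2^-1 * (1 + y n ^+ 2)).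
  have := sqr_ge0 (1 - y n); lra.
rewrite lerD//.
  by rewrite (le_trans (Yle _ _))// -mulrA ler_wpM2l//; case/andP: (y01 n.+1).
by rewrite (le_trans (IH _))// -mulrA ler_wpM2l.
Qed.

Lemma positive_root : exists2 M, positive_op ip M & M \o M = P.
Proof.
have /choice[W WP] : forall x, exists z, cvgs (fun n => Y n x) z.
  move=> x; apply: cauchys_cvg.
  apply: (@cauchys_dominated _ _ _ (fun n => y n * hnorm x) (hnorm x)) => n.
    by rewrite -mulrBl.
  by rewrite ler_piMl ?hnorm_ge0//; case/andP: (y01 n).
have W1 x : hnorm (W x) <= 1 * hnorm x.
  by rewrite mul1r; apply: (hnorm_cvgs_le (N := 0%N) (WP x)).
have bW : bounded_op W.
  apply: (@bounded_opI _ _ _ 1) => // c x z; apply: (cvgs_unique (WP _)).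
  apply: cvgs_ext (cvgsD (cvgsZ c (WP x)) (WP z)) => n.
  by rewrite (bY n).1.
have Wsym x z : ip (W x) z = ip x (W z).
  exact: (ip_cvgs_eq2 (WP x) (WP z) (fun n => Ysym n x z)).
have WW x : W x = 2^-1%:C *: (Z x + W (W x)).
  have h1 : cvgs (fun n => Y n.+1 x) (W x).
    by move=> e /(WP x)[N NP]; exists N => n Nn; apply: NP; rewrite leqW.
  apply: (cvgs_unique h1).
  apply: (cvgsZ _ (u := fun n => Z x + Y n (Y n x))).
  apply: cvgsD (cvgs_cst _) _ => e e0; have e2 : 0 < e / 2 by rewrite divr_gt0.
  have [N NP] := WP x _ e2; have [K KP] := WP (W x) _ e2; exists (maxn N K) => n.
  rewrite geq_max => /andP[/NP hN /KP hK].
  rewrite (le_lt_trans (hnorm_dist_trans (Y n (W x)) _ _))// -(bopB (bY n)).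
  by have := Yle1 n (Y n x - W x); lra.
(* [WW] says [2 W = Z + W^2] with [Z = id - P], that is, [(id - W)^2 = P]. *)
exists (fun x => x - W x).
  apply: symmetric_positive => [|x z|x].
  - exact: bounded_op_sub bounded_op_id bW.
  - by rewrite ipBl ipBr Wsym.
  - have := Re_ip_bound ip x W1; rewrite ipBl raddfB /= -hnorm_ip; lra.
apply/funext => x /=; rewrite (bopB bW).
have h2 : W x + W x = Z x + W (W x).
  rewrite {1 2}(WW x) -scalerDl -rmorphD /=.
  by rewrite (_ : 2^-1 + 2^-1 = 1 :> R) ?scale1r//; lra.
have -> : W (W x) = W x + W x - Z x by rewrite h2 addrC addKr.
by rewrite opprB [W x + W x - Z x - W x]addrAC addrK subrKA subKr.
Qed.

End Root.

Lemma modulus_exists A : bounded_op A ->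
  exists M, positive_op ip M /\ M \o M = adjoint ip A \o A.
Proof.
move=> bA; have [L L0 AL] := bounded_op_pos bA.
have L0' : L != 0 by rewrite gt_eqF.
have bA' := bounded_adjoint ip bA.
(* Rescaled to norm at most 1, the range in which the iteration converges; the root is multiplied
   back by [L]. *)
pose P x := (L ^- 2)%:C *: adjoint ip A (A x).
have L2 : 0 <= L ^- 2 by rewrite invr_ge0 sqr_ge0.
have bP : bounded_op P.
  exact: (bounded_op_scaled _ (bounded_op_comp bA' bA)).
have pP : positive_op ip P.
  split=> // x; rewrite ipZl adjointPl// ipxx -rmorphM ler0c.
  by rewrite mulr_ge0// sqr_ge0.
have P1 x : hnorm (P x) <= hnorm x.
  rewrite hnormZ cabs_pos// (le_trans (ler_wpM2l L2 (adjoint_bound ip (ltW L0) bA AL _)))//.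
  rewrite (le_trans (ler_wpM2l L2 (ler_wpM2l (ltW L0) (AL x))))//.
  by rewrite !mulrA -(mulrA (L ^- 2)) -expr2 mulVf ?mul1r// expf_neq0.
have [M pM MM] := positive_root pP P1.
exists (fun x => L%:C *: M x); split.
  split=> [|x]; first exact: bounded_op_scaled pM.1.
  by rewrite ipZl (positive_Re x pM) -rmorphM ler0c mulr_ge0 ?positive_Re_ge0// ltW.
apply/funext => x; rewrite /= (bopZ pM.1) scalerA -[M (M x)]/((M \o M) x) MM /P.
by rewrite scalerA -!rmorphM -expr2 mulfV ?rmorph1 ?scale1r// expf_neq0.
Qed.

Section Modulus.
Variable A : H -> H.
Hypothesis bA : bounded_op A.

Lemma modulusP : positive_op ip (modulus ip A) /\
  modulus ip A \o modulus ip A = adjoint ip A \o A.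
Proof. exact: (getPex (modulus_exists bA)). Qed.

Lemma modulus_pos : positive_op ip (modulus ip A).
Proof. by case: modulusP. Qed.

Lemma bounded_modulus : bounded_op (modulus ip A).
Proof. by case: modulus_pos. Qed.

Lemma modulus_sqr x : modulus ip A (modulus ip A x) = adjoint ip A (A x).
Proof. by rewrite -[LHS]/((modulus ip A \o modulus ip A) x) modulusP.2. Qed.

Lemma modulus_sym x y : ip (modulus ip A x) y = ip x (modulus ip A y).
Proof. exact: positive_sym modulus_pos. Qed.

Lemma modulus_ip x y : ip (modulus ip A x) (modulus ip A y) = ip (A x) (A y).
Proof. by rewrite modulus_sym modulus_sqr -adjointP. Qed.

Lemma hnorm_modulus x : hnorm (modulus ip A x) = hnorm (A x).
Proof.
apply/eqP; rewrite -(@eqrXn2 _ 2) ?hnorm_ge0//; apply/eqP/(@complexI R).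
by rewrite -!(ipxx ip) modulus_ip.
Qed.

Lemma kernel_modulus : kernel (modulus ip A) = kernel A.
Proof.
have h x : (modulus ip A x == 0) = (A x == 0) by rewrite -!hnorm_eq0 hnorm_modulus.
by apply/seteqP; split=> x /eqP hx; apply/eqP; [rewrite -h|rewrite h].
Qed.

End Modulus.

Section Polar.
Variable A : H -> H.
Hypothesis crA : closed_range A.

Let bA : bounded_op A. Proof. by case: crA. Qed.
Let a := modulus ip A.
Let N := kernel A.
Let PN := proj ip N.
Let pa : positive_op ip a. Proof. exact: modulus_pos. Qed.
Let ba : bounded_op a. Proof. by case: pa. Qed.
Let sN : subsp N. Proof. exact: subsp_kernel. Qed.
Let cN : closed N. Proof. exact: closed_kernel. Qed.
Let bPN : bounded_op PN. Proof. exact: bounded_proj. Qed.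

Let aPN x : a (PN x) = 0.
Proof.
have : kernel a (PN x) by rewrite /a kernel_modulus//; exact: proj_in.
by [].
Qed.

Lemma proj_kernel_modulus x : PN (a x) = 0.
Proof.
apply: (proj_orthc sN cN) => z Nz; rewrite modulus_sym//.
have : kernel (modulus ip A) z by rewrite kernel_modulus.
by rewrite /kernel /mkset => ->; rewrite ip0r.
Qed.

(** On N(A)^\perp, [d^2 |x|^2 <= |A x|^2 = |a x|^2 <= L <a x, x>], whence the constant [d^2 / L]. *)
Lemma modulus_lower : exists2 d : R, 0 < d &
  forall x, d * hnorm (x - PN x) ^+ 2 <= complex.Re (ip (a x) x).
Proof.
have [d d0 Ad] := closed_range_bounded_below ip crA.
have [L L0 aL] := bounded_op_pos ba.
exists (d ^+ 2 / L); first by rewrite divr_gt0 ?exprn_gt0.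
move=> x; rewrite mulrAC ler_pdivrMr// -exprMn.
have h : ip (a x) x = ip (a (x - PN x)) (x - PN x).
  rewrite (bopB ba) aPN subr0 ipBr (modulus_sym bA x (PN x)).
  by rewrite [modulus ip A (PN x)]aPN ip0r subr0.
rewrite h [leRHS]mulrC (le_trans _ (positive_hnorm_sqr _ pa L0 aL))//.
rewrite ler_pXn2r ?nnegrE ?mulr_ge0 ?hnorm_ge0 ?(ltW d0)//.
by rewrite /a hnorm_modulus//; apply: Ad; exact: proj_compl.
Qed.

(** The Moore-Penrose inverse of the modulus, obtained by inverting the coercive operator [a + PN]
    and cutting off N(A). *)
Lemma modulus_pinv : exists a', [/\ bounded_op a',
  forall x, a' (a x) = x - PN x, forall x, a (a' x) = x - PN x
  & forall x, PN (a' x) = 0].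
Proof.
have [d d0 ad] := modulus_lower.
pose a1 x := a x + PN x.
have ba1 : bounded_op a1 by exact: bounded_op_add ba bPN.
have PNE x : ip (PN x) x = (hnorm (PN x) ^+ 2)%:C.
  rewrite -(ipxx ip) -{2}[x](subrK (PN x)) ipDr.
  by rewrite (ip_eq0C (proj_compl ip sN cN x (proj_in ip sN cN x))) add0r.
have pa1 : positive_op ip a1.
  split=> // x; rewrite ipDl PNE addr_ge0//; first by case: pa.
  by rewrite ler0c sqr_ge0.
pose m := Num.min d 1.
have m0 : 0 < m by rewrite lt_min d0 ltr01.
have [|L [bL aL La]] := positive_invertible pa1 m0.
  move=> x; rewrite ipDl PNE raddfD /= (hnorm_proj ip sN cN x) -/PN.
  have m1 : m <= 1 by rewrite ge_min lexx orbT.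
  have m2 : m <= d by rewrite ge_min lexx.
  have := ad x; have := sqr_ge0 (hnorm (PN x)); have := sqr_ge0 (hnorm (x - PN x)).
  move: (_ ^+ 2) (_ ^+ 2) => p q; nra.
have PP x : PN (x - PN x) = 0.
  by apply: (proj_orthc sN cN); exact: proj_compl.
have a1E x : a1 (x - PN x) = a x by rewrite /a1 PP addr0 (bopB ba) aPN subr0.
have La1 x : L (a1 x) = x by rewrite -[LHS]/((L \o a1) x) La.
have a1L x : a1 (L x) = x by rewrite -[LHS]/((a1 \o L) x) aL.
have PL x : PN (L (x - PN x)) = 0.
  have := congr1 PN (a1L (x - PN x)); rewrite PP /a1 (bopD bPN) proj_kernel_modulus add0r.
  by rewrite [PN (PN _)](proj_id ip sN cN (proj_in ip sN cN _)).
exists (fun x => L (x - PN x)); split=> [|x|x|x].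
- exact: bounded_op_comp bL (bounded_op_sub bounded_op_id bPN).
- by rewrite proj_kernel_modulus subr0 -a1E La1.
- by have := a1L (x - PN x); rewrite /a1 PL addr0.
- exact: PL.
Qed.

Lemma polarP : [/\ partial_isometry ip (polar_isometry ip A),
  A = polar_isometry ip A \o modulus ip A & kernel (polar_isometry ip A) = kernel A].
Proof.
have [a' [ba' a'a aa' PNa']] := modulus_pinv.
have Nker z : N z -> a' z = 0.
  move=> Nz; have : N (a' z).
    rewrite /N -(kernel_modulus bA) /kernel /mkset -/a aa'.
    by rewrite [PN z](proj_id ip sN cN Nz) subrr.
  by move=> /(proj_id ip sN cN); rewrite -/PN PNa'.
have nV x : hnorm (A (a' x)) = hnorm (x - PN x).
  by rewrite -(hnorm_modulus bA) -/a aa'.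
suff : exists V, [/\ partial_isometry ip V, A = V \o modulus ip A & kernel V = kernel A].
  by move=> ex; exact: (getPex ex).
exists (A \o a'); split.
- split; first exact: bounded_op_comp.
  move=> x xo; rewrite /= !hnormE nV [PN x](proj_orthc sN cN) ?subr0// => z Nz.
  by apply: xo; rewrite /kernel /mkset /= Nker ?bop0.
- apply/funext => x; rewrite /= a'a (bopB bA).
  by rewrite (proj_in ip sN cN x : A (PN x) = 0) subr0.
- apply/seteqP; split=> z; rewrite /kernel /mkset /= => h.
    have : hnorm (z - PN z) = 0 by rewrite -nV h hnorm0.
    by move/eqP; rewrite hnorm_eq0 subr_eq0 => /eqP ->; exact: (proj_in ip sN cN z).
  by rewrite Nker ?bop0.
Qed.

Let V := polar_isometry ip A.

Lemma bounded_polar : bounded_op V.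
Proof. by case: polarP => -[]. Qed.

(** Makes the chosen [V] explicit: [A a' = V a a' = V (id - PN) = V], since [V] vanishes on N(A). *)
Lemma polarE a' : (forall x, a (a' x) = x - PN x) -> V = A \o a'.
Proof.
move=> aa'; have [_ AV kV] := polarP; apply/funext => x.
rewrite /= [in RHS]AV /= -/a -/V aa' (bopB bounded_polar).
by have : kernel V (PN x); [rewrite kV; exact: proj_in|move=> ->; rewrite subr0].
Qed.

Lemma adjoint_polar x : adjoint ip V (V x) = x - PN x.
Proof.
have [a' [ba' a'a aa' PNa']] := modulus_pinv.
apply: (adjoint_eq bounded_polar) => y.
rewrite (polarE aa') /= -(modulus_ip bA) -/a !aa' ipBl.
by rewrite (ip_eq0C (proj_compl ip sN cN x (proj_in ip sN cN y))) subr0.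
Qed.

End Polar.
End SquareRoot.

(** * Singular values *)

Section OpNorm.
Context {R : realType} {H : completeNormedModType R[i]}.
Implicit Types (x y z : H) (T : H -> H).

Definition opnorm T : R := sup [set hnorm (T x) | x in [set x | hnorm x <= 1]].

Lemma opnorm_has_sup T : bounded_op T ->
  has_sup [set hnorm (T x) | x in [set x | hnorm x <= 1]].
Proof.
move=> bT; have [C C0 TC] := bounded_op_pos bT; split.
  by exists (hnorm (T 0)), 0 => //=; rewrite hnorm0 ler01.
exists C => _ [x /= x1 <-]; rewrite (le_trans (TC x))//.
by rewrite ler_piMr// ltW.
Qed.

Lemma opnorm_ge0 T : bounded_op T -> 0 <= opnorm T.
Proof.
move=> bT; have := @ub_le_sup _ _ (opnorm_has_sup bT).2 (hnorm (T 0)).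
by rewrite (bop0 bT) hnorm0; apply; exists 0; rewrite /= ?(bop0 bT) hnorm0 ?ler01.
Qed.

Lemma opnormP T x : bounded_op T -> hnorm (T x) <= opnorm T * hnorm x.
Proof.
move=> bT; have [->|x0] := eqVneq x 0; first by rewrite (bop0 bT) hnorm0 mulr0.
have nx : 0 < hnorm x by rewrite hnorm_gt0.
rewrite -ler_pdivrMr// mulrC.
apply: (@ub_le_sup _ _ (opnorm_has_sup bT).2); exists ((hnorm x)^-1%:C *: x) => /=.
  by rewrite hnormZ cabs_pos ?invr_ge0 ?hnorm_ge0// mulVf// gt_eqF.
by rewrite (bopZ bT) hnormZ cabs_pos ?invr_ge0 ?hnorm_ge0.
Qed.

Lemma opnorm_le T C : 0 <= C -> (forall x, hnorm (T x) <= C * hnorm x) -> opnorm T <= C.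
Proof.
move=> C0 TC; apply: ge_sup.
  by exists (hnorm (T 0)), 0 => //=; rewrite hnorm0 ler01.
by move=> _ [x /= x1 <-]; rewrite (le_trans (TC x))// ler_piMr.
Qed.

End OpNorm.

Section Eigen.
Context {R : realType} {H : completeNormedModType R[i]}.
Variable ip : hdot H.
Implicit Types (x y z : H) (M T : H -> H).

(** Let [s] be the norm. If [id - s^-2 M^2] were injective, the Fredholm alternative would bound it
    below, and this would push the norm of [M] strictly under [s]. So [M^2 x = s^2 x] for some
    nonzero [x], and [M x + s x] is an eigenvector, nonzero by positivity. Using [M^2] ties the
    quadratic form directly to [|M x|^2]. *)
Lemma top_eigenvector M : positive_op ip M -> ess_small ip M -> 0 < opnorm M ->
  exists f, hnorm f = 1 /\ M f = (opnorm M)%:C *: f.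
Proof.
move=> pM eM; set s := opnorm M => s0; have bM := pM.1.
have sN0 : s != 0 by rewrite gt_eqF.
have s2 : 0 < s ^+ 2 by rewrite exprn_gt0.
pose t := s ^- 2; have t0 : 0 < t by rewrite invr_gt0.
pose C x := (- t)%:C *: M (M x).
have bMM : bounded_op (M \o M) by exact: bounded_op_comp.
have bC : bounded_op C by exact: (bounded_op_scaled _ bMM).
have eC : ess_small ip C.
  apply: (ess_small_compl (S := fun x => (- t)%:C *: x) (T := M \o M)).
    exact: bounded_op_scale.
  exact: ess_small_compl.
have MMx x : ip (M (M x)) x = (hnorm (M x) ^+ 2)%:C by rewrite (positive_sym _ _ pM) ipxx.
have pMM : positive_op ip (M \o M).
  by split=> // x; rewrite /= MMx ler0c sqr_ge0.
have MM_le x : hnorm ((M \o M) x) <= s ^+ 2 * hnorm x.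
  rewrite /= (le_trans (opnormP _ bM))// expr2 -mulrA.
  by rewrite ler_wpM2l ?(ltW s0)//; exact: opnormP.
have [inj|] := pselect (forall x, x + C x = 0 -> x = 0).
  have [L [bL _ LK]] := fredholm_alternative bC eC inj.
  have [K0 K00 LK0] := bounded_op_pos bL.
  pose K := K0 + 1; have K1 : 1 < K by rewrite /K; lra.
  have Kx x : hnorm x <= K * hnorm (x + C x).
    rewrite -{1}[x]/(id x) -LK (le_trans (LK0 _))// ler_wpM2r ?hnorm_ge0// /K; lra.
  have key x : hnorm (M x) ^+ 2 <= s ^+ 2 * (1 - K ^- 2) * hnorm x ^+ 2.
    have := positive_contraction x pMM s2 (ltW t0) _ MM_le.
    rewrite mulVf ?gt_eqF// lexx => /(_ isT) /=; rewrite MMx /=.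
    have -> : x - t%:C *: M (M x) = x + C x by rewrite /C rmorphN scaleNr.
    have : hnorm x ^+ 2 <= (K * hnorm (x + C x)) ^+ 2.
      by rewrite ler_pXn2r ?nnegrE ?mulr_ge0 ?hnorm_ge0//; lra.
    have K2 : 0 < K ^+ 2 by rewrite exprn_gt0//; lra.
    rewrite exprMn -ler_pdivrMl// => h1 h2.
    rewrite -mulrA mulrC -ler_pdivrMr// mulrC -/t mulrBl mul1r; lra.
  have K2 : 0 <= 1 - K ^- 2.
    rewrite subr_ge0 invf_le1 ?exprn_gt0 ?exprn_ege1//; lra.
  have : s <= s * Num.sqrt (1 - K ^- 2).
    apply: opnorm_le => [|x]; first by rewrite mulr_ge0 ?sqrtr_ge0// ltW.
    rewrite -(@ler_pXn2r _ 2) ?nnegrE ?mulr_ge0 ?sqrtr_ge0 ?hnorm_ge0 ?(ltW s0)//.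
    by rewrite !exprMn sqr_sqrtr.
  rewrite ler_pMr// leNgt -[X in _ < X]sqrtr1 ltr_sqrt ?ltr01//.
  by rewrite gtrBl invr_gt0 exprn_gt0//; lra.
move=> /existsNP[x /not_implyP[Cx /eqP x0]].
have MMxs : M (M x) = (s ^+ 2)%:C *: x.
  move/eqP: Cx; rewrite addr_eq0 /C rmorphN scaleNr opprK => /eqP {2}->.
  by rewrite scalerA -rmorphM /= mulfV ?gt_eqF// scale1r.
pose y := M x + s%:C *: x.
have My : M y = s%:C *: y.
  by rewrite /y (bopD bM) (bopZ bM) MMxs addrC scalerDr scalerA -rmorphM -expr2.
have y0 : y != 0.
  apply/eqP => y0; have := congr1 (fun z => complex.Re (ip z x)) y0.
  rewrite /y ipDl ipZl ipxx ip0l raddfD /= mul0r subr0.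
  have := positive_Re_ge0 x pM; have : 0 < s * hnorm x ^+ 2.
    by rewrite mulr_gt0// exprn_gt0// hnorm_gt0.
  lra.
have ny : hnorm y != 0 by rewrite hnorm_eq0.
exists ((hnorm y)^-1%:C *: y); split.
  by rewrite hnormZ cabs_pos ?invr_ge0 ?hnorm_ge0// mulVf.
by rewrite (bopZ bM) My !scalerA mulrC.
Qed.

Definition topvec M : H :=
  if opnorm M == 0 then 0 else
  get [set f | hnorm f = 1 /\ M f = (opnorm M)%:C *: f].

Lemma topvecP M : positive_op ip M -> ess_small ip M ->
  M (topvec M) = (opnorm M)%:C *: topvec M /\
  (if opnorm M == 0 then topvec M = 0 else hnorm (topvec M) = 1).
Proof.
move=> pM eM; rewrite /topvec; case: ifPn => [/eqP ->|M0].
  by rewrite (bop0 pM.1) scaler0.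
have M1 : 0 < opnorm M by rewrite lt_def M0 opnorm_ge0//; case: pM.
by have [] := getPex (top_eigenvector pM eM M1).
Qed.

Definition deflate M x :=
  M x - ((opnorm M)%:C * ip x (topvec M)) *: topvec M.

Section Deflate.
Variable M : H -> H.
Hypotheses (pM : positive_op ip M) (eM : ess_small ip M).
Let s := opnorm M.
Let f := topvec M.
Let P x := x - ip x f *: f.

Let Mf : M f = s%:C *: f. Proof. by case: (topvecP pM eM). Qed.
Let bM : bounded_op M. Proof. by case: pM. Qed.
Let s0 : 0 <= s. Proof. exact: opnorm_ge0. Qed.
Let bP : bounded_op P.
Proof. exact: bounded_op_sub bounded_op_id (bounded_rank1 ip f f). Qed.

Lemma ip_topvec : ip f f = (f != 0)%:R.
Proof.
have [->|f0] := eqVneq f 0; first by rewrite ip0l.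
have [_] := topvecP pM eM; rewrite -/f -/s; case: ifP => [_ f00|_ f1].
  by rewrite f00 eqxx in f0.
by rewrite ipxx f1 expr1n.
Qed.

Lemma deflateE x : deflate M x = M (P x).
Proof. by rewrite /deflate (bopB bM) (bopZ bM) Mf scalerA mulrC. Qed.

Let ipPf x : ip (P x) f = 0.
Proof.
rewrite /P ipBl ipZl ip_topvec; have [->|_] := eqVneq f 0.
  by rewrite ip0r mul0r subrr.
by rewrite mulr1 subrr.
Qed.

Lemma deflate_positive : positive_op ip (deflate M).
Proof.
have -> : deflate M = M \o P by apply/funext => x; exact: deflateE.
split=> [|x /=]; first exact: bounded_op_comp.
have -> : ip (M (P x)) x = ip (M (P x)) (P x); last by case: pM.
rewrite -[X in _ = ip _ X]/(x - ip x f *: f) ipBr ipZr (positive_sym (P x) f pM) Mf ipZr ipPf.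
by rewrite !mulr0 subr0.
Qed.

Lemma deflate_small : ess_small ip (deflate M).
Proof.
have -> : deflate M = M \o P by apply/funext => x; exact: deflateE.
exact: ess_small_compr.
Qed.

Lemma deflate_opnorm : opnorm (deflate M) <= opnorm M.
Proof.
apply: opnorm_le => // x; rewrite deflateE (le_trans (opnormP _ bM))//.
rewrite ler_wpM2l// -(@ler_pXn2r _ 2) ?nnegrE ?hnorm_ge0//.
have -> : hnorm x ^+ 2 = hnorm (P x) ^+ 2 + hnorm (ip x f *: f) ^+ 2.
  by rewrite -(@pythagoras _ _ ip) ?subrK// ipZr ipPf mulr0.
by rewrite lerDl sqr_ge0.
Qed.

Lemma deflate_topvec : deflate M f = 0.
Proof.
rewrite deflateE /P ip_topvec; have [->|_] := eqVneq f 0.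
  by rewrite scaler0 subrr (bop0 bM).
by rewrite scale1r subrr (bop0 bM).
Qed.

Lemma deflate_kernel x : M x = 0 -> deflate M x = 0.
Proof.
move=> Mx; have : ip x (M f) = 0 by rewrite -(positive_sym _ _ pM) Mx ip0l.
by rewrite Mf ipZr conj_real => h; rewrite /deflate h scale0r subr0.
Qed.

End Deflate.
End Eigen.

Section Spectral.
Context {R : realType} {H : completeNormedModType R[i]}.
Variable ip : hdot H.
Variable M : H -> H.
Hypotheses (pM : positive_op ip M) (eM : ess_small ip M).
Implicit Types (x y z : H).

(** Top eigenvectors are split off one at a time. Once the norm reaches zero, [topvec] is zero and
    the sequence goes on with zeros, the padding that [lists_singular_values] prescribes. *)
Definition deflated n := iter n (deflate ip) M.
Definition eigval n := opnorm (deflated n).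
Definition eigvec n := topvec (deflated n).

Let bM : bounded_op M. Proof. by case: pM. Qed.

Let inv n : positive_op ip (deflated n) /\ ess_small ip (deflated n).
Proof.
elim: n => [|n [p e]] //; split; first exact: deflate_positive.
exact: deflate_small.
Qed.

Let pD n := (inv n).1.
Let eD n := (inv n).2.

Lemma eigval_ge0 n : 0 <= eigval n.
Proof. by apply: opnorm_ge0; case: (pD n). Qed.

Lemma eigval_noninc m n : (m <= n)%N -> eigval n <= eigval m.
Proof.
elim: n => [|n IH]; first by rewrite leqn0 => /eqP ->.
rewrite leq_eqVlt => /predU1P[->//|]; rewrite ltnS => /IH; apply: le_trans.
exact: (deflate_opnorm (pD n) (eD n)).
Qed.

Let deflated_eigvec k n : (k < n)%N -> deflated n (eigvec k) = 0.
Proof.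
elim: n => // n IH; rewrite ltnS leq_eqVlt => /predU1P[->|/IH h].
  exact: (deflate_topvec (pD n) (eD n)).
exact: (deflate_kernel (pD n) (eD n)).
Qed.

Let deflated_eig n : deflated n (eigvec n) = (eigval n)%:C *: eigvec n.
Proof. by case: (topvecP (pD n) (eD n)). Qed.

Lemma eigvec_neq0 n : (eigvec n != 0) = (eigval n != 0).
Proof.
have [_] := topvecP (pD n) (eD n); rewrite -/(eigvec n) -/(eigval n).
case: ifP => [_ ->|_ f1]; first by rewrite eqxx.
by apply/eqP => f0; move: f1; rewrite f0 hnorm0 => /esym/eqP; rewrite oner_eq0.
Qed.

Lemma orthoseq_eigvec : orthoseq ip eigvec.
Proof.
have lt i j : (i < j)%N -> ip (eigvec j) (eigvec i) = 0.
  move=> ij; have [j0|j0] := eqVneq (eigvec j) 0; first by rewrite j0 ip0l.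
  have : (eigval j)%:C * ip (eigvec j) (eigvec i) = 0.
    by rewrite -ipZl -deflated_eig (positive_sym _ _ (pD j)) deflated_eigvec// ip0r.
  move=> /eqP; rewrite mulf_eq0 (fmorph_eq0 (real_complex R)).
  by rewrite eigvec_neq0 in j0; rewrite (negbTE j0) => /eqP.
move=> i j; have [->|] := eqVneq i j; first exact: ip_topvec (pD j) (eD j).
by case: (ltngtP i j) => // [/lt/ip_eq0C ->|/lt ->].
Qed.

Lemma deflated_sum n x :
  deflated n x = M x - \sum_(k < n) ((eigval k)%:C * ip x (eigvec k)) *: eigvec k.
Proof.
elim: n => [|n IH]; first by rewrite big_ord0 subr0.
by rewrite big_ord_recr /= opprD addrA -IH.
Qed.

Lemma eigvecP n : M (eigvec n) = (eigval n)%:C *: eigvec n.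
Proof.
rewrite -deflated_eig deflated_sum big1 ?subr0// => i _.
by rewrite orthoseq_eigvec gtn_eqF// mulr0 scale0r.
Qed.

Lemma deflatedE n x : deflated n x = M (x - psum ip eigvec n x).
Proof.
rewrite deflated_sum (bopB bM) (bop_sum bM); congr (_ - _); apply: eq_bigr => i _.
by rewrite (bopZ bM) eigvecP scalerA mulrC.
Qed.

(** If the eigenvalue of index [m = size us] exceeded [e], a nonzero combination of the first
    [m + 1] eigenvectors would be orthogonal to the [m] vectors of [us], and [M] would stretch it by
    more than [e]. *)
Lemma eigval_cvg0 (e : R) : 0 < e ->
  exists N, forall n, (N <= n)%N -> eigval n <= e.
Proof.
move=> e0; have [us hu] := eM e0; pose m := size us; exists m => n mn.
apply: le_trans (eigval_noninc mn) _; rewrite leNgt; apply/negP => em.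
pose A : 'M[R[i]]_(m.+1, m) := \matrix_(k, j) ip (eigvec k) us`_j.
have : kermx A != 0.
  by rewrite kermx_eq0 -row_leq_rank -ltnNge (leq_ltn_trans (rank_leq_col A)).
case/rowV0Pn => v /sub_kermxP vA v0; pose c k := v 0 (inord k).
have vc (k : 'I_m.+1) : v 0 k = c k by rewrite /c inord_val.
pose x := \sum_(k < m.+1) c k *: eigvec k.
have xo u : u \in us -> ip x u = 0.
  move=> /(nthP 0)[j jm <-]; rewrite ip_suml.
  have := congr1 (fun B : 'rV[R[i]]_m => B 0 (Ordinal jm)) vA; rewrite !mxE => h.
  by rewrite -[RHS]h; apply: eq_bigr => k _; rewrite ipZl -vc mxE.
have eig_norm (k : 'I_m.+1) : hnorm (eigvec k) = 1.
  rewrite (orthoseq_norm k orthoseq_eigvec) eigvec_neq0 gt_eqF//.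
  by rewrite (lt_trans e0)// (lt_le_trans em)// eigval_noninc// -ltnS.
have nx : hnorm x ^+ 2 = \sum_(k < m.+1) cabs (c k) ^+ 2.
  rewrite (hnorm_sum_ortho _ c orthoseq_eigvec); apply: eq_bigr => k _.
  by rewrite eig_norm mulr1.
have nMx : eigval m ^+ 2 * hnorm x ^+ 2 <= hnorm (M x) ^+ 2.
  have -> : M x = \sum_(k < m.+1) (c k * (eigval k)%:C) *: eigvec k.
    by rewrite (bop_sum bM); apply: eq_bigr => k _; rewrite (bopZ bM) eigvecP scalerA.
  rewrite (hnorm_sum_ortho _ (fun k => c k * (eigval k)%:C) orthoseq_eigvec) nx mulr_sumr.
  apply: ler_sum => k _; rewrite eig_norm mulr1 cabsM cabs_pos ?eigval_ge0//.
  rewrite exprMn mulrC ler_wpM2l ?sqr_ge0// ler_pXn2r ?nnegrE ?eigval_ge0//.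
  by rewrite eigval_noninc// -ltnS.
have x0 : 0 < hnorm x ^+ 2.
  rewrite lt_def sqr_ge0 andbT; apply: contra v0; rewrite nx psumr_eq0 => [|k _].
    move=> /allP c0; apply/eqP/rowP => k; rewrite mxE vc; apply/eqP.
    by rewrite -cabs_eq0 -sqrf_eq0; apply: c0; rewrite mem_index_enum.
  exact: sqr_ge0.
have : hnorm (M x) ^+ 2 <= e ^+ 2 * hnorm x ^+ 2.
  by rewrite -exprMn ler_pXn2r ?nnegrE ?mulr_ge0 ?hnorm_ge0 ?(ltW e0)// hu.
move/(le_trans nMx); rewrite ler_pM2r// ler_pXn2r ?nnegrE ?eigval_ge0 ?(ltW e0)//.
by rewrite leNgt em.
Qed.

(** Eigenvalues from [N] on are at most [l / 2], so finitely many indices carry [l]. A vector [y] of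
    the eigenspace orthogonal to their eigenvectors is orthogonal to every [eigvec k]; hence
    [l |y| = |deflated N y| <= (l / 2) |y|] and [y = 0]. *)
Lemma eigenspace_dim (l : R) : 0 < l ->
  exists2 n, has_dim [set x | M x = l%:C *: x] n
    & ([set k | eigval k = l] #= `I_n)%card.
Proof.
move=> l0; have l2 : 0 < l / 2 by rewrite divr_gt0.
have [N NP] := eigval_cvg0 l2.
pose L := [seq k <- iota 0 N | eigval k == l].
have memL k : (k \in L) = (eigval k == l).
  rewrite mem_filter mem_iota /= add0n; case: eqP => //= kl.
  by rewrite ltnNge; apply/negP => /NP; rewrite kl; lra.
have uL : uniq L by rewrite filter_uniq// iota_uniq.
have lC : l%:C != 0 :> R[i] by rewrite (fmorph_eq0 (real_complex R)) gt_eqF.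
exists (size L); last first.
  have -> : [set k | eigval k = l] = [set` [fset k in L]%fset].
    by apply/seteqP; split=> k /=; rewrite inE /= memL => /eqP.
  by apply/card_eq_fsetP; rewrite card_fseq undup_id.
pose e (i : 'I_(size L)) := eigvec (nth 0%N L i).
have inL (i : 'I_(size L)) : eigval (nth 0%N L i) = l.
  by apply/eqP; rewrite -memL mem_nth.
have ee i j : ip (e i) (e j) = (i == j)%:R.
  rewrite /e orthoseq_eigvec nth_uniq// eigvec_neq0 inL.
  by rewrite (gt_eqF l0) andbT.
exists e; split=> [i|c /= h i|x /= Mx].
- by rewrite /e /mkset eigvecP inL.
- have := congr1 (fun z => ip z (e i)) h; rewrite /= ip0l ip_suml (bigD1 i)//=.
  rewrite ipZl ee eqxx mulr1 big1 ?addr0// => j ji.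
  by rewrite ipZl ee (negbTE ji) mulr0.
exists (fun i => ip x (e i)); rewrite /=; set y := x - _.
have My : M y = l%:C *: y.
  rewrite /y (bopB bM) (bop_sum bM) Mx scalerBr; congr (_ - _).
  rewrite scaler_sumr; apply: eq_bigr => i _.
  by rewrite (bopZ bM) eigvecP inL !scalerA mulrC.
have yo k : ip y (eigvec k) = 0.
  have [kl|kl] := eqVneq (eigval k) l.
    have kL : k \in L by rewrite memL kl.
    have kL' : (index k L < size L)%N by rewrite index_mem.
    have -> : eigvec k = e (Ordinal kL') by rewrite /e nth_index.
    rewrite /y ipBl ip_suml (bigD1 (Ordinal kL'))//= ipZl ee eqxx mulr1 big1 ?addr0 ?subrr//.
    by move=> j ji; rewrite ipZl ee (negbTE ji) mulr0.
  have : l%:C * ip y (eigvec k) = (eigval k)%:C * ip y (eigvec k).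
    by rewrite -ipZl -My (positive_sym _ _ pM) eigvecP ipZr conj_real.
  move/eqP; rewrite -subr_eq0 -mulrBl -rmorphB mulf_eq0 (fmorph_eq0 (real_complex R)).
  by rewrite subr_eq0 eq_sym (negbTE kl) => /eqP.
apply: hnorm_le0; have := opnormP y (pD N).1; rewrite -/(eigval N).
rewrite deflatedE [psum _ _ _ _]big1 ?subr0 => [|i _]; last by rewrite yo scale0r.
rewrite My hnormZ cabs_pos ?(ltW l0)//.
have := NP N (leqnn N); have := hnorm_ge0 y; nra.
Qed.

End Spectral.

Section SingularValues.
Context {R : realType} {H : completeNormedModType R[i]}.
Variable ip : hdot H.
Variable D : H -> H.
Hypotheses (bD : bounded_op D) (eD : ess_small ip D).
Implicit Types s t : nat -> R.

Let pM : positive_op ip (modulus ip D). Proof. exact: modulus_pos. Qed.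
Let eM : ess_small ip (modulus ip D).
Proof.
by apply: (ess_small_dominated ler01 _ eD) => x; rewrite mul1r hnorm_modulus.
Qed.

Lemma lists_singular_values_eigval :
  lists_singular_values ip D (eigval ip (modulus ip D)).
Proof.
split; [exact: eigval_ge0|exact: eigval_noninc|exact: eigenspace_dim].
Qed.

(** Put [l = t n]. If [s n < l], every index where [s] equals [l] is below [n], where [t] equals [l]
    too. Both level sets have the dimension of the eigenspace as cardinality, so they coincide; but
    [n] belongs only to that of [t]. *)
Lemma lists_singular_values_ltF s t n : lists_singular_values ip D s ->
  lists_singular_values ip D t -> (forall k, (k < n)%N -> s k = t k) ->
  ~~ (s n < t n).
Proof.
move=> [s0 sd sl] [t0 td tl] st; apply/negP => stn.
have l0 : 0 < t n := le_lt_trans (s0 n) stn.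
have [m1 d1 c1] := sl _ l0; have [m2 d2 c2] := tl _ l0.
have m12 : m1 = m2 := has_dim_mod_unique (@subsp0 R H) d1 d2; subst m2.
have fin A m : (A #= `I_m)%card -> exists2 X : {fset nat}, A = [set` X] & #|` X|%fset = m.
  move=> Am; have /finite_fsetP[X AX] : finite_set A by apply/finite_setP; exists m.
  by exists X => //; apply/card_eq_fsetP; rewrite -AX.
have [X sX Xm] := fin _ _ c1; have [Y tY Ym] := fin _ _ c2.
have memX k : (k \in X) <-> s k = t n.
  by have := congr1 (fun A : set nat => A k) sX; rewrite /= => <-.
have memY k : (k \in Y) <-> t k = t n.
  by have := congr1 (fun A : set nat => A k) tY; rewrite /= => <-.
have lt k : k \in X -> (k < n)%N.
  move=> /memX kX; rewrite ltnNge; apply/negP => /sd; rewrite kX leNgt.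
  by rewrite stn.
have : n \in X.
  suff -> : X = Y by apply/memY.
  apply/eqP; rewrite eqEfcard Xm Ym leqnn andbT; apply/fsubsetP => k kX.
  by apply/memY; rewrite -st ?lt//; apply/memX.
by move/lt; rewrite ltnn.
Qed.

Lemma lists_singular_values_unique s t : lists_singular_values ip D s ->
  lists_singular_values ip D t -> s =1 t.
Proof.
move=> ls lt n; have [m] := ubnP n; elim: m n => // m IH n; rewrite ltnS => nm.
have st k : (k < n)%N -> s k = t k by move=> kn; apply: IH; exact: leq_trans nm.
apply/eqP; rewrite eq_le !leNgt (lists_singular_values_ltF ls lt st)//.
by rewrite (lists_singular_values_ltF lt ls)// => k /st.
Qed.

Lemma singular_valuesE : singular_values ip D = eigval ip (modulus ip D).
Proof.
apply/funext; apply: lists_singular_values_unique lists_singular_values_eigval.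
exact: (getPex (ex_intro _ _ lists_singular_values_eigval)).
Qed.

End SingularValues.

(** * Ky Fan inequality and majorization *)

Section KyFan.
Context {R : realType} {H : completeNormedModType R[i]}.
Variable ip : hdot H.
Implicit Types (x y : nat -> H) (z : H).

(** Measured from the threshold [s n], indices below [n] contribute at most [s k - s n] and the
    others at most zero; the weights then pay at most [n * s n] in total. *)
Lemma weighted_sum_le (s w : nat -> R) n N : (n <= N)%N ->
  (forall k l, (k <= l)%N -> s l <= s k) -> (forall k, 0 <= s k) ->
  (forall k, 0 <= w k <= 1) -> \sum_(k < N) w k <= n%:R ->
  \sum_(k < N) s k * w k <= \sum_(k < n) s k.
Proof.
move=> nN sd s0 w01 wn.
have h1 : \sum_(k < N) s k * w k <=
    \sum_(k < N) (s n * w k + (if (k < n)%N then s k - s n else 0)).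
  apply: ler_sum => k _; have /andP[wk0 wk1] := w01 k; case: ltnP => kn.
    by have := sd _ _ (ltnW kn); nra.
  by have := sd _ _ kn; nra.
apply: le_trans h1 _; rewrite big_split /= -mulr_sumr -big_mkcond /=.
rewrite -(big_ord_widen N (fun k => s k - s n) nN) sumrB sumr_const card_ord.
have := ler_wpM2l (s0 n) wn; rewrite -mulr_natr; lra.
Qed.

(** Unlike orthonormality, Bessel's inequality survives a contraction, which lets the Ky Fan
    inequality be applied to families such as [q^-1 V f]. *)
Definition bessel_family n x :=
  forall z, \sum_(i < n) cabs (ip z (x i)) ^+ 2 <= hnorm z ^+ 2.

Lemma bessel_family_orthoseq n x : orthoseq ip x -> bessel_family n x.
Proof. by move=> ox z; exact: bessel. Qed.

Lemma bessel_family_norm n x i : bessel_family n x -> (i < n)%N -> hnorm (x i) <= 1.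
Proof.
move=> bx i_n; have := bx (x i); rewrite (bigD1 (Ordinal i_n))//= => h.
have : cabs (ip (x i) (x i)) ^+ 2 <= hnorm (x i) ^+ 2.
  by apply: le_trans h; rewrite lerDl sumr_ge0// => j _; exact: sqr_ge0.
rewrite ipxx cabs_pos ?sqr_ge0//; have := hnorm_ge0 (x i).
move: (hnorm _) => r r0 h2; rewrite leNgt; apply/negP => r1.
have r2 : 1 < r ^+ 2 by rewrite expr_gt1.
by move: h2 r2; move: (r ^+ 2) => q; nra.
Qed.

Lemma bessel_family_op n x T (q : R) : bounded_op T -> 0 < q ->
  (forall z, hnorm (T z) <= q * hnorm z) -> bessel_family n x ->
  bessel_family n (fun i => q^-1%:C *: T (x i)).
Proof.
move=> bT q0 Tq bx z.
have h i : cabs (ip z (q^-1%:C *: T (x i))) ^+ 2 =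
    q ^- 2 * cabs (ip (adjoint ip T z) (x i)) ^+ 2.
  rewrite ipZr conj_real cabsM cabs_pos ?invr_ge0 ?(ltW q0)// exprMn exprVn.
  by rewrite adjointPl.
under eq_bigr do rewrite h; rewrite -mulr_sumr ler_pdivrMl ?exprn_gt0//.
rewrite (le_trans (bx _))// -exprMn ler_pXn2r ?nnegrE ?mulr_ge0 ?hnorm_ge0 ?(ltW q0)//.
exact: adjoint_bound (ltW q0) bT Tq z.
Qed.

Section Compact.
Variable D : H -> H.
Hypotheses (bD : bounded_op D) (eD : ess_small ip D).

Let M := modulus ip D.
Let pM : positive_op ip M. Proof. exact: modulus_pos. Qed.
Let eM : ess_small ip M.
Proof.
by apply: (ess_small_dominated ler01 _ eD) => x; rewrite mul1r hnorm_modulus.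
Qed.

Definition rsv := eigvec ip (modulus ip D).
(** Left singular vectors; where the singular value is zero, [0^-1 = 0] makes the vector zero. *)
Definition lsv k := (singular_values ip D k)^-1%:C *: D (rsv k).

Let s := singular_values ip D.
Let sE : s = eigval ip M. Proof. exact: singular_valuesE. Qed.

Lemma sv_ge0 k : 0 <= s k. Proof. by rewrite sE eigval_ge0. Qed.

Lemma sv_noninc k l : (k <= l)%N -> s l <= s k.
Proof. by rewrite sE; exact: eigval_noninc. Qed.

Lemma orthoseq_rsv : orthoseq ip rsv. Proof. exact: orthoseq_eigvec. Qed.

Lemma rsv_neq0 k : (rsv k != 0) = (s k != 0).
Proof. by rewrite sE eigvec_neq0. Qed.

Lemma D_rsv k : D (rsv k) = (s k)%:C *: lsv k.
Proof.
rewrite /lsv scalerA -rmorphM /=; have [s0|s0] := eqVneq (s k) 0.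
  rewrite -/(s k) s0 mul0r scale0r; apply: hnorm_le0.
  by have := rsv_neq0 k; rewrite s0 eqxx /= => /negbFE/eqP ->; rewrite (bop0 bD) hnorm0.
by rewrite mulfV// rmorph1 scale1r.
Qed.

Lemma orthoseq_lsv : orthoseq ip lsv.
Proof.
have h i j : ip (lsv i) (lsv j) = ((i == j) && (s i != 0))%:R.
  rewrite /lsv ipZl ipZr conj_real -modulus_ip// -/M !(eigvecP pM eM) -sE.
  rewrite ipZl ipZr conj_real orthoseq_rsv rsv_neq0.
  have [->|_] /= := eqVneq i j; last by rewrite !mulr0.
  have [->|s0] := eqVneq (s j) 0; first by rewrite !mulr0.
  by rewrite mulr1 mulrA mulrACA -mulrA -!rmorphM /= mulVf// mulr1 mulVf.
move=> i j; rewrite h; congr ((_ && _)%:R).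
apply/idP/idP => [si|]; last first.
  by apply: contra => /eqP si; rewrite /lsv -/(s i) si invr0 scale0r.
apply/eqP => l0; have := h i i; rewrite l0 ip0l eqxx si /= => /esym/eqP.
by rewrite oner_eq0.
Qed.

Lemma ip_D_sv k : ip (D (rsv k)) (lsv k) = (s k)%:C.
Proof.
rewrite D_rsv ipZl orthoseq_lsv eqxx /=; have [l0|l0] := eqVneq (lsv k) 0.
  rewrite mulr0; have := D_rsv k; rewrite l0 scaler0 => D0.
  have : hnorm (M (rsv k)) = 0 by rewrite hnorm_modulus// D0 hnorm0.
  rewrite (eigvecP pM eM) -sE hnormZ cabs_pos ?sv_ge0// (orthoseq_norm k orthoseq_rsv).
  by rewrite rsv_neq0; case: eqVneq => [->//|s0]; rewrite mulr1 => /eqP; rewrite (negbTE s0).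
by rewrite mulr1.
Qed.

Lemma sv_expansion N z : exists2 r, hnorm r <= s N * hnorm z &
  D z = \sum_(k < N) ((s k)%:C * ip z (rsv k)) *: lsv k + r.
Proof.
exists (D (z - psum ip rsv N z)).
  rewrite -(hnorm_modulus ip bD) -/M -(deflatedE pM eM) sE.
  apply: opnormP; rewrite (_ : deflated _ _ _ = fun u => M (u - psum ip rsv N u)).
    apply: (bounded_op_comp pM.1 (T := fun u => u - psum ip rsv N u)).
    exact: bounded_op_sub bounded_op_id (bounded_psum _ orthoseq_rsv).
  by apply/funext => x; rewrite deflatedE.
rewrite (bopB bD) addrC -[LHS](subrK (D (psum ip rsv N z))); congr (_ + _).
rewrite (bop_sum bD); apply: eq_bigr => k _.
by rewrite (bopZ bD) D_rsv scalerA mulrC.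
Qed.

(* Expanding [D] along its singular vectors writes the left-hand side as
   [\sum_k s_k w_k] with [0 <= w_k <= 1] and [\sum_k w_k <= n]. *)
Lemma ky_fan n x y : bessel_family n x -> bessel_family n y ->
  \sum_(i < n) cabs (ip (D (x i)) (y i)) <= \sum_(k < n) s k.
Proof.
move=> bx by_.
pose p i k := cabs (ip (x i) (rsv k)); pose q i k := cabs (ip (lsv k) (y i)).
pose w k := \sum_(i < n) p i k * q i k.
have amgm (a b : R) : a * b <= (a ^+ 2 + b ^+ 2) / 2.
  by have := sqr_ge0 (a - b); rewrite sqrrB; lra.
have pq0 i k : 0 <= p i k * q i k by rewrite mulr_ge0 ?cabs_ge0.
have w01 k : 0 <= w k <= 1.
  apply/andP; split; first by apply: sumr_ge0.
  have h1 : \sum_(i < n) p i k ^+ 2 <= 1.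
    under eq_bigr do rewrite /p ipC cabsJ.
    rewrite (le_trans (bx _))// expr_le1 ?hnorm_ge0//.
    exact: orthoseq_norm_le1 orthoseq_rsv.
  have h2 : \sum_(i < n) q i k ^+ 2 <= 1.
    rewrite (le_trans (by_ _))// expr_le1 ?hnorm_ge0//.
    exact: orthoseq_norm_le1 orthoseq_lsv.
  apply: (@le_trans _ _ (\sum_(i < n) (p i k ^+ 2 + q i k ^+ 2) / 2)).
    by apply: ler_sum => i _.
  rewrite -mulr_suml big_split /=; lra.
have wn N : \sum_(k < N) w k <= n%:R.
  rewrite exchange_big /= -[n in n%:R]card_ord -sumr_const; apply: ler_sum => i _.
  apply: (@le_trans _ _ (\sum_(k < N) (p i k ^+ 2 + q i k ^+ 2) / 2)).
    by apply: ler_sum => k _.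
  rewrite -mulr_suml big_split /=.
  have h1 : \sum_(k < N) p i k ^+ 2 <= 1.
    rewrite (le_trans (bessel _ _ orthoseq_rsv))// expr_le1 ?hnorm_ge0//.
    exact: bessel_family_norm bx (ltn_ord i).
  have h2 : \sum_(k < N) q i k ^+ 2 <= 1.
    under eq_bigr do rewrite /q ipC cabsJ.
    rewrite (le_trans (bessel _ _ orthoseq_lsv))// expr_le1 ?hnorm_ge0//.
    exact: bessel_family_norm by_ (ltn_ord i).
  by move: h1 h2; lra.
have main N : (n <= N)%N -> \sum_(i < n) cabs (ip (D (x i)) (y i)) <=
    \sum_(k < n) s k + n%:R * s N.
  move=> nN; apply: (@le_trans _ _ (\sum_(k < N) s k * w k + n%:R * s N)); last first.
    by rewrite lerD2r weighted_sum_le//; [exact: sv_noninc|exact: sv_ge0].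
  have -> : n%:R * s N = \sum_(i < n) s N by rewrite sumr_const card_ord mulr_natl.
  have -> : \sum_(k < N) s k * w k = \sum_(i < n) \sum_(k < N) s k * (p i k * q i k).
    rewrite exchange_big; apply: eq_bigr => k _; rewrite mulr_sumr//.
  rewrite -big_split; apply: ler_sum => i _ /=.
  have [r rs ->] := sv_expansion N (x i).
  rewrite ipDl (le_trans (cabsD _ _))// lerD//.
    rewrite ip_suml (le_trans (cabs_sum _ _ _))//; apply: ler_sum => k _.
    by rewrite ipZl !cabsM cabs_pos ?sv_ge0// mulrA.
  rewrite (le_trans (cauchy_schwarz _ _ _))//.
  have x1 := bessel_family_norm bx (ltn_ord i).
  have y1 := bessel_family_norm by_ (ltn_ord i).
  rewrite (@le_trans _ _ (s N * 1 * 1))//; last by rewrite !mulr1.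
  rewrite ler_pM ?hnorm_ge0// (le_trans rs)// ler_wpM2l//; exact: sv_ge0.
apply/ler_addgt0Pr => e e0.
(* The denominator [n + 1] rather than [n] covers [n = 0] and still makes the remainder [n * s N] at
   most [e]. *)
have [N0 NP] := eigval_cvg0 pM eM (divr_gt0 e0 (ltr0Sn R n)).
have sN := NP _ (leq_maxr n N0); have := main _ (leq_maxl n N0).
rewrite -sE ler_pdivlMr// in sN; have := sv_ge0 (maxn n N0).
rewrite -natr1 mulrDr mulr1 in sN; rewrite [n%:R * _]mulrC; lra.
Qed.

(** The singular vectors attain the bound of [ky_fan]; the two together characterize the partial
    sums variationally. *)
Lemma sv_sum n : \sum_(k < n) s k = complex.Re (\sum_(k < n) ip (D (rsv k)) (lsv k)).
Proof. by rewrite raddf_sum; apply: eq_bigr => k _; rewrite ip_D_sv. Qed.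

(** If [D \o Q] has norm at most [e], with [Q] removing the components along [f], then off the
    vectors [D (f k)] the adjoints of [D] and of [D \o Q] agree. *)
Lemma ess_small_adjoint : ess_small ip (adjoint ip D).
Proof.
move=> e e0; have [f [m [of_ Df]]] := ess_small_psum eD e0.
pose Q (u : H) := u - psum ip f m u.
have bQ : bounded_op Q by exact: bounded_op_sub bounded_op_id (bounded_psum m of_).
have DQ (u : H) : hnorm ((D \o Q) u) <= e * hnorm u.
  by rewrite (le_trans (Df u))// ler_wpM2l ?(ltW e0)// psum_compl_le.
exists [seq D (f k) | k <- iota 0 m] => z zo.
have -> : adjoint ip D z = adjoint ip (D \o Q) z.
  apply/esym/adjoint_eq => [|u]; first exact: bounded_op_comp.
  rewrite -adjointP// /= /Q (bopB bD) ipBl (bop_sum bD) ip_suml big1 ?subr0// => k _.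
  rewrite (bopZ bD) ipZl (ip_eq0C (zo (D (f k)) _)) ?mulr0//.
  by apply/mapP; exists (val k) => //; rewrite mem_iota add0n ltn_ord.
exact: (adjoint_bound ip (ltW e0) (bounded_op_comp bD bQ) DQ).
Qed.

End Compact.

Lemma Re_sum_le n (c : 'I_n -> R[i]) : complex.Re (\sum_i c i) <= \sum_i cabs (c i).
Proof. by rewrite (le_trans (Re_le_cabs _))// cabs_sum. Qed.

Lemma adjoint_majorized D : bounded_op D -> ess_small ip D ->
  weakly_majorized (singular_values ip (adjoint ip D)) (singular_values ip D).
Proof.
move=> bD eD n; have bD' := bounded_adjoint ip bD; have eD' := ess_small_adjoint bD eD.
rewrite (sv_sum bD' eD') (le_trans (Re_sum_le _))//.
under eq_bigr do rewrite adjointPl// ipC cabsJ.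
by apply: ky_fan => //; apply: bessel_family_orthoseq; [exact: orthoseq_lsv|exact: orthoseq_rsv].
Qed.

End KyFan.

(** * Total boundedness and compactness *)

Section TotallyBounded.
Context {R : realType} {H : completeNormedModType R[i]}.
Implicit Types (x y z : H) (S : set H).

Definition totally_bounded S := forall e : R, 0 < e -> exists xs : seq H,
  forall y, S y -> exists2 x, x \in xs & hnorm (y - x) < e.

(** An ultrafilter on the closure must contain one ball of each finite net, so it is Cauchy and
    converges by completeness. *)
Lemma totally_bounded_precompact S : totally_bounded S -> precompact S.
Proof.
move=> tS; rewrite precompactE compact_ultra => F FU FS.
have /cauchy_cvgP/cvg_ex[l Fl] : cauchy F.
  apply: cauchy_exP => _ /gt0_complex[e e0 ->].
  have e2 : 0 < e / 2 by rewrite divr_gt0.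
  have [xs xsP] := tS _ e2.
  apply: contrapT => /forallNP noF.
  have FC x : F (~` ball x e%:C).
    by have [/noF|] := in_ultra_setVsetC (ball x e%:C) FU.
  have FI : F (fun y => forall x, x \in xs -> ~ ball x e%:C y).
    elim: xs {xsP} => [|x xs IH]; first by apply: filterS filterT.
    apply: filterS (filterI (FC x) IH) => y [xy xsy] z.
    by rewrite inE => /predU1P[->//|]; exact: xsy.
  apply: (@filter_not_empty _ F _).
  apply: filterS (filterI FS FI) => y [cy ny].
  have e2c : (0 : R[i]) < (e / 2)%:C by rewrite ltcR.
  have [z [Sz yz]] := cy _ (nbhsx_ballx y _ e2c).
  have [x xxs zx] := xsP z Sz; apply: (ny x xxs).
  move: yz; rewrite -!ball_normE /= !hnormE !ltcR => yz.
  rewrite hnorm_distC; have := hnorm_dist_trans z y x; lra.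
exists l; split=> //.
by apply: (@closed_cvg _ _ F _ id (closure S) (@closed_closure _ S) FS l Fl).
Qed.

Lemma real_net (e : R) : 0 < e -> exists xs : seq R,
  forall a, `|a| <= 1 -> exists2 x, x \in xs & `|a - x| < e.
Proof.
move=> e0; pose n := (Num.truncn e^-1).+1.
have n0 : (0 : R) < n%:R by rewrite ltr0n.
have ne : n%:R^-1 < e by rewrite invf_plt ?posrE// truncnS_gt.
exists [seq k%:R / n%:R - 1 | k <- iota 0 (2 * n).+1] => a.
rewrite ler_norml => /andP[a1 a2].
have an : 0 <= (a + 1) * n%:R by rewrite mulr_ge0 ?(ltW n0)//; lra.
pose k := Num.truncn ((a + 1) * n%:R).
have /andP[k1 k2] := truncn_itv an; rewrite -/k in k1 k2.
exists (k%:R / n%:R - 1).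
  apply/mapP; exists k => //; rewrite mem_iota add0n ltnS /=.
  rewrite -(ler_nat R) (le_trans k1)// natrM ler_wpM2r ?(ltW n0)//; lra.
have -> : a - (k%:R / n%:R - 1) = ((a + 1) * n%:R - k%:R) / n%:R.
  by field; rewrite gt_eqF.
rewrite ger0_norm; last by rewrite divr_ge0 ?(ltW n0)// subr_ge0.
apply: lt_trans ne; rewrite ltr_pdivrMr// mulVf ?gt_eqF//.
by rewrite -natr1 in k2; lra.
Qed.

Lemma complex_net (e : R) : 0 < e -> exists cs : seq R[i],
  forall c, cabs c <= 1 -> exists2 d, d \in cs & cabs (c - d) < e.
Proof.
move=> e0; have e2 : 0 < e / 2 by rewrite divr_gt0.
have [xs xsP] := real_net e2.
exists [seq a +i* b | a <- xs, b <- xs] => -[a b] c1.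
have := cabs_sqr (a +i* b); rewrite /= => h.
have c2 : cabs (a +i* b) ^+ 2 <= 1 by rewrite expr_le1 ?cabs_ge0.
have [|x xx ax] := xsP a.
  by rewrite -(@expr_le1 _ 2)// real_normK ?num_real//; have := sqr_ge0 b; lra.
have [|y yy by_] := xsP b.
  by rewrite -(@expr_le1 _ 2)// real_normK ?num_real//; have := sqr_ge0 a; lra.
exists (x +i* y); first by apply/allpairsP; exists (x, y).
have -> : a +i* b - (x +i* y) = (a - x)%:C + 'i * (b - y)%:C.
  by apply/eqP; rewrite eq_complex /=; apply/andP; split; apply/eqP; ring.
rewrite (le_lt_trans (cabsD _ _))// cabsM !cabs_real.
have -> : cabs 'i = 1 :> R.
  by have := cabs_sqr ('i : R[i]); rewrite /= expr0n expr1n add0r => /eqP;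
    rewrite sqrp_eq1 ?cabs_ge0// => /eqP.
by rewrite mul1r; lra.
Qed.

Lemma combinations_totally_bounded n (v : nat -> H) :
  totally_bounded [set x | exists2 c : nat -> R[i], forall k, cabs (c k) <= 1
    & x = \sum_(k < n) c k *: v k].
Proof.
elim: n => [|n IH] e e0.
  exists [:: 0] => _ [c _ ->]; exists 0; first by rewrite inE.
  by rewrite big_ord0 subrr hnorm0.
have e2 : 0 < e / 2 by rewrite divr_gt0.
have [xs xsP] := IH _ e2.
have v1 : 0 < hnorm (v n) + 1 by have := hnorm_ge0 (v n); lra.
have [|cs csP] := @complex_net (e / 2 / (hnorm (v n) + 1)); first by rewrite divr_gt0.
exists [seq x + c *: v n | x <- xs, c <- cs] => _ [c c1 ->].
have [|x xx hx] := xsP (\sum_(k < n) c k *: v k); first by exists c.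
have [d dd hd] := csP _ (c1 n).
exists (x + d *: v n); first by apply/allpairsP; exists (x, d).
rewrite big_ord_recr /= opprD addrACA -scalerBl (le_lt_trans (hnormD _ _))//.
rewrite hnormZ; move: hd; rewrite ltr_pdivlMr// => hd.
have := cabs_ge0 (c n - d); lra.
Qed.

Variable ip : hdot H.

(** Bridge to the [compact_op] demanded by [am_closed]: up to [e / 2], the image of the unit ball
    consists of combinations of the [T (f k)], with coefficients of modulus at most 1. *)
Lemma ess_small_compact T : bounded_op T -> ess_small ip T -> compact_op T.
Proof.
move=> bT eT; split=> //; apply: totally_bounded_precompact => e e0.
have e2 : 0 < e / 2 by rewrite divr_gt0.
have [f [m [of_ Tf]]] := ess_small_psum eT e2.
have e2' : 0 < e / 2 by rewrite divr_gt0.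
have [xs xsP] := @combinations_totally_bounded m (T \o f) _ e2'.
exists xs => _ [x /= x1 <-]; have nx : hnorm x <= 1.
  by rewrite -lecR -hnormE.
have [|y yy hy] := xsP (T (psum ip f m x)).
  exists (fun k => ip x (f k)) => [k|].
    rewrite (le_trans (cauchy_schwarz _ _ _))//.
    by rewrite -[leRHS]mulr1 ler_pM ?hnorm_ge0// (orthoseq_norm_le1 _ of_).
  by rewrite (bop_sum bT); apply: eq_bigr => k _; rewrite (bopZ bT).
exists y => //; rewrite (le_lt_trans (hnorm_dist_trans (T (psum ip f m x)) _ _))//.
rewrite -(bopB bT); have := Tf x; have := psum_compl_le m x of_.
move=> h1 h2; have : e / 2 * hnorm (x - psum ip f m x) <= e / 2 * 1.
  by rewrite ler_wpM2l ?(ltW e2)// (le_trans h1).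
lra.
Qed.

End TotallyBounded.

(** * The Sylvester equation of the moduli *)

Section Sylvester.
Context {R : realType} {H : completeNormedModType R[i]}.
Variable ip : hdot H.
Implicit Types (x y z : H).

(* A solution [X] of [X = U X + X V + t D] with [U], [V] of norm below [1/2]
   inherits compactness and, up to a factor, the Ky Fan norms of [D]. *)
Variables (U V X D : H -> H) (q t : R).
Hypotheses (bU : bounded_op U) (bV : bounded_op V) (bX : bounded_op X)
  (bD : bounded_op D).
Hypotheses (q0 : 0 < q) (q1 : 2 * q < 1) (t0 : 0 < t).
Hypotheses (Uq : forall x, hnorm (U x) <= q * hnorm x)
  (Vq : forall x, hnorm (V x) <= q * hnorm x).
Hypothesis XE : forall x, X x = U (X x) + X (V x) + t%:C *: D x.
Hypothesis eD : ess_small ip D.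

(** One use of the equation trades an essential bound [m] for [2 q m + e]: the terms with [U] and
    [V] cost [q m] each, and the compact [t D] only [e]. *)
Lemma sylvester_small_step e m : 0 < e -> 0 <= m -> forall us, small_off ip X m us ->
  exists vs, small_off ip X (2 * q * m + e) vs.
Proof.
move=> e0 m0 us Xm; have [vs Dv] := ess_small_compl (bounded_op_scale t%:C) eD e0.
have h1 := small_off_compl (ltW q0) Uq Xm.
have h2 := small_off_compr m0 bV Vq Xm.
exists ((us ++ map (adjoint ip V) us) ++ vs).
have := small_offD (small_offD h1 h2) Dv.
rewrite (_ : q * m + q * m + e = 2 * q * m + e); last by ring.
by congr small_off; apply/funext => x; rewrite XE.
Qed.

Lemma sylvester_ess_small : ess_small ip X.
Proof.
pose E := [set m : R | 0 <= m /\ exists us, small_off ip X m us].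
have hE : has_inf E.
  split; last by exists 0 => m [].
  have [C C0 XC] := bounded_op_pos bX; exists C; split; first exact: ltW.
  by exists [::] => x _; exact: XC.
have i0 : inf E = 0.
  apply/eqP; rewrite eq_le; apply/andP; split; last first.
    by apply: lb_le_inf; [case: hE|move=> m []].
  rewrite leNgt; apply/negP => i0.
  have p0 : 0 < 1 - 2 * q by rewrite subr_gt0.
  (* The infimum of [E] is the essential norm [i] of [X]. With [p = 1 - 2q], a bound
     [m < (1 + p/2) i] followed by a step with error [p i / 4] gives a value below
     [(1 - p/4 - p^2/2) i], less than [i]. *)
  have e0 : 0 < (1 - 2 * q) / 2 * inf E by rewrite mulr_gt0// divr_gt0.
  have [m [m0 [us Xm]] mi] := inf_adherent e0 hE.
  have e1 : 0 < (1 - 2 * q) / 4 * inf E by rewrite mulr_gt0// divr_gt0.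
  have [vs Xv] := sylvester_small_step e1 m0 Xm.
  have : inf E <= 2 * q * m + (1 - 2 * q) / 4 * inf E.
    apply: ge_inf; first by case: hE.
    split; last by exists vs.
    have qm : 0 <= q * m by rewrite mulr_ge0 ?(ltW q0).
    by move: qm e1; lra.
  have : 2 * q * m <= 2 * q * (inf E + (1 - 2 * q) / 2 * inf E).
    by rewrite ler_wpM2l ?(ltW mi)// mulr_ge0// ltW.
  have w0 : 0 < (1 - 2 * q) * inf E by rewrite mulr_gt0.
  have w1 : 0 < (1 - 2 * q) * ((1 - 2 * q) * inf E) by rewrite mulr_gt0.
  by move: w0 w1; move: (inf E) => i; lra.
move=> e e0; have [m [m0 [us Xm]] mi] := inf_adherent e0 hE.
exists us => x xo; rewrite (le_trans (Xm x xo))// ler_wpM2r ?hnorm_ge0//.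
by move: mi; rewrite i0 add0r => /ltW.
Qed.

Lemma sylvester_majorized :
  weakly_majorized (singular_values ip X)
    (singular_values ip (fun x => (t / (1 - 2 * q))%:C *: D x)).
Proof.
move=> n; have eX := sylvester_ess_small; have p0 : 0 < 1 - 2 * q by rewrite subr_gt0.
set D' := fun x => _.
have bD' : bounded_op D' by exact: bounded_op_scaled bD.
have eD' : ess_small ip D' := ess_small_compl (bounded_op_scale _) eD.
have of_ := orthoseq_rsv bX eX; have og := orthoseq_lsv bX eX.
set f := rsv ip X in of_; set g := lsv ip X in og.
have bf := bessel_family_orthoseq n of_; have bg := bessel_family_orthoseq n og.
have bU' := bounded_adjoint ip bU.
(* Moving [U] to the right as an adjoint and keeping [V] on the left, the first two terms of the
   equation become [q] times pairings of [X] along Bessel families, so each is at most [q] times the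
   Ky Fan sum of [X]. Absorbing both produces the factor [t / (1 - 2q)]. *)
have Ug := bessel_family_op bU' q0 (adjoint_bound ip (ltW q0) bU Uq) bg.
have Vf := bessel_family_op bV q0 Vq bf.
have h1 := ky_fan bX eX bf Ug; have h2 := ky_fan bX eX Vf bg.
have h3 := ky_fan bD' eD' bf bg.
have qC : q%:C != 0 :> R[i] by rewrite (fmorph_eq0 (real_complex R)) gt_eqF.
have split3 i : cabs (ip (X (f i)) (g i)) <=
    q * cabs (ip (X (f i)) (q^-1%:C *: adjoint ip U (g i))) +
    q * cabs (ip (X (q^-1%:C *: V (f i))) (g i)) +
    (1 - 2 * q) * cabs (ip (D' (f i)) (g i)).
  rewrite [X in cabs (ip X _) <= _]XE !ipDl (le_trans (cabsD _ _))// lerD//.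
    rewrite (le_trans (cabsD _ _))// lerD//.
      rewrite ipZr conj_real cabsM cabs_pos ?invr_ge0 ?(ltW q0)// -adjointP//.
      by rewrite mulrA mulfV ?mul1r// gt_eqF.
    rewrite (bopZ bX) ipZl cabsM cabs_pos ?invr_ge0 ?(ltW q0)//.
    by rewrite mulrA mulfV ?mul1r// gt_eqF.
  rewrite /D' !ipZl !cabsM !cabs_pos ?(ltW t0)//; last by rewrite divr_ge0// ltW.
  by rewrite mulrA mulrCA mulfV ?mulr1// gt_eqF.
have := sv_sum bX eX n; rewrite -/f -/g => sX.
have sle : \sum_(i < n) singular_values ip X i <=
    \sum_(i < n) cabs (ip (X (f i)) (g i)) by rewrite sX Re_sum_le.
have := le_trans sle (ler_sum _ (fun i _ => split3 (val i))).
rewrite !big_split /= -!mulr_sumr.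
move: h1 h2 h3; move: (\sum_(i < n) singular_values ip X i) => s.
move: (\sum_(i < n) _) (\sum_(i < n) _) (\sum_(i < n) _) (\sum_(i < n) _).
move=> a b c d h1 h2 h3 h.
rewrite -(ler_pM2l p0); have := ler_wpM2l (ltW q0) h1.
have := ler_wpM2l (ltW q0) h2; have := ler_wpM2l (ltW p0) h3; lra.
Qed.

End Sylvester.

Section Polar.
Context {R : realType} {H : completeNormedModType R[i]}.
Variable ip : hdot H.
Hypothesis sepH : separable H.
Variable J : set (H -> H).
Hypothesis properJ : proper_ideal J.
Implicit Types (x y z : H).

Let iJ : operator_ideal J. Proof. by case: properJ. Qed.
Let J_small K : J K -> ess_small ip K.
Proof. by apply: ideal_ess_small => //; case: properJ. Qed.

Lemma am_closed_adjoint K : am_closed ip J -> J K -> J (adjoint ip K).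
Proof.
move=> amJ JK; have bK := ideal_bounded iJ JK; have eK := J_small JK.
apply: (amJ K) => //; last exact: adjoint_majorized.
  exact: ess_small_compact eK.
exact: (ess_small_compact (bounded_adjoint ip bK) (ess_small_adjoint bK eK)).
Qed.

Variables A B : H -> H.
Hypotheses (crA : closed_range A) (crB : closed_range B).

Let bA : bounded_op A. Proof. by case: crA. Qed.
Let bB : bounded_op B. Proof. by case: crB. Qed.
Let a := modulus ip A.
Let b := modulus ip B.
Let ba : bounded_op a. Proof. exact: bounded_modulus. Qed.
Let bb : bounded_op b. Proof. exact: bounded_modulus. Qed.

Section Half.
Variables (T : H -> H) (P : H -> H) (L d : R).
Hypotheses (pT : positive_op ip T) (d0 : 0 < d) (dL : d < L).
Hypotheses (TL : forall x, hnorm (T x) <= L * hnorm x)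
  (TP : forall x, T (P x) = T x)
  (Td : forall x, d * hnorm (P x) ^+ 2 <= complex.Re (ip (T x) x))
  (PP : forall x, P (P x) = P x) (P1 : forall x, hnorm (P x) <= hnorm x).

(** Half of [P x - L^-1 T (P x)]: the contraction estimate with step [1 / L] and the lower bound [d]
    shrink the square of the norm by [1 - d / L]. *)
Lemma half_contraction x :
  hnorm ((2^-1)%:C *: P x - ((2 * L)^-1)%:C *: T x) <= Num.sqrt (1 - d / L) / 2 * hnorm x.
Proof.
have L0 : 0 < L := lt_trans d0 dL.
have dL1 : 0 <= 1 - d / L by rewrite subr_ge0 ler_pdivrMr// mul1r ltW.
have -> : (2^-1)%:C *: P x - ((2 * L)^-1)%:C *: T x =
    (2^-1)%:C *: (P x - L^-1%:C *: T (P x)).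
  by rewrite scalerBr TP scalerA -rmorphM /= invfM.
rewrite hnormZ cabs_pos ?invr_ge0 ?ler0n// [_ / 2]mulrC -mulrA ler_wpM2l ?invr_ge0 ?ler0n//.
rewrite -(@ler_pXn2r _ 2) ?nnegrE ?mulr_ge0 ?sqrtr_ge0 ?hnorm_ge0// exprMn sqr_sqrtr//.
have Li : 0 <= L^-1 by rewrite invr_ge0 ltW.
have := positive_contraction (P x) pT L0 Li _ TL; rewrite mulVf ?gt_eqF// lexx => /(_ isT) h.
apply: le_trans h _; have := ler_wpM2l Li (Td (P x)); rewrite PP.
have : hnorm (P x) ^+ 2 <= hnorm x ^+ 2 by rewrite ler_pXn2r ?nnegrE ?hnorm_ge0.
move: (hnorm (P x) ^+ 2) (hnorm x ^+ 2) (complex.Re _) => p n r pn h.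
have : (1 - d / L) * p <= (1 - d / L) * n by rewrite ler_wpM2l.
by move: h; move: (L^-1) => e; lra.
Qed.

End Half.

Lemma modulus_sub_ideal : am_closed ip J -> J (A \- B) -> kernel A = kernel B ->
  J (a \- b).
Proof.
move=> amJ JAB kAB.
have sN := subsp_kernel bA; have cN := closed_kernel bA.
pose PN := proj ip (kernel A); pose P x := x - PN x.
have bPN : bounded_op PN by exact: bounded_proj.
have bP : bounded_op P by exact: bounded_op_sub bounded_op_id bPN.
have aPN x : a (PN x) = 0.
  have : kernel a (PN x) by rewrite /a kernel_modulus//; exact: (proj_in ip sN cN x).
  by [].
have bPN' x : b (PN x) = 0.
  have : kernel b (PN x).
    by rewrite /b kernel_modulus// -kAB; exact: (proj_in ip sN cN x).
  by [].
have PNa x : PN (a x) = 0 by exact: proj_kernel_modulus.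
have PNb x : PN (b x) = 0 by rewrite /PN kAB; exact: proj_kernel_modulus.
have PNP x : PN (P x) = 0 by apply: (proj_orthc sN cN); exact: proj_compl.
have PP x : P (P x) = P x by rewrite {1}/P PNP subr0.
have P1 x : hnorm (P x) <= hnorm x.
  rewrite -(@ler_pXn2r _ 2) ?nnegrE ?hnorm_ge0// (hnorm_proj ip sN cN x).
  by rewrite lerDr sqr_ge0.
have aP x : a (P x) = a x by rewrite (bopB ba) aPN subr0.
have bP' x : b (P x) = b x by rewrite (bopB bb) bPN' subr0.
have [da da0 ad] := modulus_lower ip crA; have [db db0 bd] := modulus_lower ip crB.
rewrite -/a -/PN in ad; rewrite -kAB -/b -/PN in bd.
have [La La0 aL] := bounded_op_pos ba; have [Lb Lb0 bL] := bounded_op_pos bb.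
(* A common lower bound and a common upper bound for both moduli. Adding [d] to [L] ensures [d < L],
   hence [q > 0]. *)
pose d := Num.min da db; pose L := La + Lb + d.
have d0 : 0 < d by rewrite lt_min da0.
have dL : d < L by rewrite /L; lra.
have L0 : 0 < L := lt_trans d0 dL.
have aL' x : hnorm (a x) <= L * hnorm x.
  by rewrite (le_trans (aL x))// ler_wpM2r ?hnorm_ge0// /L; lra.
have bL' x : hnorm (b x) <= L * hnorm x.
  by rewrite (le_trans (bL x))// ler_wpM2r ?hnorm_ge0// /L; lra.
have ad' x : d * hnorm (P x) ^+ 2 <= complex.Re (ip (a x) x).
  by apply: le_trans (ad x); rewrite ler_wpM2r ?sqr_ge0// ge_min lexx.
have bd' x : d * hnorm (P x) ^+ 2 <= complex.Re (ip (b x) x).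
  by apply: le_trans (bd x); rewrite ler_wpM2r ?sqr_ge0// ge_min lexx orbT.
pose q := Num.sqrt (1 - d / L) / 2; pose t := (2 * L)^-1.
have t0 : 0 < t by rewrite invr_gt0 mulr_gt0.
have dL0 : 0 < 1 - d / L by rewrite subr_gt0 ltr_pdivrMr// mul1r.
have q0 : 0 < q by rewrite divr_gt0// sqrtr_gt0.
have q1 : 2 * q < 1.
  rewrite /q mulrC divfK ?pnatr_eq0// -[ltRHS]sqrtr1 ltr_sqrt ?ltr01//.
  by rewrite ltrBlDr ltrDl divr_gt0.
pose U x := (2^-1)%:C *: P x - t%:C *: a x.
pose V x := (2^-1)%:C *: P x - t%:C *: b x.
have Uq := half_contraction (modulus_pos ip bA) d0 dL aL' aP ad' PP P1.
have Vq := half_contraction (modulus_pos ip bB) d0 dL bL' bP' bd' PP P1.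
have bU : bounded_op U by exact: bounded_op_sub (bounded_op_scaled _ bP) (bounded_op_scaled _ ba).
have bV : bounded_op V by exact: bounded_op_sub (bounded_op_scaled _ bP) (bounded_op_scaled _ bb).
pose X := a \- b; have bX : bounded_op X by exact: bounded_op_sub.
pose D := (adjoint ip A \o A) \- (adjoint ip B \o B).
have JD : J D.
  (* [A^* A - B^* B = A^* (A - B) + (A - B)^* B]. *)
  have h1 := ideal_compl iJ (bounded_adjoint ip bA) JAB.
  have h2 := ideal_compr iJ bB (am_closed_adjoint amJ JAB).
  have := idealD iJ h1 h2; congr J; apply/funext => x /=.
  rewrite (bopB (bounded_adjoint ip bA)).
  have -> : adjoint ip (A \- B) (B x) = adjoint ip A (B x) - adjoint ip B (B x).
    apply: adjoint_eq => [|z]; first exact: bounded_op_sub.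
    by rewrite ipBl ipBr !adjointP.
  by rewrite addrA subrK.
have bD := ideal_bounded iJ JD; have eD := J_small JD.
(* [a X + X b = a ^ 2 - b ^ 2 = D], and [P] acts as the identity on [X]. *)
have XE x : X x = U (X x) + X (V x) + t%:C *: D x.
  have PX : P (X x) = X x by rewrite /P /X /= (bopB bPN) PNa PNb subrr subr0.
  have XP : X (P x) = X x by rewrite /X /= aP bP'.
  have -> : X (V x) = (2^-1)%:C *: X x - t%:C *: X (b x).
    by rewrite /V (bopB bX) !(bopZ bX) XP.
  rewrite /U PX addrACA -scalerDl -rmorphD /=.
  rewrite (_ : 2^-1 + 2^-1 = 1 :> R); last by lra.
  rewrite rmorph1 scale1r -opprD -scalerDr -addrA addrC -scalerN -scalerDr.
  suff -> : - (a (X x) + X (b x)) + D x = 0 by rewrite scaler0 add0r.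
  have -> : D x = a (X x) + X (b x).
    by rewrite /D /X /= -!(modulus_sqr ip)// -/a -/b (bopB ba) subrKA.
  exact: addNr.
have eX := sylvester_ess_small bV bX q0 q1 Uq Vq XE eD.
apply: (amJ (fun x => (t / (1 - 2 * q))%:C *: D x)).
- exact: ess_small_compact (bounded_op_scaled _ bD) (ess_small_compl (bounded_op_scale _) eD).
- exact: ess_small_compact bX eX.
- exact: idealZ.
- exact: (sylvester_majorized bU bV bX bD q0 q1 t0 Uq Vq XE eD).
Qed.

Lemma polar_sub_ideal : J (A \- B) -> kernel A = kernel B -> J (a \- b) ->
  J (polar_isometry ip A \- polar_isometry ip B).
Proof.
move=> JAB kAB Jab.
have [a' [ba' a'a aa' PNa']] := modulus_pinv ip crA.
have [b' [bb' b'b bb'E PNb']] := modulus_pinv ip crB.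
rewrite (polarE crA aa') (polarE crB bb'E).
rewrite -kAB -/a -/b in a'a aa' b'b bb'E PNb' *.
have h1 := ideal_compr iJ ba' JAB.
have h2 := ideal_compl iJ bB (ideal_compl iJ ba' (ideal_compr iJ bb' (idealBC iJ Jab))).
have := idealD iJ h1 h2; congr J; apply/funext => x /=.
(* Resolvent identity [a' - b' = a' (b - a) b']. It holds for pseudo-inverses because both moduli
   have the same kernel: [a'] kills N(A) and [b'] takes its values in N(A)^\perp. *)
suff -> : a' (b (b' x) - a (b' x)) = a' x - b' x by rewrite (bopB bB) addrA subrK.
have sN := subsp_kernel bA; have cN := closed_kernel bA.
have a'PN : a' (proj ip (kernel A) x) = 0.
  set y := proj _ _ _; have yN : proj ip (kernel A) y = y.
    exact: (proj_id ip sN cN (proj_in ip sN cN x)).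
  have : a (a' y) = 0 by rewrite aa' yN subrr.
  have := a'a (a' y); rewrite PNa' subr0 => + h; rewrite h => <-.
  exact: bop0.
by rewrite bb'E (bopB ba') a'a PNb' subr0 (bopB ba') a'PN subr0.
Qed.

(** Each product is the projection onto the orthogonal complement of the kernel, and the
    complementary projection has the kernel as its range. *)
Lemma polar_kernel : adjoint ip (polar_isometry ip A) \o polar_isometry ip A =
  adjoint ip (polar_isometry ip B) \o polar_isometry ip B <-> kernel A = kernel B.
Proof.
split=> [h|kAB]; last first.
  by apply/funext => x; rewrite /= !adjoint_polar// kAB.
have E x : x - proj ip (kernel A) x = x - proj ip (kernel B) x.
  by have := congr1 (fun f => f x) h; rewrite /= !adjoint_polar.
have E' x : proj ip (kernel A) x = proj ip (kernel B) x.
  by apply: oppr_inj; apply: (addrI x); exact: E.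
have {E'}/funext E' : proj ip (kernel A) =1 proj ip (kernel B) by [].
rewrite -(range_proj ip (subsp_kernel bA) (closed_kernel bA)) E'.
exact: range_proj (subsp_kernel bB) (closed_kernel bB).
Qed.

(** [A - B = V_A (|A| - |B|) + (V_A - V_B) |B|]. *)
Lemma polar_factors_ideal : J (a \- b) ->
  J (polar_isometry ip A \- polar_isometry ip B) -> J (A \- B).
Proof.
move=> Jab JV; have [_ AV _] := polarP ip crA; have [_ BV _] := polarP ip crB.
have h1 := ideal_compl iJ (bounded_polar ip crA) Jab.
have h2 := ideal_compr iJ bb JV.
have := idealD iJ h1 h2; congr J; apply/funext => x /=.
rewrite (bopB (bounded_polar ip crA)) addrA subrK.
by rewrite [in RHS]AV [in RHS]BV.
Qed.

End Polar.

Theorem theorem3p5 (R : realType) (H : completeNormedModType R[i])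
    (ip : {dot H for Num.conj}) (ip_norm : forall x, ip x x = `|x| ^+ 2)
    (sepH : separable H) (infH : ~ exists n, has_dim [set: H] n)
    (A B : H -> H) (crA : closed_range A) (crB : closed_range B)
    (J : set (H -> H)) (properJ : proper_ideal J) :
  let cond_i := exists2 G, GLJ J G & G \o A = B in
  let cond_ii := J (A \- B) /\ kernel A = kernel B in
  let VA := polar_isometry ip A in
  let VB := polar_isometry ip B in
  let cond_iii := [/\ J (modulus ip A \- modulus ip B), J (VA \- VB)
                    & adjoint ip VA \o VA = adjoint ip VB \o VB] in
  let PA := ortho_proj ip (range A) in
  let PB := ortho_proj ip (range B) in
  [/\ cond_i <-> cond_ii,
      cond_i \/ cond_ii -> fredholm_pair PA PB /\ ess_codim PA PB = 0
    & am_closed ip J -> (cond_i <-> cond_iii) /\ (cond_ii <-> cond_iii)].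
Proof.
move=> cond_i cond_ii VA VB cond_iii PA PB.
pose hip := HDot ip_norm.
have h12 : cond_i <-> cond_ii.
  split; first exact: GLJ_factor_kernel.
  by case; exact: (kernel_factor_GLJ hip sepH properJ crA crB).
have h23 : am_closed ip J -> (cond_ii <-> cond_iii).
  move=> amJ; have kP := polar_kernel hip crA crB.
  split=> [[JAB kAB]|[Jm JV /kP kAB]].
    have Jm := modulus_sub_ideal (ip := hip) sepH properJ crA crB amJ JAB kAB.
    split=> //; last exact/kP.
    exact: (polar_sub_ideal (ip := hip) properJ crA crB JAB kAB Jm).
  by split=> //; exact: (polar_factors_ideal (ip := hip) properJ crA crB Jm JV).
split=> // [h|amJ].
  apply: (GLJ_factor_fredholm hip sepH properJ crA crB).
  by case: h => // /h12.
by split; [exact: iff_trans h12 (h23 amJ)|exact: h23].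
Qed.
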